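(* A foliated Lie algebroid $(A,B)$ over $(M,\mathcal{F})$ is equivalent with a couple $(E^*,W)$, where $E^*$ is an $\mathcal{F}$-foliated vector subbundle of $A^*$ and $W$ is a homological super-vector field of degree $1$ on $\Pi A^*$ such that i) $W$ is foliated (projectable) with respect to the super-foliation $\bar{\mathcal{F}}$ of $\Pi A^*$ associated to the pair $(\mathcal{F},B)$, ii) $W|_{\Pi(A^*/E^* )}\in T\bar{\mathcal{F}}\cap T\Pi(A^*/E^* )$ and is a homological super-vector field of degree $1$ on $\Pi(A^*/E^* )$, transitive over the leaves of $\mathcal{F}$.
   Context: All objects are $C^\infty$. $(M,\mathcal{F})$ is a foliated manifold, with local adapted coordinates $(x^a,y^u)$ in which the leaves are $x^a=\mathrm{const}$; $T\mathcal{F}$ is the tangent bundle of the leaves; a function is foliated if it is constant on leaves. A foliated vector bundle over $(M,\mathcal{F})$ is a vector bundle with a maximal atlas of local trivializations whose local bases (foliated bases) are related by matrices of foliated functions; the dual of a foliated bundle is foliated by dual bases. Foliated Lie algebroid $(A,B)$ over $(M,\mathcal{F})$: $A$ is a Lie algebroid on $M$ (anchor $\sharp_A$, bracket $[\,,\,]_A$), $B\subseteq A$ is a Lie subalgebroid, $\sharp_A(B)=T\mathcal{F}$, and locally $\Gamma A$ is spanned over $C^\infty(M)$ by the $B$-foliated sections, i.e. the sections $a$ with $[b,a]_A\in\Gamma B$ for all $b\in\Gamma B$. $\Pi A^*$ (parity-changed bundle): the supermanifold with even coordinates $x^i$ (coordinates of $M$) and odd coordinates $\bar\eta^\alpha$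 attached to local bases $(a_\alpha)$ of $\Gamma A$, with transition functions $\tilde{\bar\eta}^\alpha=b^\alpha_\beta\bar\eta^\beta$ when $a_\beta=b^\alpha_\beta\tilde a_\alpha$; similarly for other bundles. A super-vector field on it is of degree $1$ if it has the local form $\frac12\alpha_{\beta\gamma}^\lambda(x)\bar\eta^\beta\bar\eta^\gamma\frac{\partial}{\partial\bar\eta^\lambda}+\alpha_\beta^i(x)\bar\eta^\beta\frac{\partial}{\partial x^i}$; a super-vector field $V$ of degree $1$ is homological if $[V,V]=0$. Notation for the pair $(\mathcal{F},B)$: $B$ is a subbundle of $A$, $E=A/B$, and $E^*=\mathrm{ann}\,B\subseteq A^*$ (so $B=\mathrm{ann}\,E^*$). Take adapted coordinates $(x^a,y^u)$ on $M$ and local bases $(b_h,a_q)$ of $\Gamma A$ with $(b_h)$ a basis of $\Gamma B$ and the classes of $a_q$ a foliated basis of $E$; let $(x^a,y^u,\bar\eta^h,\bar\zeta^q)$ be the corresponding coordinates on $\Pi A^*$. The super-foliation $\bar{\mathcal{F}}$ is the one with $T\bar{\mathcal{F}}=\mathrm{span}\{\partial/\partial y^u,\partial/\partial\bar\eta^h\}$. $W$ is foliated (projectable) if the coefficients of $\partial/\partial x^a$ and $\partial/\partial\bar\zeta^q$ in $W$ depend only on $(x^a,\bar\zeta^q)$. $\Pi(A^*/E^* )$ is seen as the submanifold of $\Pi A^*$ with local equations $\bar\zeta^q=0$. A degree $1$ field $\frac12\beta_{hk}^l\bar\eta^h\bar\eta^k\frac{\partial}{\partial\bar\eta^l}+\beta_h^u\bar\eta^h\frac{\partial}{\partial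 y^u}$ on $\Pi(A^*/E^* )$ is transitive over the leaves of $\mathcal{F}$ if $\mathrm{rank}(\beta^u_h)=\dim\mathcal{F}$ (the leaf dimension). *)

(* Defs.v *)
From HB Require Import structures.
From Stdlib Require Import Relation_Operators.
From mathcomp Require Import all_boot all_order all_algebra.
From mathcomp Require Import all_classical all_reals all_analysis.

Set Implicit Arguments.
Unset Strict Implicit.
Unset Printing Implicit Defensive.

Import Order.TTheory GRing.Theory Num.Theory.
Import numFieldNormedType.Exports.

Local Open Scope classical_set_scope.
Local Open Scope ring_scope.

Section Smooth.
Variables (R : realType) (n : nat).
Implicit Types (U : set 'rV[R]_n) (f g : 'rV[R]_n -> R).

Fixpoint Ck (k : nat) U f : Prop :=
  if k is k'.+1 then
    (forall x, U x -> differentiable f x) /\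
    (forall v, Ck k' U (fun x => 'D_v f x))
  else forall x, U x -> {for x, continuous f}.

Definition Cinf U f : Prop := forall k, Ck k U f.

Lemma near_eq_on U f g x : open U -> {in U, f =1 g} -> U x ->
  \forall y \near x, f y = g y.
Proof.
move=> oU fg Ux; have := open_nbhs_nbhs (conj oU Ux).
by apply: filterS => y Uy; apply: fg; rewrite inE.
Qed.

Lemma near_eq_differentiable f g x :
  (\forall y \near x, f y = g y) -> differentiable f x -> differentiable g x.
Proof.
move=> fg df; have fgx : f x = g x := nbhs_singleton fg.
have gE : g \o shift x = cst (g x) + 'd f x +o_ 0 id.
  apply/eqaddoP => e e0.
  have /eqaddoP/(_ e e0) := diff_locally df.
  have fg0 : \forall h \near (0 : 'rV[R]_n), f (h + x) = g (h + x).
    have := fg; rewrite (near_shift 0 x); apply: filterS => h /=.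
    by rewrite subr0.
  by apply: filterS2 fg0 => h /= fgh; rewrite !fctE /= fgh fgx.
have dc : continuous ('d f x) by exact: diff_continuous.
have dE := diff_unique dc gE.
by apply/diff_locallyP; rewrite dE; split.
Qed.

Lemma Ck_ext k U f g : open U -> {in U, f =1 g} -> Ck k U f -> Ck k U g.
Proof.
move=> oU; elim: k f g => [|k IH] f g fg /=.
  move=> cf x Ux; have fgx := near_eq_on oU fg Ux.
  move=> P; rewrite -(nbhs_singleton fgx) => /(cf x Ux).
  by apply: filterS2 fgx => y /= <-.
case=> df Df; split=> [x Ux|v].
  exact: near_eq_differentiable (near_eq_on oU fg Ux) (df x Ux).
apply: IH (Df v) => x; rewrite inE => Ux.
by apply: near_eq_derive; apply: near_eq_on fg Ux.
Qed.

Lemma CkS k U f : Ck k.+1 U f -> Ck k U f.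
Proof.
elim: k f => [|k IH] f [df Df].
  by move=> x Ux; apply: differentiable_continuous; apply: df.
by split=> // v; apply: IH; apply: Df.
Qed.

Lemma CkD k U f g : open U -> Ck k U f -> Ck k U g ->
  Ck k U (fun x => f x + g x).
Proof.
move=> oU; elim: k f g => [|k IH] f g /=.
  by move=> cf cg x Ux; apply: continuousD; [apply: cf|apply: cg].
move=> [df Df] [dg Dg]; split=> [x Ux|v].
  by apply: differentiableD; [apply: df|apply: dg].
apply: Ck_ext (IH _ _ (Df v) (Dg v)) => // x; rewrite inE => Ux /=.
by rewrite -deriveD //; apply: diff_derivable; [apply: df|apply: dg].
Qed.

Lemma CkM k U f g : open U -> Ck k U f -> Ck k U g ->
  Ck k U (fun x => f x * g x).
Proof.
move=> oU; elim: k f g => [|k IH] f g.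
  by move=> cf cg x Ux; apply: continuousM; [apply: cf|apply: cg].
move=> Cf Cg; have [df Df] := Cf; have [dg Dg] := Cg; split=> [x Ux|v].
  by apply: differentiableM; [apply: df|apply: dg].
have H := CkD oU (IH _ _ (CkS Cf) (Dg v)) (IH _ _ (CkS Cg) (Df v)).
apply: Ck_ext H => // x; rewrite inE => Ux /=.
by rewrite -[LHS](deriveM (f:=f) (g:=g)) //; apply: diff_derivable;
   [apply: df|apply: dg].
Qed.

End Smooth.

Record chart (R : realType) (n : nat) (M : topologicalType) := Chart {
  cdom : set M;
  cmap : M -> 'rV[R]_n;
  cinv : 'rV[R]_n -> M;
  cdom_open : open cdom;
  cimg_open : open (cmap @` cdom);
  cmapK : forall x, cdom x -> cinv (cmap x) = x;
  cmap_cts : forall x, cdom x -> {for x, continuous cmap};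
  cinv_cts : forall v, (cmap @` cdom) v -> {for v, continuous cinv} }.

(* The atlas is not required to be maximal.  [chart_at x] is a preferred chart
   around x; it only serves to realize the tangent space at x. *)
Record manifold (R : realType) (n : nat) := Manifold {
  mcarrier :> topologicalType;
  mhausdorff : hausdorff_space mcarrier;
  msecond_countable : @second_countable mcarrier;
  atlas : set (chart R n mcarrier);
  chart_at : mcarrier -> chart R n mcarrier;
  chart_at_atlas : forall x, atlas (chart_at x);
  chart_at_dom : forall x, cdom (chart_at x) x;
  atlas_smooth : forall c c', atlas c -> atlas c' -> forall i,
    Cinf (cmap c @` (cdom c `&` cdom c')) (fun v => cmap c' (cinv c v) ord0 i) }.

Section Manifold.
Variables (R : realType) (n : nat) (M : manifold R n).
Implicit Types (U : set M) (f g : M -> R) (c : chart R n M).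

Definition smooth_on U f : Prop :=
  forall c, atlas c -> Cinf (cmap c @` (U `&` cdom c)) (f \o cinv c).

Lemma cimg_sub_open c U : open U -> open (cmap c @` (U `&` cdom c)).
Proof.
move=> oU; rewrite openE => _ [x [Ux cx] <-].
have ix : (cmap c @` cdom c) (cmap c x) by exists x.
have n1 := open_nbhs_nbhs (conj (@cimg_open _ _ _ c) ix).
have n2 : nbhs (cmap c x) (cinv c @^-1` U).
  apply: (cinv_cts ix); rewrite cmapK //.
  exact: open_nbhs_nbhs (conj oU Ux).
apply: filterS2 n1 n2 => _ [y cy <-] /=; rewrite cmapK // => Uy.
by exists y.
Qed.

Lemma smooth_on_ext U f g : open U -> (forall x, U x -> f x = g x) ->
  smooth_on U f -> smooth_on U g.
Proof.
move=> oU fg Sf c Ac k; apply: Ck_ext (Sf c Ac k); first exact: cimg_sub_open.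
by move=> _ /[1!inE] -[x [Ux cx] <-] /=; rewrite cmapK // fg.
Qed.

Lemma smooth_onD U f g : open U -> smooth_on U f -> smooth_on U g ->
  smooth_on U (fun x => f x + g x).
Proof.
by move=> oU Sf Sg c Ac k; apply: CkD; [apply: cimg_sub_open|apply: Sf|apply: Sg].
Qed.

Lemma smooth_onM U f g : open U -> smooth_on U f -> smooth_on U g ->
  smooth_on U (fun x => f x * g x).
Proof.
by move=> oU Sf Sg c Ac k; apply: CkM; [apply: cimg_sub_open|apply: Sf|apply: Sg].
Qed.

Lemma smooth_on_sub U U' f : U `<=` U' -> smooth_on U' f -> smooth_on U f.
Proof.
move=> UU' Sf c Ac k.
have sub : cmap c @` (U `&` cdom c) `<=` cmap c @` (U' `&` cdom c).
  by apply: image_subset; apply: setSI.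
have CkS' W W' h : W `<=` W' -> Ck k W' h -> Ck k W h.
  move=> WW'; elim: k {Sf} h => [|k IH] h /=.
    by move=> ch x /WW'/ch.
  by case=> dh Dh; split=> [x /WW'/dh//|v]; apply/IH/Dh.
exact: CkS' sub (Sf c Ac k).
Qed.

Record cfun := CFun { cfunF :> M -> R; cfun_smooth : smooth_on setT cfunF }.

Definition coordf c (i : 'I_n) : M -> R := fun x => cmap c x ord0 i.

(* df/dx^i in the chart c *)
Definition pderiv c (i : 'I_n) f : M -> R :=
  fun x => 'D_(delta_mx ord0 i) (f \o cinv c : 'rV[R]_n -> R) (cmap c x).

(* T_xM is the space of row vectors, read in the preferred chart at x; [tderiv x v f] is the
   derivative v(f), so that v has components v(x^i) in any chart (x^i). *)
Definition tderiv (x : M) (v : 'rV[R]_n) f : R :=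
  'D_v (f \o cinv (chart_at x) : 'rV[R]_n -> R) (cmap (chart_at x) x).

Definition tcomp c (x : M) (v : 'rV[R]_n) (i : 'I_n) : R :=
  tderiv x v (coordf c i).

(* i-th component, in the chart c, of the Lie bracket [X, Y] *)
Definition lie_bracket_comp c (X Y : M -> 'rV[R]_n) (i : 'I_n) : M -> R := fun x =>
  \sum_(j < n) (tcomp c x (X x) j * pderiv c j (fun y => tcomp c y (Y y) i) x
              - tcomp c x (Y x) j * pderiv c j (fun y => tcomp c y (X y) i) x).

End Manifold.

(* Adapted coordinates are (x^a, y^u) with x^a = [lshift q a]
    and y^u = [rshift p u]; q is the dimension of the leaves. *)

Record foliation (R : realType) (p q : nat) (M : manifold R (p + q)) := Foliation {
  fcharts : set (chart R (p + q) M);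
  fcharts_atlas : fcharts `<=` @atlas R (p + q) M;
  fcharts_cover : forall x : M, exists2 c, fcharts c & cdom c x;
  fcharts_adapted : forall c c', fcharts c -> fcharts c' ->
    forall x, cdom c x -> cdom c' x -> forall (a : 'I_p) (u : 'I_q),
    pderiv c (rshift p u) (coordf c' (lshift q a)) x = 0 }.

Section Foliation.
Variables (R : realType) (p q : nat) (M : manifold R (p + q)) (F : foliation M).

(* Leaves of the foliation induced on V are generated by connected subsets, inside
   V, of the plaques of adapted charts *)
Definition in_plaque (V : set M) (x y : M) : Prop :=
  exists2 c, fcharts F c & exists P : set M,
    [/\ connected P, P `<=` V `&` cdom c, P x, P y &
        forall z, P z -> forall a : 'I_p,
          coordf c (lshift q a) z = coordf c (lshift q a) x].

Definition same_leaf (V : set M) : M -> M -> Prop :=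
  clos_refl_trans M (in_plaque V).

Definition foliated_on (V : set M) (f : M -> R) : Prop :=
  forall x y, V x -> V y -> same_leaf V x y -> f x = f y.

Definition leaf_tangent (x : M) (v : 'rV[R]_(p + q)) : Prop :=
  forall c, fcharts F c -> cdom c x ->
    forall a : 'I_p, tcomp c x v (lshift q a) = 0.

End Foliation.

Section Bundle.
Variables (R : realType) (n : nat) (M : manifold R n).

(* r sections over [fdom]; their values outside [fdom] are irrelevant *)
Record lframe (E : M -> vectType R) (r : nat) := LFrame {
  fdom : set M;
  fsec : 'I_r -> forall x, E x }.

Definition ftup E r (e : lframe E r) (x : M) : r.-tuple (E x) :=
  [tuple fsec e i x | i < r].

Definition fcoord E r (e : lframe E r) (i : 'I_r) (x : M) (v : E x) : R :=
  coord (ftup e x) i v.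

Record vbundle (r : nat) := VBundle {
  fib :> M -> vectType R;
  trivs : set (lframe fib r);
  triv_open : forall t, trivs t -> open (fdom t);
  triv_basis : forall t, trivs t -> forall x, fdom t x ->
    basis_of fullv (ftup t x);
  triv_cover : forall x, exists2 t, trivs t & fdom t x;
  triv_smooth : forall t t', trivs t -> trivs t' -> forall i j,
    smooth_on (fdom t `&` fdom t') (fun x => fcoord t' i (fsec t j x)) }.

Variables (r : nat) (A : vbundle r).

Definition smooth_section_on (U : set M) (s : forall x, A x) : Prop :=
  forall t, trivs t -> forall i,
    smooth_on (U `&` fdom t) (fun x => fcoord t i (s x)).

Record section := MkSection {
  sectionF :> forall x, A x;
  section_smooth : smooth_section_on setT sectionF }.

Lemma sectionD_subproof (s t : section) :
  smooth_section_on setT (fun x => s x + t x).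
Proof.
move=> e Te i; have oe : open (setT `&` fdom e) by rewrite setTI; exact: triv_open.
have := smooth_onD oe (section_smooth s Te i) (section_smooth t Te i).
by apply: smooth_on_ext => // x _; rewrite /fcoord linearD.
Qed.
Definition sectionD s t := MkSection (sectionD_subproof s t).

Lemma sectionZ_subproof (f : cfun M) (s : section) :
  smooth_section_on setT (fun x => f x *: s x).
Proof.
move=> e Te i; have oe : open (setT `&` fdom e) by rewrite setTI; exact: triv_open.
have := smooth_onM oe (smooth_on_sub (@subsetT _ _) (cfun_smooth f))
  (section_smooth s Te i).
by apply: smooth_on_ext => // x _; rewrite /fcoord linearZ.
Qed.
Definition sectionZ f s := MkSection (sectionZ_subproof f s).

Definition local_basis k (S : forall x, {vspace A x}) (e : lframe A k) : Prop :=
  [/\ open (fdom e),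
      forall i, smooth_section_on (fdom e) (fsec e i) &
      forall x, fdom e x -> basis_of (S x) (ftup e x)].

Definition local_frame (e : lframe A r) : Prop :=
  local_basis (fun x => fullv) e.

Record subbundle (k : nat) := Subbundle {
  subfib :> forall x, {vspace A x};
  subfib_local : forall x, exists2 e : lframe A k, local_basis subfib e & fdom e x }.

End Bundle.

Section Dual.
Variables (R : realType) (n : nat) (M : manifold R n) (r : nat) (A : vbundle M r).

Definition dual_fib (x : M) : vectType R := 'Hom(A x, R^o).

Definition dual_frame (e : lframe A r) : lframe dual_fib r :=
  @LFrame R n M dual_fib r (fdom e)
    (fun i x => linfun (coord (ftup e x) i : A x -> R^o)).

Definition dual_trivs : set (lframe dual_fib r) := @dual_frame @` @trivs _ _ _ _ A.

Lemma dual_expand (e : lframe A r) x (xi : dual_fib x) :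
  basis_of fullv (ftup e x) ->
  xi = \sum_i (xi : 'Hom(A x, R^o)) (fsec e i x) *: fsec (dual_frame e) i x.
Proof.
move=> eb; apply/lfunP => v; rewrite sum_lfunE.
rewrite {1}(coord_basis eb (memvf v)) linear_sum; apply: eq_bigr => i _.
rewrite linearZ /= !scale_lfunE lfunE /= (nth_map i) ?size_enum_ord //.
by rewrite nth_ord_enum; exact: mulrC.
Qed.

Lemma dual_frame_basis (e : lframe A r) x : basis_of fullv (ftup e x) ->
  basis_of fullv (ftup (dual_frame e) x).
Proof.
move=> eb; rewrite basisEdim; apply/andP; split.
  apply/subvP => xi _; rewrite (dual_expand xi eb); apply: memv_suml => i _.
  by apply: rpredZ; apply: memv_span; apply/tnthP; exists i; rewrite tnth_mktuple.
have rE : r = dim (A x) by rewrite -dimvf (size_basis eb).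
by rewrite size_tuple dimvf /dim /= muln1 [leqLHS]rE.
Qed.

Lemma dual_frame_coord (e e' : lframe A r) x (i j : 'I_r) :
  basis_of fullv (ftup e x) -> basis_of fullv (ftup e' x) ->
  fcoord (dual_frame e') i (fsec (dual_frame e) j x) = fcoord e j (fsec e' i x).
Proof.
move=> eb eb'; rewrite {1}(dual_expand (fsec (dual_frame e) j x) eb').
have tE k : fsec (dual_frame e') k x = (ftup (dual_frame e') x)`_k.
  by rewrite (nth_map k) ?size_enum_ord // nth_ord_enum.
under eq_bigr do rewrite tE.
rewrite /fcoord coord_sum_free ?(basis_free (dual_frame_basis eb')) //.
by rewrite /= lfunE.
Qed.

Lemma dual_triv_open t : dual_trivs t -> open (fdom t).
Proof. by case=> e Te <-; exact: triv_open Te. Qed.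

Lemma dual_triv_basis t : dual_trivs t -> forall x, fdom t x ->
  basis_of fullv (ftup t x).
Proof. by case=> e Te <- x ex; apply/dual_frame_basis/(triv_basis Te). Qed.

Lemma dual_triv_cover x : exists2 t, dual_trivs t & fdom t x.
Proof.
by have [e Te ex] := triv_cover A x; exists (dual_frame e) => //; exists e.
Qed.

Lemma dual_triv_smooth t t' : dual_trivs t -> dual_trivs t' -> forall i j,
  smooth_on (fdom t `&` fdom t') (fun x => fcoord t' i (fsec t j x)).
Proof.
case=> e Te <- [e' Te' <-] i j.
apply: smooth_on_ext (smooth_on_sub _ (triv_smooth Te' Te j i)).
- by apply: openI; apply: triv_open.
- by move=> x [/= ex ex']; rewrite dual_frame_coord //; apply: triv_basis.
- by rewrite setIC.
Qed.

Definition dual : vbundle M r :=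
  VBundle dual_triv_open dual_triv_basis dual_triv_cover dual_triv_smooth.

End Dual.

(* Real homogeneity of the bracket is the case of a constant f in [leibniz]. *)
Record lie_algebroid (R : realType) (n : nat) (M : manifold R n) (r : nat)
    (A : vbundle M r) := LieAlgebroid {
  anchor : forall x, 'Hom(A x, 'rV[R]_n);
  bracket : section A -> section A -> section A;
  anchor_smooth : forall (s : section A) c, atlas c -> forall i,
    smooth_on (cdom c) (fun x => tcomp c x (anchor x (s x)) i);
  bracketDl : forall (s s' t : section A) x,
    bracket (sectionD s s') t x = bracket s t x + bracket s' t x;
  bracket_anti : forall (s t : section A) x, bracket s t x = - bracket t s x;
  jacobi : forall (s t u : section A) x,
    bracket s (bracket t u) x + bracket t (bracket u s) x
      + bracket u (bracket s t) x = 0;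
  leibniz : forall (s t : section A) (f : cfun M) x,
    bracket s (sectionZ f t) x
      = f x *: bracket s t x + tderiv x (anchor x (s x)) f *: t x;
  anchor_bracket : forall (s t : section A) c x, atlas c -> cdom c x -> forall i,
    tcomp c x (anchor x (bracket s t x)) i
      = lie_bracket_comp c (fun y => anchor y (s y)) (fun y => anchor y (t y)) i x }.

Section FoliatedLieAlgebroid.
Variables (R : realType) (p q : nat) (M : manifold R (p + q)) (F : foliation M).
Variables (r k : nat) (A : vbundle M r) (L : lie_algebroid A) (B : subbundle A k).

Definition section_of (b : section A) : Prop := forall x, b x \in B x.

Definition lie_subalgebroid : Prop :=
  forall b b', section_of b -> section_of b' -> section_of (bracket L b b').

(* Local sections are represented by global ones, only their values over U
   being used: an arbitrary local section coincides with a global one after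
   shrinking its domain, and the bracket is local. *)
Definition B_foliated_on (U : set M) (a : section A) : Prop :=
  forall b, section_of b -> forall x, U x -> bracket L b a x \in B x.

Definition spanned_by_B_foliated : Prop :=
  forall x0 : M, exists U : set M, [/\ open U, U x0 &
    forall s : section A, exists (m : nat) (f : 'I_m -> cfun M) (a : 'I_m -> section A),
      (forall j, B_foliated_on U (a j)) /\
      (forall x, U x -> s x = \sum_j f j x *: a j x)].

Definition foliated_lie_algebroid : Prop :=
  [/\ lie_subalgebroid,
      forall x v, v \in (anchor L x @: B x)%VS <-> leaf_tangent F x v &
      spanned_by_B_foliated].

End FoliatedLieAlgebroid.

Section FoliatedSubbundle.
Variables (R : realType) (p q : nat) (M : manifold R (p + q)) (F : foliation M).
Variables (r : nat) (A : vbundle M r).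

Definition foliated_transition s (e e' : lframe A s) : Prop :=
  forall i j, foliated_on F (fdom e `&` fdom e')
    (fun x => fcoord e' i (fsec e j x)).

Record foliated_subbundle (s : nat) := FoliatedSubbundle {
  fsubbundle :> subbundle A s;
  foliated_bases : set (lframe A s);
  foliated_bases_local : forall e, foliated_bases e -> local_basis fsubbundle e;
  foliated_bases_cover : forall x, exists2 e, foliated_bases e & fdom e x;
  foliated_bases_transition : forall e e',
    foliated_bases e -> foliated_bases e' -> foliated_transition e e';
  foliated_bases_max : forall e, local_basis fsubbundle e ->
    (forall e', foliated_bases e' -> foliated_transition e e') -> foliated_bases e }.

End FoliatedSubbundle.

(* [G : grassmann R m] is the sum of the G I eta^I, where eta^I is the product of
   the generators eta^i, i in I, in increasing order *)

Notation grassmann R m := {ffun {set 'I_m} -> R^o}.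

Section Grassmann.
Variables (R : realType) (m : nat).
Implicit Types (G H : grassmann R m) (I J K : {set 'I_m}).

Definition gsign I J : R :=
  (-1) ^+ \sum_(i in I) #|[pred j | (j \in J) && (j < i)%N]|.

Definition gmul G H : grassmann R m :=
  [ffun K : {set 'I_m} => \sum_(I : {set 'I_m} | I \subset K)
               gsign I (K :\: I)%SET * G I * H (K :\: I)%SET].

Definition gconst (c : R) : grassmann R m := [ffun I : {set 'I_m} => if I == finset.set0 then c else 0].

Definition geta (i : 'I_m) : grassmann R m := [ffun I : {set 'I_m} => (I == finset.set1 i)%:R].

(* left derivative with respect to eta^i *)
Definition gderiv (i : 'I_m) G : grassmann R m :=
  [ffun I : {set 'I_m} => if i \in I then 0 else gsign (finset.set1 i) I * G (i |: I)%SET].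

(* the substitution eta^i := \sum_j b i j eta^j *)
Definition gsubst (b : 'I_m -> 'I_m -> R) G : grassmann R m :=
  \sum_(I : {set 'I_m})
    G I *: \big[gmul/gconst 1]_(i in I) (\sum_j b i j *: geta j).

End Grassmann.

(* A super-function of local
    coordinates (x^i, eta^l) is a Grassmann-valued function on M. *)

Section LocalSuperFields.
Variables (R : realType) (n : nat) (M : manifold R n) (m : nat).

(* the field V^i d/dx^i + V^l d/deta^l *)
Record lsfield := LSField {
  sfx : 'I_n -> M -> grassmann R m;
  sfeta : 'I_m -> M -> grassmann R m }.

Variable c : chart R n M.

Definition superpderiv (i : 'I_n) (G : M -> grassmann R m) : M -> grassmann R m :=
  fun x => [ffun I => pderiv c i (fun y => G y I) x].

Definition sfapply (V : lsfield) (G : M -> grassmann R m) : M -> grassmann R m :=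
  fun x => \sum_i gmul (sfx V i x) (superpderiv i G x)
         + \sum_l gmul (sfeta V l x) (gderiv l (G x)).

(* [V, V'] for fields V, V' of parities d, d' *)
Definition sfbracket (d d' : bool) (V V' : lsfield) : lsfield := LSField
  (fun i x => sfapply V (sfx V' i) x - (-1) ^+ (d && d') *: sfapply V' (sfx V i) x)
  (fun l x => sfapply V (sfeta V' l) x - (-1) ^+ (d && d') *: sfapply V' (sfeta V l) x).

Definition sfzero_on (D : set M) (V : lsfield) : Prop :=
  forall x, D x -> (forall i, sfx V i x = 0) /\ (forall l, sfeta V l x = 0).

(* V = 1/2 a2_{bg}^l eta^b eta^g d/deta^l + a1_b^i eta^b d/dx^i over D *)
Definition degree1_form (D : set M) (V : lsfield)
    (a2 : 'I_m -> 'I_m -> 'I_m -> M -> R) (a1 : 'I_m -> 'I_n -> M -> R) : Prop :=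
  [/\ forall b g l, smooth_on D (a2 b g l),
      forall b i, smooth_on D (a1 b i),
      forall b g l x, D x -> a2 b g l x = - a2 g b l x,
      forall l x, D x -> sfeta V l x
        = \sum_b \sum_g (2^-1 * a2 b g l x) *: gmul (geta R b) (geta R g) &
      forall i x, D x -> sfx V i x = \sum_b a1 b i x *: geta R b].

Definition degree1_on (D : set M) (V : lsfield) : Prop :=
  exists a2 a1, degree1_form D V a2 a1.

(* fields of degree 1 are odd *)
Definition homological_on (D : set M) (V : lsfield) : Prop :=
  sfzero_on D (sfbracket true true V V).

End LocalSuperFields.

Section SuperFields.
Variables (R : realType) (n : nat) (M : manifold R n) (r : nat) (A : vbundle M r).

(* a coordinate system (x^i, eta^a): a chart and a local basis of A *)
Record scoord := SCoord {
  schart : chart R n M;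
  sframe : lframe A r;
  schart_atlas : atlas schart;
  sframe_local : local_frame sframe }.

Definition sdom (c : scoord) : set M := cdom (schart c) `&` fdom (sframe c).

(* the functions b^i_j with a_j = b^i_j a'_i, so that eta'^i = b^i_j eta^j *)
Definition stransition (c c' : scoord) (x : M) (i j : 'I_r) : R :=
  fcoord (sframe c') i (fsec (sframe c) j x).

(* expression in the coordinates c of a super-function of the coordinates c' *)
Definition spullback (c c' : scoord) (G : M -> grassmann R r) : M -> grassmann R r :=
  fun x => gsubst (stransition c c' x) (G x).

(* V(x'^i), V(eta'^l) computed in c must be the components of V in c' *)
Record sfield := SField {
  sfloc : scoord -> lsfield M r;
  sfx_smooth : forall c i I, smooth_on (sdom c) (fun x => sfx (sfloc c) i x I);
  sfeta_smooth : forall c l I, smooth_on (sdom c) (fun x => sfeta (sfloc c) l x I);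
  sfx_change : forall c c' i x, sdom c x -> sdom c' x ->
    spullback c c' (sfx (sfloc c') i) x
      = sfapply (schart c) (sfloc c)
          (fun y => gconst r (coordf (schart c') i y)) x;
  sfeta_change : forall c c' l x, sdom c x -> sdom c' x ->
    spullback c c' (sfeta (sfloc c') l) x
      = sfapply (schart c) (sfloc c)
          (spullback c c' (fun=> geta R l)) x }.

(* the components are meaningless outside [sdom] *)
Definition sfield_eq (V W : sfield) : Prop :=
  forall c x, sdom c x ->
    (forall i, sfx (sfloc V c) i x = sfx (sfloc W c) i x) /\
    (forall l, sfeta (sfloc V c) l x = sfeta (sfloc W c) l x).

Definition degree1 (V : sfield) : Prop := forall c, degree1_on (sdom c) (sfloc V c).

Definition homological (V : sfield) : Prop :=
  degree1 V /\ forall c, homological_on (schart c) (sdom c) (sfloc V c).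

(* W is the differential d_A of the algebroid: W x^i = rho_b^i eta^b and
   W eta^l = -1/2 C_{bg}^l eta^b eta^g, where rho_b^i are the components of the
   anchor and [a_b, a_g] = C_{bg}^l a_l. *)
Definition algebroid_differential (L : lie_algebroid A) (W : sfield) : Prop :=
  forall c, exists a2 a1, degree1_form (sdom c) (sfloc W c) a2 a1 /\
    forall x, sdom c x ->
      (forall b i, a1 b i x
         = tcomp (schart c) x (anchor L x (fsec (sframe c) b x)) i) /\
      (forall b g (s t : section A),
         (\forall y \near x, s y = fsec (sframe c) b y) ->
         (\forall y \near x, t y = fsec (sframe c) g y) ->
         bracket L s t x = - \sum_l a2 b g l x *: fsec (sframe c) l x).

End SuperFields.

(* The indices of a basis (b_h, a_q) of A are split
    as h = [lshift s h] and q = [rshift k q]. *)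

Section Conditions.
Variables (R : realType) (p q : nat) (M : manifold R (p + q)) (F : foliation M).
Variables (k s : nat) (A : vbundle M (k + s)).
Variable E : foliated_subbundle F (dual A) s.

(* B = ann E^* *)
Definition annihilator (x : M) : {vspace A x} :=
  (\bigcap_(i < \dim (E x)) lker ((vbasis (E x))`_i : 'Hom(A x, R^o)))%VS.

(* (b_h) is a basis of B, and the classes of the a_q form the basis of A/B dual
   to a foliated basis of E^* *)
Definition adapted_frame (e : lframe A (k + s)) : Prop :=
  [/\ local_frame e,
      local_basis annihilator (LFrame (fdom e) (fun h : 'I_k => fsec e (lshift s h))) &
      exists2 z : lframe (dual A) s, foliated_bases E z /\ fdom z = fdom e &
        forall x, fdom e x -> forall i j : 'I_s,
          (fsec z i x : 'Hom(A x, R^o)) (fsec e (rshift k j) x) = (i == j)%:R].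

Definition adapted (c : scoord A) : Prop :=
  fcharts F (schart c) /\ adapted_frame (sframe c).

(* G depends only on (x^a, zeta^q); as usual for foliated functions, this is
   meant along the leaves of the domain *)
Definition projectable_function (D : set M) (G : M -> grassmann R (k + s)) : Prop :=
  (forall (I : {set 'I_(k + s)}) (h : 'I_k), lshift s h \in I ->
     forall x, D x -> G x I = 0) /\
  (forall I, foliated_on F D (fun x => G x I)).

Definition projectable (W : sfield A) : Prop :=
  forall c, adapted c ->
    (forall a : 'I_p, projectable_function (sdom c) (sfx (sfloc W c) (lshift q a))) /\
    (forall j : 'I_s, projectable_function (sdom c) (sfeta (sfloc W c) (rshift k j))).

(* pullback of a super-function to the submanifold zeta^q = 0 *)
Definition restr (G : grassmann R (k + s)) : grassmann R k :=
  [ffun J : {set 'I_k} => G [set lshift s h | h in J]%SET].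

Definition restr_in_TFbar (c : scoord A) (W : sfield A) : Prop :=
  forall x, sdom c x ->
    (forall a : 'I_p, restr (sfx (sfloc W c) (lshift q a) x) = 0) /\
    (forall j : 'I_s, restr (sfeta (sfloc W c) (rshift k j) x) = 0).

(* W(zeta^q) vanishes where zeta^q = 0 *)
Definition restr_tangent (c : scoord A) (W : sfield A) : Prop :=
  forall x, sdom c x -> forall j : 'I_s,
    restr (sfapply (schart c) (sfloc W c) (fun=> geta R (rshift k j)) x) = 0.

(* W restricted to the submanifold zeta^q = 0, with coordinates (x^a, y^u, eta^h) *)
Definition restr_field (c : scoord A) (W : sfield A) : lsfield M k :=
  LSField (fun i x => restr (sfx (sfloc W c) i x))
          (fun h x => restr (sfeta (sfloc W c) (lshift s h) x)).

Definition transitive_form (D : set M) (b1 : 'I_k -> 'I_(p + q) -> M -> R) : Prop :=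
  forall x, D x -> \rank (\matrix_(h < k, u < q) b1 h (rshift p u) x) = q.

Definition restriction_condition (W : sfield A) : Prop :=
  forall c, adapted c ->
    [/\ restr_in_TFbar c W,
        restr_tangent c W,
        homological_on (schart c) (sdom c) (restr_field c W) &
        exists b2 b1, degree1_form (sdom c) (restr_field c W) b2 b1 /\
                      transitive_form (sdom c) b1].

Definition super_couple (W : sfield A) : Prop :=
  [/\ homological W, projectable W & restriction_condition W].

End Conditions.

(* E^* = ann B and W = d_A *)
Definition corresponds (R : realType) (p q : nat) (M : manifold R (p + q))
    (F : foliation M) (k s : nat) (A : vbundle M (k + s))
    (L : lie_algebroid A) (B : subbundle A k)
    (E : foliated_subbundle F (dual A) s) (W : sfield A) : Prop :=
  (forall x (xi : 'Hom(A x, R^o)),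
     xi \in E x <-> forall b, b \in B x -> xi b = 0) /\
  algebroid_differential L W.

(* Main.v *)
Require Import Defs.
From HB Require Import structures.
From mathcomp Require Import all_boot all_order all_algebra.
From mathcomp Require Import all_classical all_reals all_analysis.
From mathcomp Require Import ring lra.

Set Implicit Arguments.
Unset Strict Implicit.
Unset Printing Implicit Defensive.

Import Order.TTheory GRing.Theory Num.Theory.
Import numFieldNormedType.Exports.

Local Open Scope classical_set_scope.
Local Open Scope ring_scope.

(** In coordinates the differential W of a Lie algebroid has for coefficients the
    components of the anchor, a1 = rho, and the opposite of the structure functions, a2
    = - C. Since W is odd, [W, W] = 2 W^2, and the coefficients of W (W x) and W (W
    eta), of degree 2 and 3 in eta, express that the anchor is compatible with brackets
    and that the Jacobi identity holds for the members of a frame ([homological_eqs]).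
    The invariance of W under changes of coordinates is, coefficient by coefficient, the
    transformation law of rho and C. So the local formula for the bracket given by rho
    and C glues to a bracket of global sections ([bracket_comp_change], [algebroidW]),
    and conversely rho and C define a homological field ([field_of]). Each determines
    the other because a bracket of sections is local and is known from rho and C
    ([fcoord_bracketE]).

    The foliated data enter through E^* = ann B. Let h index a basis of B and j its
    complement. The Lie algebroid gives the Bott connection of B on ann B, (nabla_b
    xi)(a) = (sharp b)(xi(a)) - xi([b, a]), and the foliated bases of ann B are its
    parallel frames. They exist because B-foliated sections span A locally: completing a
    basis of B by such sections gives a frame whose dual transverse forms are parallel
    ([exists_B_frame], [conormal_frame_parallel]). Two parallel frames differ by
    functions that are constant on the leaves because sharp B is the whole of TF
    ([bott_parallel_transition]).

    In coordinates adapted to a parallel frame, sharp B = TF gives rho_h^a = 0, and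
    parallelism says that [b, e_g] is in B for every section b of B, that is C_hg^j = 0.
    Differentiating along the leaves, with the compatibility of anchor and bracket and
    the Jacobi identity, shows that the remaining transverse coefficients rho_j^a and
    C_ij^l are constant on the leaves ([adapted_anchor_coef_foliated],
    [adapted_structure_coef_foliated]). This is the projectability of W; the vanishing of C_hh'^j
    also makes the restriction of W to zeta = 0 tangent and homological, and the
    surjectivity of sharp from B to TF is its transitivity.

    Conversely projectability forces rho_h^a = 0 and C_hg^j = 0 in adapted coordinates.
    Hence ann E^* is closed under brackets, members of adapted frames are B-foliated,
    and sharp B is inside TF; it is equal to TF by transitivity. Uniqueness of W and of
    L is the fact that d_A and the algebroid determine each other; uniqueness of the
    foliated structure holds because C_hg^j = 0 makes every foliated basis parallel, and
    maximality gives the converse ([couple_unique]). *)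

(** * Smooth functions of several real variables *)

Section Calculus.
Variable R : realType.

Lemma Ck_cst n k (U : set 'rV[R]_n) (a : R) : Ck k U (fun=> a).
Proof.
elim: k a => [|k IH] a /=; first by move=> x _; apply: cst_continuous.
split=> [x _|v]; first exact: differentiable_cst.
have -> : (fun x => 'D_v (fun=> a : R) x) = (fun=> 0 : R) :> ('rV[R]_n -> R).
  by apply/funext => x; rewrite derive_cst.
exact: IH.
Qed.

Lemma Ck_sum n k (U : set 'rV[R]_n) (I : Type) (r : seq I) (P : pred I)
    (f : I -> 'rV[R]_n -> R) :
  open U -> (forall i, Ck k U (f i)) ->
  Ck k U (fun x => \sum_(i <- r | P i) f i x).
Proof.
move=> oU Cf; elim: r => [|i r IH].
  by apply: (Ck_ext oU _ (Ck_cst k U 0)) => x _; rewrite big_nil.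
apply: (Ck_ext oU (f := fun x => (if P i then f i x else 0) + \sum_(i <- r | P i) f i x)).
  by move=> x _; rewrite big_cons; case: (P i); rewrite ?add0r.
by apply: CkD => //; case: (P i) => //; apply: Ck_cst.
Qed.

Lemma Ck_opp n k (U : set 'rV[R]_n) (f : 'rV[R]_n -> R) :
  open U -> Ck k U f -> Ck k U (fun x => - f x).
Proof.
move=> oU Cf; apply: (Ck_ext oU (f := fun x => (-1) * f x)).
  by move=> x _; rewrite mulN1r.
by apply: CkM => //; apply: Ck_cst.
Qed.

Lemma Ck_coord n k (U : set 'rV[R]_n) i : Ck k U (fun x => x ord0 i).
Proof.
case: k => [|k]; first by move=> x _; apply: coord_continuous.
split=> [x _|v]; first exact: differentiable_coord.
have -> : (fun x => 'D_v (fun y : 'rV[R]_n => y ord0 i : R) x) = (fun=> v ord0 i).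
  apply/funext => x; have := @derive_mx _ _ 1 n (id : 'rV[R]_n -> 'rV[R]_n) x v.
  by rewrite derive_id => H; rewrite {2}H ?mxE //; exact: derivable_id.
exact: Ck_cst.
Qed.

Lemma Ck_inv n k (U : set 'rV[R]_n) (f : 'rV[R]_n -> R) :
  open U -> (forall x, U x -> f x != 0) -> Ck k U f -> Ck k U (fun x => (f x)^-1).
Proof.
move=> oU f0; elim: k => [|k IH] Cf.
  by move=> x Ux; apply: continuousV; [exact: f0|exact: Cf].
have [df Df] := Cf; have CI := IH (CkS Cf); split=> [x Ux|v].
  by apply: differentiableV; [exact: df|exact: f0].
have H : Ck k U (fun x => - ((f x)^-1 * (f x)^-1) * 'D_v f x).
  exact: (CkM oU (Ck_opp oU (CkM oU CI CI)) (Df v)).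
apply: Ck_ext H => // x; rewrite inE => Ux.
rewrite deriveV; [|exact: f0|exact/diff_derivable/df].
by rewrite -exprVn expr2.
Qed.

(** Stated on coordinates, the chain rule expresses a derivative of a composite by
    products of derivatives, which is the form that an induction on the order of
    differentiability can use. *)
Lemma derive_comp_rV (V : normedModType R) n (Phi : V -> 'rV[R]_n)
    (h : 'rV[R]_n -> R) (x v : V) :
  (forall j, differentiable (fun y => Phi y ord0 j : R) x) ->
  differentiable h (Phi x) ->
  differentiable (h \o Phi) x /\
  'D_v (h \o Phi) x = \sum_j 'D_v (fun y => Phi y ord0 j : R) x
                              * 'D_(delta_mx ord0 j) h (Phi x).
Proof.
move=> dP dh.
have PE : Phi = \sum_j (fun y => Phi y ord0 j *: (delta_mx ord0 j : 'rV[R]_n)).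
  by apply/funext => y; rewrite fct_sumE {1}[Phi y]row_sum_delta.
have dPhi : differentiable Phi x.
  by rewrite PE; apply: differentiable_sum => j; apply: differentiableZl.
split; first exact: differentiable_comp.
rewrite deriveE; last exact: differentiable_comp.
rewrite diff_comp //= -[X in 'd h _ X]deriveE //.
have -> : 'D_v Phi x = \sum_j 'D_v (fun y => Phi y ord0 j : R) x *: (delta_mx ord0 j : 'rV[R]_n).
  rewrite derive_mx; last exact: diff_derivable.
  rewrite [LHS]row_sum_delta; apply: eq_bigr => j _; by rewrite mxE.
rewrite linear_sum; apply: eq_bigr => j _ /=.
by rewrite linearZ /= -deriveE.
Qed.

Lemma Ck_comp m n k (U : set 'rV[R]_m) (V : set 'rV[R]_n) (Phi : 'rV[R]_m -> 'rV[R]_n) h :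
  open U -> (forall x, U x -> V (Phi x)) ->
  (forall j, Cinf U (fun x => Phi x ord0 j)) -> Ck k V h -> Ck k U (h \o Phi).
Proof.
move=> oU UV CP.
have dP x j : U x -> differentiable (fun y => Phi y ord0 j : R) x.
  by move=> Ux; have [d _] := CP j 1%N; exact: d.
elim: k h => [|k IH] h.
  move=> ch x Ux; apply: continuous_comp; last exact/ch/UV.
  apply: differentiable_continuous.
  have [//|] := @derive_comp_rV _ n Phi (cst 0) x 0 (fun j => dP x j Ux).
  move=> _ _.
  have PE : Phi = \sum_j (fun y => Phi y ord0 j *: (delta_mx ord0 j : 'rV[R]_n)).
    by apply/funext => y; rewrite fct_sumE {1}[Phi y]row_sum_delta.
  by rewrite PE; apply: differentiable_sum => j; apply: differentiableZl; apply: dP.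
case=> dh Dh; split=> [x Ux|v].
  by have [] := @derive_comp_rV _ n Phi h x 0 (fun j => dP x j Ux) (dh _ (UV _ Ux)).
apply: (@Ck_ext _ _ _ _ (fun x => \sum_j 'D_v (fun y => Phi y ord0 j) x
   * ((fun z => 'D_(delta_mx ord0 j) h z) \o Phi) x)) => //.
  move=> x; rewrite inE => Ux.
  by have [_ ->] := @derive_comp_rV _ n Phi h x v (fun j => dP x j Ux) (dh _ (UV _ Ux)).
apply: Ck_sum => // j; have [_ H] := CP j k.+1.
exact: (CkM oU (H v) (IH _ (Dh _))).
Qed.

(** Smoothness of a function of one real variable is given by a tower of successive
    derivatives. *)
Lemma Ck_comp1 n k (U : set 'rV[R]_n) (G : nat -> R -> R) (f : 'rV[R]_n -> R) i :
  open U -> (forall i (t : R), is_derive t (1 : R) (G i) (G i.+1 t)) -> Cinf U f ->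
  Ck k U (G i \o f).
Proof.
move=> oU dG Cf; elim: k i => [|k IH] i.
  move=> x Ux; apply: continuous_comp; first exact: (Cf 0%N x Ux).
  by apply: differentiable_continuous; apply/derivable1_diffP; exact: ex_derive.
have [df Df] := Cf k.+1.
have dGf x : U x -> differentiable (G i \o f) x /\
    forall v, 'D_v (G i \o f) x = G i.+1 (f x) * 'D_v f x.
  move=> Ux; have dgx : differentiable (G i) (f x).
    by apply/derivable1_diffP; exact: ex_derive.
  have dc : differentiable (G i \o f) x by apply: differentiable_comp => //; apply: df.
  split=> // v; rewrite deriveE // diff_comp //=; last exact: df.
  rewrite -[X in 'd (G i) _ X]mulr1 -[X in 'd (G i) _ X]/(_ *: (1 : R)).
  rewrite [LHS]linearZ /= -[X in _ *: X]deriveE // -deriveE; last exact: df.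
  by rewrite derive_val [RHS]mulrC.
split=> [x /dGf[]//|v].
apply: (@Ck_ext _ _ _ _ (fun x => (G i.+1 \o f) x * 'D_v f x)) => //.
  by move=> x; rewrite inE => /dGf[_ ->].
exact: (CkM oU (IH _) (Df v)).
Qed.

(** The monomial of degree i is controlled by u <= (i + 1) exp (u / (i + 1)). *)
Lemma poly_expR_bounded (P : {poly R}) :
  exists C : R, forall u, 0 < u -> `|P.[u]| * expR (- u) <= C.
Proof.
exists (\sum_(i < size P) `|P`_i| * (i.+1%:R ^+ i)) => u u0.
rewrite horner_coef (le_trans (ler_wpM2r (expR_ge0 _) (ler_norm_sum _ _ _))) //.
rewrite mulr_suml ler_sum // => i _; rewrite normrM -mulrA ler_wpM2l //.
rewrite expRN ler_pdivrMr ?expR_gt0 // ger0_norm ?exprn_ge0 ?(ltW u0) //.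
have le1 : u <= i.+1%:R * expR (u / i.+1%:R).
  rewrite -ler_pdivrMl // mulrC (le_trans _ (expR_ge1Dx _)) //.
  by rewrite lerDr.
apply: (@le_trans _ _ ((i.+1%:R * expR (u / i.+1%:R)) ^+ i)).
  by apply: lerXn2r => //; rewrite nnegrE ?mulr_ge0 ?expR_ge0 ?ltW.
rewrite exprMn ler_wpM2l ?exprn_ge0 // -expRM_natl ler_expR.
by rewrite mulrCA ler_piMr ?ltW // ltr_pdivrMr // mul1r ltr_nat.
Qed.

(** The functions P(1/t) exp (-1/t), extended by 0 to t <= 0; the extension by 0 is
    smooth, and is the source of all cut-off functions. *)
Definition flat (P : {poly R}) (t : R) : R :=
  if 0 < t then P.[t^-1] * expR (- t^-1) else 0.

(** The family of functions [flat P] is closed under differentiation, so that its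
    members are smooth. At 0 the difference quotient is h times a function that
    [poly_expR_bounded] bounds. *)
Lemma is_derive_flat (P : {poly R}) (t : R) :
  is_derive t (1 : R) (flat P) (flat ('X^2 * (P - P^`())) t).
Proof.
have [t0|t0|->] := ltgtP t 0.
- have near0 : \forall s \near t, cst 0 s = flat P s.
    near=> s; rewrite /flat ifF //; apply/negbTE; rewrite -leNgt.
    by apply: ltW; near: s; apply: lt_nbhsl.
  rewrite {2}/flat ifF ?ltNge ?(ltW t0) //.
  apply: near_eq_is_derive near0 _; exact: is_derive_cst.
- have nearE : \forall s \near t, P.[s^-1] * expR (- s^-1) = flat P s.
    near=> s; rewrite /flat ifT //.
    by near: s; apply: lt_nbhsr.
  apply: near_eq_is_derive nearE _; rewrite /flat t0.
  have tn0 : t != 0 by rewrite gt_eqF.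
  have dI : is_derive t (1 : R) (fun s : R => s^-1) (- t ^- 2).
    split; first exact/derivableV.
    by rewrite deriveV // derive_id -[_ *: _]/(_ * _) mulr1.
  have dNI : is_derive t (1 : R) (fun s : R => - s^-1) (t ^- 2).
    have := is_deriveN dI; rewrite opprK; exact.
  have d1 := is_derive1_comp (is_derive_poly P t^-1) dI.
  have d2 := @is_derive1_comp _ expR (fun s : R => - s^-1) t _ _ (is_derive_expR (- t^-1)) dNI.
  apply: (is_derive_eq (is_deriveM d1 d2)); rewrite /= !hornerE /=.
  rewrite -![_ *: _]/(_ * _) -?exprVn; ring.
- rewrite {2}/flat ltxx.
  have [C CP] := poly_expR_bounded ('X^2 * P).
  suff H : (fun h : R => h^-1 *: (flat P (h *: (1 : R) + 0) - flat P 0)) @ 0^' --> (0 : R).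
    split; first by apply/cvg_ex; exists 0.
    exact: cvg_lim.
  apply/cvgr0Pnorm_lt => e e0 /=.
  have C0 : 0 <= C by rewrite (le_trans _ (CP 1 ltr01)) // mulr_ge0 // expR_ge0.
  have C1 : 0 < C + 1 by rewrite ltr_wpDl.
  near=> h; rewrite /flat ltxx subr0 addr0 -[h *: 1]/(h * 1) mulr1.
  case: ifP => h0; last by rewrite scaler0 normr0.
  have := CP h^-1; rewrite invr_gt0 => /(_ h0).
  rewrite !hornerE -[_ *: _]/(_ * _) !normrM (ger0_norm (expR_ge0 _)).
  have hp : h < e / (C + 1).
    rewrite -(gtr0_norm h0); near: h; apply: dnbhs0_lt; exact: divr_gt0.
  rewrite (ger0_norm (_ : 0 <= h^-1)) ?invr_ge0 ?(ltW h0) // => H.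
  have -> : h^-1 * (`|P.[h^-1]| * expR (- h^-1)) =
    h * (h^-1 * h^-1 * `|P.[h^-1]| * expR (- h^-1)).
    by field; rewrite gt_eqF.
  apply: (@le_lt_trans _ _ (h * C)); first by rewrite ler_wpM2l // ltW.
  rewrite ltr_pdivlMr // in hp; rewrite (le_lt_trans _ hp) // ler_wpM2l ?ltW //.
  by rewrite ltrDl.
Unshelve. all: by end_near. Qed.

Lemma Cinf_flat n (U : set 'rV[R]_n) f : open U -> Cinf U f -> Cinf U (flat 1 \o f).
Proof.
move=> oU Cf k.
apply: (@Ck_comp1 _ k U
  (fun i => flat (iter i (fun P : {poly R} => 'X^2 * (P - P^`())) 1)) f 0%N) => //.
by move=> i t; apply: is_derive_flat.
Qed.

Lemma flat_gt0 t : 0 < t -> 0 < flat 1 t.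
Proof. by move=> t0; rewrite /flat t0 hornerC mul1r expR_gt0. Qed.

Lemma flat_eq0 t : t <= 0 -> flat 1 t = 0.
Proof. by move=> t0; rewrite /flat ltNge t0. Qed.

Lemma flat_ge0 t : 0 <= flat 1 t.
Proof. by have [/flat_eq0->|/flat_gt0/ltW] := leP t 0. Qed.

(** The function is a / (a + b), where a vanishes far from x and b vanishes near x. It
    is built on the squared Euclidean distance, which is smooth, unlike the norm. The
    compact set K makes the support closed once it is carried to a manifold. *)
Lemma Cinf_bump n (x : 'rV[R]_n) (d : R) : 0 < d ->
  exists h : 'rV[R]_n -> R, [/\ Cinf setT h, \forall v \near x, h v = 1 &
    exists K, [/\ compact K, K `<=` ball x d & forall v, ~ K v -> h v = 0]].
Proof.
move=> d0.
pose N (v : 'rV[R]_n) : R := \sum_i (v ord0 i - x ord0 i) ^+ 2.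
have CN : Cinf setT N.
  move=> k; apply: Ck_sum; first exact: openT.
  move=> i; have C1 : Ck k setT (fun v : 'rV[R]_n => v ord0 i - x ord0 i).
    by apply: CkD; [exact: openT|apply: Ck_coord|apply: Ck_cst].
  by have := CkM openT C1 C1.
have N0 : N x = 0 by rewrite /N big1 // => i _; rewrite subrr expr0n.
have cN : continuous N by move=> v; apply: (CN 0%N v).
(* The condition N v <= 2 * e implies that each coordinate of v - x is less than d. *)
pose e := d ^+ 2 / 4.
have e0 : 0 < e by rewrite divr_gt0 // exprn_gt0.
have Lp (a b : R) : Cinf (setT : set 'rV[R]_n) (fun v => a + b * N v).
  move=> k; apply: CkD; [exact: openT|exact: Ck_cst|].
  by apply: CkM; [exact: openT|exact: Ck_cst|exact: CN].
have Ca := Cinf_flat openT (Lp (2 * e) (-1)).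
have Cb := Cinf_flat openT (Lp (- e) 1).
set a := (flat 1 \o _) in Ca; set b := (flat 1 \o _) in Cb.
have aE v : a v = flat 1 (2 * e - N v) by rewrite /a /= mulN1r.
have bE v : b v = flat 1 (N v - e) by rewrite /b /= mul1r addrC.
have ab v : 0 < a v + b v.
  rewrite aE bE; have [Nv|Nv] := ltP (N v) (2 * e).
    by rewrite ltr_wpDr ?flat_ge0 // flat_gt0 // subr_gt0.
  rewrite ltr_wpDl ?flat_ge0 // flat_gt0 // subr_gt0 (lt_le_trans _ Nv) //.
  by rewrite ltr_pMl // ltr1n.
have NB v : N v <= 2 * e -> ball x d v.
  move=> Nv; split=> // i j; rewrite (ord1 i) {i} -ball_normE /=.
  have dd : (x ord0 j - v ord0 j) ^+ 2 < d ^+ 2.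
    rewrite -sqrrN opprB; apply: (@le_lt_trans _ _ (N v)).
      by rewrite /N (bigD1 j) //= lerDl sumr_ge0 // => i _; apply: sqr_ge0.
    apply: le_lt_trans Nv _; have : 0 < d ^+ 2 by rewrite exprn_gt0.
    rewrite /e; lra.
  by rewrite -(@ltr_pXn2r _ 2) ?nnegrE ?(ltW d0) // real_normK ?num_real.
exists (fun v => a v * (a v + b v)^-1); split.
- move=> k; apply: CkM; [exact: openT|exact: Ca|].
  apply: Ck_inv; first exact: openT.
    by move=> v _; rewrite gt_eqF.
  by apply: CkD; [exact: openT|exact: Ca|exact: Cb].
- have : \forall v \near x, N v < e.
    by apply: cvgr_lt (cN x) _ _; rewrite N0.
  apply: filterS => v Nv; have b0 : b v = 0.
    by rewrite bE flat_eq0 // subr_le0 ltW.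
  by rewrite b0 addr0 divff // gt_eqF //; have := ab v; rewrite b0 addr0.
- exists [set v | N v <= 2 * e]; split.
  + apply: bounded_closed_compact; last first.
      have -> : [set v | N v <= 2 * e] = N @^-1` [set t | t <= 2 * e] by [].
      by apply: (proj1 (continuous_closedP N) cN); exact: closed_le.
    exists (`|x| + d); split; first exact: num_real.
    move=> r xr v /= Nv; apply: le_trans (ltW xr).
    rewrite -lerBlDl (le_trans (lerB_dist _ _)) //.
    by have := NB v Nv; rewrite -ball_normE /= distrC => /ltW.
  + exact: NB.
  + move=> v /= /negP; rewrite -ltNge => Nv.
    by rewrite aE flat_eq0 ?mul0r // subr_le0 ltW.
Qed.

Lemma mvt_dir n (f : 'rV[R]_n -> R) (y u : 'rV[R]_n) (h : R) : 0 < h ->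
  (forall t, 0 <= t <= h -> differentiable f (y + t *: u)) ->
  exists2 t, 0 < t < h & f (y + h *: u) - f y = h * 'D_u f (y + t *: u).
Proof.
move=> h0 df; pose g t := f (y + t *: u).
have dg (t : R) : 0 <= t <= h -> is_derive t (1 : R) g ('D_u f (y + t *: u)).
  move=> tI; have dfu := diff_derivable (v := u) (df t tI).
  have gE (s : R) : (fun r : R => r^-1 *: (g (r *: (1:R) + t) - g t)) =
      (fun r => r^-1 *: ((f \o shift (y + t *: u)) (r *: u) - f (y + t *: u))).
    apply/funext => r /=; congr (_ *: (f _ - _)).
    by rewrite -[r *: 1]/(r * 1) mulr1 scalerDl addrCA.
  by split; rewrite /derivable /derive /= gE.
have [||t tI gE] := MVT h0 (df := fun t => 'D_u f (y + t *: u)) (f := g).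
- by move=> t /[!in_itv]/= /andP[t0 th]; apply: dg; rewrite !ltW.
- apply: derivable_within_continuous => t /[!in_itv]/= tI.
  by have [] := dg t tI.
exists t; first by move: tI; rewrite in_itv.
by move: gE; rewrite /g scale0r addr0 subr0 mulrC.
Qed.

Lemma derive_shiftE n (f : 'rV[R]_n -> R) (w u y : 'rV[R]_n) :
  'D_u (fun z => f (z + w)) y = 'D_u f (y + w).
Proof.
rewrite /derive.
suff -> : (fun r : R => r^-1 *: (((fun z => f (z + w)) \o shift y) (r *: u) - f (y + w)))
  = (fun r => r^-1 *: ((f \o shift (y + w)) (r *: u) - f (y + w))) by [].
by apply/funext => r /=; rewrite addrA.
Qed.

Lemma differentiable_shift n (f : 'rV[R]_n -> R) (w y : 'rV[R]_n) :
  differentiable f (y + w) -> differentiable (fun z => f (z + w)) y.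
Proof.
move=> df; apply: (@differentiable_comp _ _ _ _ (fun z => z + w) f) => //.

Qed.

(** The mean value theorem is applied twice, first to the increment z |-> f (z + h v) -
    f z in the direction u. *)
Lemma second_difference n (f : 'rV[R]_n -> R) (x u v : 'rV[R]_n) (h d : R) :
  0 < h -> h * (`|u| + `|v|) < d -> Ck 2 (ball x d) f ->
  exists2 z, ball x d z &
    f (x + h *: u + h *: v) - f (x + h *: u) - (f (x + h *: v) - f x)
      = h * (h * 'D_v ('D_u f) z).
Proof.
move=> h0 hd [df Df].
have inB (a b : R) : 0 <= a <= h -> 0 <= b <= h -> ball x d (x + a *: u + b *: v).
  move=> /andP[a0 ah] /andP[b0 bh]; rewrite -ball_normE /= -addrA opprD addNKr normrN.
  apply: le_lt_trans hd; rewrite mulrDr (le_trans (ler_normD _ _)) //.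
  by rewrite !normrZ !ger0_norm // lerD // ler_wpM2r.
have h00 : 0 <= h <= h by rewrite ltW //=.
have z00 : 0 <= (0 : R) <= h by rewrite lexx ltW.
have inB' a : 0 <= a <= h -> ball x d (x + a *: u).
  by move=> aI; have := inB a 0 aI z00; rewrite scale0r addr0.
have dsh a : 0 <= a <= h -> differentiable (fun z => f (z + h *: v)) (x + a *: u).
  by move=> aI; apply: differentiable_shift; apply/df/inB.
have dg a : 0 <= a <= h -> differentiable (fun z => f (z + h *: v) - f z) (x + a *: u).
  by move=> aI; apply: differentiableB; [exact: dsh|exact/df/inB'].
have [t /andP[t0 th] ->] := mvt_dir h0 dg.
have tI : 0 <= t <= h by rewrite !ltW.
have -> : 'D_u (fun z => f (z + h *: v) - f z) (x + t *: u) =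
   'D_u f (x + t *: u + h *: v) - 'D_u f (x + t *: u).
  rewrite -[in RHS]derive_shiftE -[LHS]/('D_u ((fun z => f (z + h *: v)) - f) (x + t *: u)).
  by apply: deriveB; apply: diff_derivable; [exact: dsh|exact/df/inB'].
have [dDf _] := Df u.
have [//|r /andP[r0 rh] ->] := mvt_dir (y := x + t *: u) (u := v) (f := 'D_u f) h0.
  by move=> r rI; apply: dDf; apply: inB.
by exists (x + t *: u + r *: v) => //; apply: inB => //; rewrite !ltW.
Qed.

Lemma dist_le_half (a b p e : R) : `|a - p| < e / 2 -> `|b - p| < e / 2 -> `|a - b| <= e.
Proof.
rewrite !ltr_norml ler_norml => /andP[H1 H2] /andP[H3 H4].
by apply/andP; split; lra.
Qed.

(** The second difference is symmetric in u and v, and is h^2 times each mixed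
    derivative at some point close to x; both are continuous at x. *)
Lemma derive_sym n (f : 'rV[R]_n -> R) (U : set 'rV[R]_n) (x u v : 'rV[R]_n) :
  open U -> Ck 2 U f -> U x -> 'D_v ('D_u f) x = 'D_u ('D_v f) x.
Proof.
move=> oU Cf Ux; apply/eqP; rewrite -subr_eq0 -normr_le0.
apply/ler_addgt0Pl => e e0; rewrite addr0.
have [_ Df] := Cf.
have c1 : {for x, continuous ('D_v ('D_u f))} by have [_ D] := Df u; exact: (D v x Ux).
have c2 : {for x, continuous ('D_u ('D_v f))} by have [_ D] := Df v; exact: (D u x Ux).
have e20 : 0 < e / 2 by rewrite divr_gt0.
have [d d0 Bd] : exists2 d, 0 < d & forall z, ball x d z -> [/\ U z,
   `|'D_v ('D_u f) x - 'D_v ('D_u f) z| < e / 2 &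
   `|'D_u ('D_v f) x - 'D_u ('D_v f) z| < e / 2].
  have n1 := open_nbhs_nbhs (conj oU Ux).
  have n2 := @cvgr_dist_lt _ _ _ _ _ _ _ c1 _ e20.
  have n3 := @cvgr_dist_lt _ _ _ _ _ _ _ c2 _ e20.
  have H : nbhs x (U `&` ((fun z => `|'D_v ('D_u f) x - 'D_v ('D_u f) z| < e / 2) `&`
    (fun z => `|'D_u ('D_v f) x - 'D_u ('D_v f) z| < e / 2))).
    by apply: filterI => //; apply: filterI; [exact: n2|exact: n3].
  by case: (nbhs_ex H) => d B; exists d%:num => // z /B[? []].
have Cd : Ck 2 (ball x d) f.
  have sub : ball x d `<=` U by move=> z /Bd[].
  have [a b] := Cf; split=> [z /sub/a//|w]; have [a' b'] := b w.
  by split=> [z /sub/a'//|w' z /sub]; exact: b'.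
(* The term 1 makes the denominator positive when u = v = 0. *)
pose h := d / 2 / (`|u| + `|v| + 1).
have uv1 : 0 < `|u| + `|v| + 1 by rewrite ltr_wpDl ?addr_ge0.
have h0 : 0 < h by rewrite !divr_gt0.
have hd : h * (`|u| + `|v|) < d.
  apply: (@le_lt_trans _ _ (h * (`|u| + `|v| + 1))).
    by rewrite ler_pM2l // lerDl.
  by rewrite /h divfK ?gt_eqF // ltr_pdivrMr // ltr_pMr // ltr1n.
have [z1 B1 E1] := second_difference h0 hd Cd.
have [z2 B2 E2] : exists2 z, ball x d z &
    f (x + h *: v + h *: u) - f (x + h *: v) - (f (x + h *: u) - f x)
      = h * (h * 'D_u ('D_v f) z).
  by apply: second_difference => //; rewrite [`|v| + _]addrC.
have E : 'D_v ('D_u f) z1 = 'D_u ('D_v f) z2.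
  have hn0 : h != 0 by rewrite gt_eqF.
  suff : h * (h * 'D_v ('D_u f) z1) = h * (h * 'D_u ('D_v f) z2).
    by move=> /(mulfI hn0)/(mulfI hn0).
  have sw (a b c a' : R) : a - b - (c - a') = a - c - (b - a') by ring.
  apply: etrans; first exact: esym E1.
  by apply: etrans (sw _ _ _ _) _; apply: etrans E2; rewrite (addrAC x).
have [_ H1 _] := Bd _ B1; have [_ _ H2] := Bd _ B2.
by rewrite E in H1; exact: dist_le_half H1 H2.
Qed.

End Calculus.

(** * Smooth germs and derivations on a manifold *)

Section Germs.
Variables (R : realType) (n : nat) (M : manifold R n).
Implicit Types (x y : M) (U V : set M) (f g : M -> R) (c : chart R n M).

(** Frames, charts and sections are only meaningful on their domains, so smoothness is
    handled through germs. *)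
Definition snear x f := exists2 U : set M, open U /\ U x & smooth_on U f.

Lemma Ck_sub k (W W' : set 'rV[R]_n) h : W `<=` W' -> Ck k W' h -> Ck k W h.
Proof.
move=> WW'; elim: k h => [|k IH] h /=; first by move=> ch v /WW'/ch.
by case=> dh Dh; split=> [v /WW'/dh//|v]; apply/IH/Dh.
Qed.

(** [Ck k W] only constrains a function at the points of W, so it can be checked with
    another set at each point. *)
Lemma Ck_pointwise k (W : set 'rV[R]_n) h :
  (forall v, W v -> exists2 V : set 'rV[R]_n, V v & Ck k V h) -> Ck k W h.
Proof.
elim: k h => [|k IH] h H; first by move=> v /H[V Vv]; apply.
split=> [v /H[V Vv [dh _]]|w]; first exact: dh.
apply: IH => v Wv; have [V Vv [_ Dh]] := H v Wv; exists V => //; exact: Dh.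
Qed.

Lemma smooth_on_local U f : (forall x, U x -> snear x f) -> smooth_on U f.
Proof.
move=> H c Ac k; apply: Ck_pointwise => _ [x [Ux cx] <-].
have [V [oV Vx] SV] := H x Ux; exists (cmap c @` (V `&` cdom c)); last exact: SV.
by exists x.
Qed.

Lemma snear_on U f x : open U -> U x -> smooth_on U f -> snear x f.
Proof. by move=> oU Ux SU; exists U. Qed.

Lemma snear_near x f : snear x f -> \forall y \near x, snear y f.
Proof.
move=> [U [oU Ux] SU]; have := open_nbhs_nbhs (conj oU Ux).
by apply: filterS => y Uy; exists U.
Qed.

Lemma near_open (T : topologicalType) (x : T) (P : T -> Prop) : (\forall y \near x, P y) ->
  exists2 V : set T, open V /\ V x & forall y : T, V y -> P y.
Proof. by move=> H; move: (H : nbhs x P); rewrite nbhsE => -[V [? ?] ?]; exists V. Qed.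

Lemma snear_ext x f g : (\forall y \near x, f y = g y) -> snear x f -> snear x g.
Proof.
move=> fg [U [oU Ux] SU].
have [V [oV Vx] VE] := near_open fg.
exists (U `&` V); first by split; [exact: openI|].
apply: (@smooth_on_ext _ _ _ _ f); first exact: openI.
  by move=> y [_ /VE].
exact: smooth_on_sub SU.
Qed.

Lemma snear_cst x (a : R) : snear x (fun=> a).
Proof.
exists setT; first by split=> //; exact: openT.
by move=> c Ac k; apply: Ck_cst.
Qed.

Lemma snearD x f g : snear x f -> snear x g -> snear x (fun y => f y + g y).
Proof.
move=> [U [oU Ux] SU] [V [oV Vx] SV]; exists (U `&` V).
  by split; [exact: openI|].
by apply: smooth_onD; [exact: openI|exact: smooth_on_sub SU|exact: smooth_on_sub SV].
Qed.

Lemma snearM x f g : snear x f -> snear x g -> snear x (fun y => f y * g y).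
Proof.
move=> [U [oU Ux] SU] [V [oV Vx] SV]; exists (U `&` V).
  by split; [exact: openI|].
by apply: smooth_onM; [exact: openI|exact: smooth_on_sub SU|exact: smooth_on_sub SV].
Qed.

Lemma snearN x f : snear x f -> snear x (fun y => - f y).
Proof.
move=> Sf; have := snearM (snear_cst x (-1)) Sf.
by apply: snear_ext; apply: nearW => y; rewrite mulN1r.
Qed.

Lemma snearB x f g : snear x f -> snear x g -> snear x (fun y => f y - g y).
Proof. by move=> Sf Sg; apply: snearD => //; apply: snearN. Qed.

Lemma snear_sum (I : Type) (r : seq I) (P : pred I) (f : I -> M -> R) x :
  (forall i, P i -> snear x (f i)) -> snear x (fun y => \sum_(i <- r | P i) f i y).
Proof.
move=> Sf; elim: r => [|i r IH].
  by apply: snear_ext (snear_cst x 0); apply: nearW => y; rewrite big_nil.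
case Pi: (P i); last first.
  by apply: snear_ext IH; apply: nearW => y; rewrite big_cons Pi.
apply: snear_ext (snearD (Sf i Pi) IH); apply: nearW => y; by rewrite big_cons Pi.
Qed.

Lemma snear_prod (I : Type) (r : seq I) (f : I -> M -> R) x :
  (forall i, snear x (f i)) -> snear x (fun y => \prod_(i <- r) f i y).
Proof.
move=> Sf; elim: r => [|i r IH].
  by apply: snear_ext (snear_cst x 1); apply: nearW => y; rewrite big_nil.
apply: snear_ext (snearM (Sf i) IH); apply: nearW => y; by rewrite big_cons.
Qed.

Lemma chart_img_nbhs c x V : open V -> V x -> cdom c x ->
  nbhs (cmap c x) (cmap c @` (V `&` cdom c)).
Proof.
move=> oV Vx cx; apply: open_nbhs_nbhs; split; last by exists x.
exact: cimg_sub_open.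
Qed.

Lemma snear_differentiable c x f : atlas c -> cdom c x -> snear x f ->
  differentiable (f \o cinv c : 'rV[R]_n -> R) (cmap c x).
Proof.
move=> Ac cx [U [oU Ux] SU]; have [d _] := SU c Ac 1%N.
by apply: d; exists x.
Qed.

Lemma cinv_near c x (P : set M) : cdom c x -> nbhs x P ->
  \forall v \near cmap c x, P (cinv c v).
Proof.
move=> cx xP; have : (cmap c @` cdom c) (cmap c x) by exists x.
move=> /(@cinv_cts _ _ _ c); apply; by rewrite cmapK.
Qed.

Lemma snear_continuous x f : snear x f -> {for x, continuous f}.
Proof.
move=> Sf; have Ac := chart_at_atlas x; have cx := chart_at_dom x.
set c := chart_at x in Ac cx.
have cf := differentiable_continuous (snear_differentiable Ac cx Sf).
have : {for x, continuous ((f \o cinv c) \o cmap c)}.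
  by apply: continuous_comp => //; exact: cmap_cts.
move=> H; have E : \forall y \near x, ((f \o cinv c) \o cmap c) y = f y.
  have := open_nbhs_nbhs (conj (@cdom_open _ _ _ c) cx).
  by apply: filterS => y cy /=; rewrite cmapK.
by move=> P; rewrite -(nbhs_singleton E) => /H; apply: filterS2 E => y /= <-.
Qed.

Lemma snear_neq0 x f : f x != 0 -> snear x f -> \forall y \near x, f y != 0.
Proof.
move=> f0 /snear_continuous cf.
by apply: (cf (fun t => t != 0)); apply: open_nbhs_nbhs; split=> //; exact: open_neq.
Qed.

Lemma snear_inv x f : f x != 0 -> snear x f -> snear x (fun y => (f y)^-1).
Proof.
move=> f0 Sf; have n0 := snear_neq0 f0 Sf.
have [U [oU Ux] SU] := Sf; have [V [oV Vx] VE] := near_open n0.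
exists (U `&` V); first by split; [exact: openI|].
move=> c Ac k; apply: Ck_inv.
- exact/cimg_sub_open/openI.
- by move=> _ [y [[_ /VE fy] cy] <-] /=; rewrite cmapK.
- by have : smooth_on (U `&` V) f := smooth_on_sub (@subIsetl _ _ _) SU; apply.
Qed.

(** In another chart the function is composed with a transition map, which is smooth. *)
Lemma smooth_on_chart c U f : atlas c -> open U -> U `<=` cdom c ->
  Cinf (cmap c @` U) (f \o cinv c) -> smooth_on U f.
Proof.
move=> Ac oU Uc Sf c' Ac' k.
have oI : open (cmap c' @` (U `&` cdom c')) by exact: cimg_sub_open.
apply: (@Ck_ext _ _ _ _ ((f \o cinv c) \o (cmap c \o cinv c'))) => //.
  move=> _ /[1!inE] -[y [Uy cy] <-] /=; rewrite cmapK // cmapK //; exact: Uc.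
apply: (Ck_comp (V := cmap c @` U)) => //.
- by move=> _ [y [Uy cy] <-] /=; exists y => //; rewrite cmapK.
- move=> j l; have := atlas_smooth Ac' Ac j l; apply: Ck_sub.
  by move=> _ [y [Uy cy] <-]; exists y => //; split=> //; exact: Uc.
Qed.

Lemma snear_coordf c i x : atlas c -> cdom c x -> snear x (coordf c i).
Proof.
move=> Ac cx; exists (cdom c); first by split=> //; exact: cdom_open.
apply: smooth_on_chart Ac (@cdom_open _ _ _ c) _ _ => //.
have o : open (cmap c @` cdom c) by exact: cimg_open.
move=> k; apply: Ck_ext (Ck_coord k _ i) => // v /[1!inE] -[y cy <-] /=.
by rewrite /coordf cmapK.
Qed.

(** Derivative along a vector that is constant in the chart c. Both [pderiv] and
    [tderiv] are instances of it and inherit its rules. *)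
Definition dv c x v f : R := 'D_v (f \o cinv c : 'rV[R]_n -> R) (cmap c x).

Lemma snear_dv c x v f : atlas c -> cdom c x -> snear x f -> snear x (fun y => dv c y v f).
Proof.
move=> Ac cx [U [oU Ux] SU]; have oI := openI oU (@cdom_open _ _ _ c).
exists (U `&` cdom c); first by split.
apply: (smooth_on_chart Ac oI); first exact: subIsetr.
move=> k; have [_ D] := SU c Ac k.+1; apply: Ck_ext (D v); first exact: cimg_sub_open.
move=> w /[1!inE] -[y [Uy cy] <-] /=; by rewrite /dv cmapK.
Qed.

Section DV.
Variables (c : chart R n M) (x : M) (v : 'rV[R]_n).
Hypotheses (Ac : atlas c) (cx : cdom c x).

Lemma dv_ext f g : (\forall y \near x, f y = g y) -> dv c x v f = dv c x v g.
Proof. by move=> fg; apply: near_eq_derive; exact: cinv_near fg. Qed.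

Let drv f (Sf : snear x f) : derivable (f \o cinv c : 'rV[R]_n -> R) (cmap c x) v.
Proof. exact/diff_derivable/snear_differentiable. Qed.

Lemma dvD f g : snear x f -> snear x g ->
  dv c x v (fun y => f y + g y) = dv c x v f + dv c x v g.
Proof. by move=> Sf Sg; rewrite /dv -deriveD //; exact: drv. Qed.

Lemma dvM f g : snear x f -> snear x g ->
  dv c x v (fun y => f y * g y) = f x * dv c x v g + g x * dv c x v f.
Proof.
move=> Sf Sg; have := deriveM (drv Sf) (drv Sg).
by rewrite /= cmapK.
Qed.

Lemma dv_cst (a : R) : dv c x v (fun=> a) = 0.
Proof. exact: derive_cst. Qed.

Lemma dvN f : snear x f -> dv c x v (fun y => - f y) = - dv c x v f.
Proof. by move=> Sf; rewrite /dv -deriveN //; exact: drv. Qed.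

Lemma dvB f g : snear x f -> snear x g ->
  dv c x v (fun y => f y - g y) = dv c x v f - dv c x v g.
Proof. by move=> Sf Sg; rewrite dvD ?dvN //; exact: snearN. Qed.

Lemma dv_sum (I : Type) (r : seq I) (P : pred I) (f : I -> M -> R) :
  (forall i, P i -> snear x (f i)) ->
  dv c x v (fun y => \sum_(i <- r | P i) f i y) = \sum_(i <- r | P i) dv c x v (f i).
Proof.
move=> Sf; elim: r => [|i r IH].
  rewrite big_nil -[RHS](dv_cst 0); apply: dv_ext; apply: nearW => y; by rewrite big_nil.
rewrite big_cons; case Pi: (P i); last first.
  by rewrite -IH; apply: dv_ext; apply: nearW => y; rewrite big_cons Pi.
rewrite -IH -dvD; [|exact: Sf|exact: snear_sum].
by apply: dv_ext; apply: nearW => y; rewrite big_cons Pi.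
Qed.

End DV.

Lemma dv_lin c x (a : R) v w f : atlas c -> cdom c x -> snear x f ->
  dv c x (a *: v + w) f = a * dv c x v f + dv c x w f.
Proof.
move=> Ac cx Sf; have d := snear_differentiable Ac cx Sf.
by rewrite /dv !deriveE // linearP.
Qed.

Lemma chain_rule c c' x v f : atlas c -> atlas c' -> cdom c x -> cdom c' x ->
  snear x f ->
  dv c x v f = \sum_j dv c x v (coordf c' j) * pderiv c' j f x.
Proof.
move=> Ac Ac' cx cx' Sf.
have E : \forall y \near cmap c x,
    (f \o cinv c) y = ((f \o cinv c') \o (cmap c' \o cinv c)) y.
  have := cinv_near cx (open_nbhs_nbhs (conj (@cdom_open _ _ _ c') cx')).
  by apply: filterS => w /= cw; rewrite cmapK.
rewrite /dv (near_eq_derive _ E).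
have [|| _ ->] := @derive_comp_rV R _ n (cmap c' \o cinv c) (f \o cinv c') (cmap c x) v.
- by move=> j; apply: (snear_differentiable Ac cx (snear_coordf j Ac' cx')).
- by rewrite /= cmapK //; apply: snear_differentiable.
- by rewrite /= cmapK.
Qed.

Lemma pderiv_coord c i j x : atlas c -> cdom c x -> pderiv c i (coordf c j) x = (i == j)%:R.
Proof.
move=> Ac cx; rewrite /pderiv.
have E : \forall v \near cmap c x, (coordf c j \o cinv c) v = v ord0 j.
  have ix : (cmap c @` cdom c) (cmap c x) by exists x.
  have := open_nbhs_nbhs (conj (@cimg_open _ _ _ c) ix).
  by apply: filterS => _ [y cy <-] /=; rewrite cmapK.
rewrite (near_eq_derive _ E).
have := @derive_mx _ _ 1 n (id : 'rV[R]_n -> 'rV[R]_n) (cmap c x) (delta_mx ord0 i).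
rewrite derive_id => H.
have := congr1 (fun A : 'rV_n => A ord0 j) (H _); rewrite !mxE eqxx eq_sym /= => <- //.
Qed.

Lemma tderivE c x v f : atlas c -> cdom c x -> snear x f ->
  tderiv x v f = \sum_i tcomp c x v i * pderiv c i f x.
Proof.
move=> Ac cx Sf; exact: chain_rule (chart_at_atlas x) Ac (chart_at_dom x) cx Sf.
Qed.

Lemma tcomp_chart_at x v i : tcomp (chart_at x) x v i = v ord0 i.
Proof.
have Ac := chart_at_atlas x; have cx := chart_at_dom x.
have S := snear_coordf i Ac cx.
have d := snear_differentiable Ac cx S.
rewrite /tcomp /tderiv deriveE // {1}(row_sum_delta v) linear_sum /= (bigD1 i) //= linearZ /= -deriveE //.
rewrite -/(pderiv _ _ _ _) pderiv_coord // eqxx /= big1 ?addr0 ?[_ *: _]mulr1 // => j ji.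
rewrite linearZ /= -deriveE // -/(pderiv _ _ _ _) pderiv_coord // (negbTE ji).
by rewrite scaler0.
Qed.

(** The tangent vector with components w in the chart c, written in the preferred chart
    at x. *)
Definition tvec c x (w : 'rV[R]_n) : 'rV[R]_n :=
  \row_j \sum_i w ord0 i * pderiv c i (coordf (chart_at x) j) x.

Lemma tcomp_tvec c x w i : atlas c -> cdom c x -> tcomp c x (tvec c x w) i = w ord0 i.
Proof.
move=> Ac cx; have Ac' := chart_at_atlas x; have cx' := chart_at_dom x.
rewrite /tcomp (tderivE _ Ac' cx' (snear_coordf i Ac cx)).
under eq_bigr do rewrite tcomp_chart_at mxE mulr_suml.
rewrite exchange_big /= (bigD1 i) //= [X in _ + X]big1 ?addr0 => [|j ji].
  under eq_bigr do rewrite -mulrA; rewrite -mulr_sumr.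
  rewrite -(chain_rule (delta_mx ord0 i) Ac Ac' cx cx' (snear_coordf i Ac cx)).
  by rewrite -[dv _ _ _ _]/(pderiv _ _ _ _) pderiv_coord // eqxx mulr1.
under eq_bigr do rewrite -mulrA; rewrite -mulr_sumr.
rewrite -(chain_rule (delta_mx ord0 j) Ac Ac' cx cx' (snear_coordf i Ac cx)).
by rewrite -[dv _ _ _ _]/(pderiv _ _ _ _) pderiv_coord // (negbTE ji) mulr0.
Qed.

Lemma tcomp_inj c x v w : atlas c -> cdom c x ->
  (forall i, tcomp c x v i = tcomp c x w i) -> v = w.
Proof.
move=> Ac cx H; apply/rowP => j; rewrite -!(tcomp_chart_at x) /tcomp.
rewrite !(tderivE _ Ac cx (snear_coordf j (chart_at_atlas x) (chart_at_dom x))).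
by apply: eq_bigr => i _; rewrite H.
Qed.

Lemma tderiv_lin x (a : R) v w f : snear x f ->
  tderiv x (a *: v + w) f = a * tderiv x v f + tderiv x w f.
Proof. move=> Sf; exact: dv_lin (chart_at_atlas x) (chart_at_dom x) Sf. Qed.

Lemma tderivZl x (a : R) v f : snear x f -> tderiv x (a *: v) f = a * tderiv x v f.
Proof.
move=> Sf; have := tderiv_lin a v 0 Sf; rewrite addr0 => ->.
by rewrite /tderiv derive0 addr0.
Qed.

Lemma tderivDl x v w f : snear x f -> tderiv x (v + w) f = tderiv x v f + tderiv x w f.
Proof. by move=> Sf; have := tderiv_lin 1 v w Sf; rewrite scale1r mul1r. Qed.

Lemma tderiv_suml (I : Type) (r : seq I) (P : pred I) x (v : I -> 'rV[R]_n) f : snear x f ->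
  tderiv x (\sum_(i <- r | P i) v i) f = \sum_(i <- r | P i) tderiv x (v i) f.
Proof.
move=> Sf; elim/big_rec2: _ => [|i y1 y2 _ <-]; last by rewrite tderivDl.
by rewrite /tderiv derive0.
Qed.

Section Tderiv.
Variables (x : M) (v : 'rV[R]_n).
Let Ac := chart_at_atlas x.
Let cx := chart_at_dom x.

Lemma tderiv_ext f g : (\forall y \near x, f y = g y) -> tderiv x v f = tderiv x v g.
Proof. exact: (@dv_ext _ x v cx). Qed.
Lemma tderivD f g : snear x f -> snear x g ->
  tderiv x v (fun y => f y + g y) = tderiv x v f + tderiv x v g.
Proof. exact: (dvD v Ac cx). Qed.
Lemma tderivM f g : snear x f -> snear x g ->
  tderiv x v (fun y => f y * g y) = f x * tderiv x v g + g x * tderiv x v f.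
Proof. exact: (dvM v Ac cx). Qed.
Lemma tderiv_cst (a : R) : tderiv x v (fun=> a) = 0.
Proof. exact: dv_cst. Qed.
Lemma tderivN f : snear x f -> tderiv x v (fun y => - f y) = - tderiv x v f.
Proof. exact: (dvN v Ac cx). Qed.
Lemma tderivB f g : snear x f -> snear x g ->
  tderiv x v (fun y => f y - g y) = tderiv x v f - tderiv x v g.
Proof. exact: (dvB v Ac cx). Qed.
Lemma tderiv_sum (I : Type) (r : seq I) (P : pred I) (f : I -> M -> R) :
  (forall i, P i -> snear x (f i)) ->
  tderiv x v (fun y => \sum_(i <- r | P i) f i y) = \sum_(i <- r | P i) tderiv x v (f i).
Proof. exact: (@dv_sum _ _ v Ac cx). Qed.

Lemma tderiv_near_cst f (a : R) : (\forall y \near x, f y = a) -> tderiv x v f = 0.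
Proof. by move=> /tderiv_ext ->; exact: tderiv_cst. Qed.
End Tderiv.

Lemma snear_pderiv c x i f : atlas c -> cdom c x -> snear x f -> snear x (pderiv c i f).
Proof. exact: snear_dv. Qed.

Lemma chart_near c x : cdom c x -> \forall y \near x, cdom c y.
Proof. by move=> cx; apply: open_nbhs_nbhs; split=> //; exact: cdom_open. Qed.

Lemma snear_tderiv c x (X : M -> 'rV[R]_n) f : atlas c -> cdom c x ->
  (forall i, snear x (fun y => tcomp c y (X y) i)) -> snear x f ->
  snear x (fun y => tderiv y (X y) f).
Proof.
move=> Ac cx SX Sf.
apply: (@snear_ext _ (fun y => \sum_i tcomp c y (X y) i * pderiv c i f y)).
  apply: filterS2 (snear_near Sf) (chart_near cx) => y Sy cy.
  by rewrite (tderivE _ Ac cy Sy).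
apply: snear_sum => i _; apply: snearM (SX i) _; exact: snear_pderiv.
Qed.

Lemma pderiv_sym c x i j f : atlas c -> cdom c x -> snear x f ->
  pderiv c i (pderiv c j f) x = pderiv c j (pderiv c i f) x.
Proof.
move=> Ac cx [U [oU Ux] SU].
have near_im : \forall v \near cmap c x, (cmap c @` (U `&` cdom c)) v.
  exact: chart_img_nbhs.
have E l : \forall v \near cmap c x,
    (pderiv c l f \o cinv c) v = 'D_(delta_mx ord0 l) (f \o cinv c : 'rV[R]_n -> R) v.
  by apply: filterS near_im => _ [y [Uy cy] <-] /=; rewrite /pderiv cmapK.
rewrite {1}/pderiv (near_eq_derive _ (E j)) [RHS]/pderiv (near_eq_derive _ (E i)).
have Hx : (cmap c @` (U `&` cdom c)) (cmap c x) by exists x.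
refine (@derive_sym R n (f \o cinv c) _ (cmap c x) (delta_mx ord0 j)
  (delta_mx ord0 i) (cimg_sub_open oU) (SU c Ac 2%N) Hx).
Qed.

(** The second derivatives of f cancel by symmetry, which leaves the first order terms,
    that is the components of the bracket. *)
Lemma tderiv_lie_bracket c x (X Y : M -> 'rV[R]_n) (Z : 'rV[R]_n) f :
  atlas c -> cdom c x ->
  (forall i, snear x (fun y => tcomp c y (X y) i)) ->
  (forall i, snear x (fun y => tcomp c y (Y y) i)) ->
  snear x f ->
  (forall i, tcomp c x Z i = lie_bracket_comp c X Y i x) ->
  tderiv x Z f = tderiv x (X x) (fun y => tderiv y (Y y) f)
               - tderiv x (Y x) (fun y => tderiv y (X y) f).
Proof.
move=> Ac cx SX SY Sf ZE.
(* T1 gathers the terms of first order in f, T2 those of second order. *)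
pose T1 X' Y' := \sum_i \sum_j
  tcomp c x (X' x) j * pderiv c j (fun y => tcomp c y (Y' y) i) x * pderiv c i f x.
pose T2 X' Y' := \sum_i \sum_j
  tcomp c x (X' x) j * tcomp c x (Y' x) i * pderiv c j (pderiv c i f) x.
have aux (X' Y' : M -> 'rV[R]_n) : (forall i, snear x (fun y => tcomp c y (Y' y) i)) ->
  tderiv x (X' x) (fun y => tderiv y (Y' y) f) = T1 X' Y' + T2 X' Y'.
  move=> SY'.
  rewrite (@tderiv_ext _ _ _ (fun y => \sum_i tcomp c y (Y' y) i * pderiv c i f y)); last first.
    apply: filterS2 (snear_near Sf) (chart_near cx) => y Sy cy.
    by rewrite (tderivE _ Ac cy Sy).
  have SM i : snear x (fun y => tcomp c y (Y' y) i * pderiv c i f y).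
    apply: snearM (SY' i) _; exact: snear_pderiv.
  rewrite tderiv_sum // -big_split /=; apply: eq_bigr => i _.
  rewrite (tderivE _ Ac cx (SM i)) -big_split /=; apply: eq_bigr => j _.
  rewrite -[pderiv _ _ _ _]/(dv c x _ _) dvM //; last exact: snear_pderiv.
  have sw (a b d e g : R) : a * (b * d + e * g) = a * g * e + a * b * d by ring.
  exact: sw.
have -> : tderiv x Z f = T1 X Y - T1 Y X.
  rewrite (tderivE _ Ac cx Sf) /T1 -sumrB; apply: eq_bigr => i _.
  rewrite ZE /lie_bracket_comp mulr_suml -sumrB; apply: eq_bigr => j _.
  by rewrite mulrBl.
rewrite (aux X Y SY) (aux Y X SX).
have -> : T2 X Y = T2 Y X.
  rewrite /T2 exchange_big /=; apply: eq_bigr => i _; apply: eq_bigr => j _.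
  by rewrite pderiv_sym // [X in X * _]mulrC.
by move: (T1 X Y) (T1 Y X) (T2 Y X) => a b d; ring.
Qed.

(** A bump function in a chart is extended by 0. This is smooth because the support is
    compact in the Hausdorff space M, hence closed there and not only in the chart. *)
Lemma exists_bump x U : open U -> U x -> exists chi : cfun M,
  (\forall y \near x, chi y = 1) /\
  (forall y, ~ U y -> \forall z \near y, chi z = 0).
Proof.
move=> oU Ux; have Ac := chart_at_atlas x; have cx := chart_at_dom x.
set c := chart_at x in Ac cx.
have [d Bd] := nbhs_ex (chart_img_nbhs oU Ux cx).
have [h [Ch h1 [K [cK Kd hK]]]] := Cinf_bump (cmap c x) (gt0 d).
have KU v : K v -> (cmap c @` (U `&` cdom c)) v by move=> /Kd/Bd.
pose K' := cinv c @` K.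
have clK' : closed K'.
  apply: compact_closed; first exact: mhausdorff.
  apply: continuous_compact => //; apply: continuous_in_subspaceT => v /[1!inE] /KU.
  by move=> [y [_ cy] <-]; apply: cinv_cts; exists y.
have K'U y : K' y -> U y.
  by move=> [v /KU[z [Uz cz] <-] <-]; rewrite cmapK.
pose chi y : R := if `[< cdom c y >] then h (cmap c y) else 0.
have chi0 y : ~ K' y -> chi y = 0.
  move=> nK; rewrite /chi; case: asboolP => // cy; apply: hK => Ky; apply: nK.
  by exists (cmap c y) => //; rewrite cmapK.
have near0 y : ~ K' y -> \forall z \near y, chi z = 0.
  move=> nK; have : open (~` K') by exact: closed_openC.
  move=> oK; have := open_nbhs_nbhs (conj oK nK).
  by apply: filterS => z /chi0.
have Schi : smooth_on setT chi.
  apply: smooth_on_local => y _.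
  have [cy|ncy] := pselect (cdom c y); last first.
    apply: snear_ext (snear_cst y 0).
    have nK : ~ K' y.
      by move=> [v /KU[z [Uz cz] <-]]; rewrite cmapK // => zy; apply: ncy; rewrite -zy.
    by apply: filterS (near0 y nK) => z ->.
  exists (cdom c); first by split=> //; exact: cdom_open.
  apply: smooth_on_chart Ac (@cdom_open _ _ _ c) _ _ => //.
  move=> k; apply: Ck_ext (Ck_sub (@subsetT _ _) (Ch k)); first exact: cimg_open.
  by move=> v /[1!inE] -[z cz <-] /=; rewrite /chi cmapK // asboolT.
exists (CFun Schi); split=> [|y nU]; last by apply: near0 => /K'U.
have := cmap_cts cx h1; apply: filterS2 (chart_near cx) => y cy /= h1y.
by rewrite /chi asboolT.
Qed.

Lemma cfun_snear (f : cfun M) x : snear x f.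
Proof. by apply: snear_on openT _ (cfun_smooth f). Qed.

Lemma cutoff_cfun U (chi : cfun M) f :
  (forall y, ~ U y -> \forall z \near y, chi z = 0) -> (forall y, U y -> snear y f) ->
  exists g : cfun M, forall y, g y = chi y * f y.
Proof.
move=> chi0 Sf; have S : smooth_on setT (fun y => chi y * f y).
  apply: smooth_on_local => y _; have [Uy|nUy] := pselect (U y).
    by apply: snearM; [exact: cfun_snear|exact: Sf].
  apply: snear_ext (snear_cst y 0).
  by apply: filterS (chi0 y nUy) => z ->; rewrite mul0r.
by exists (CFun S).
Qed.

Lemma exists_cfun x f : snear x f -> exists g : cfun M, \forall y \near x, g y = f y.
Proof.
move=> [U [oU Ux] SU]; have [chi [chi1 chi0]] := exists_bump oU Ux.
have [|g gE] := cutoff_cfun (f := f) chi0; first by move=> y Uy; exists U.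
by exists g; apply: filterS chi1 => y /= cy; rewrite gE cy mul1r.
Qed.

End Germs.

(** * Functions constant on the leaves *)

Section FoliatedFunctions.
Variables (R : realType) (p q : nat) (M : manifold R (p + q)) (F : foliation M).
Implicit Types (x y : M) (V : set M) (f g : M -> R) (c : chart R (p + q) M).

Lemma connected_locally_constant (T : topologicalType) (T' : Type) (P : set T)
    (f : T -> T') (x y : T) :
  connected P -> (forall z, P z -> \forall w \near z, P w -> f w = f z) ->
  P x -> P y -> f x = f y.
Proof.
move=> cP loc Px Py.
pose B := [set z | P z /\ f z = f x].
suff BE : B = P by have [] : B y by rewrite BE.
apply: cP; first by exists x.
- exists (\bigcup_(O in [set O : set T | open O /\ forall w, O w -> P w -> f w = f x]) O).
    by apply: bigcup_open => O [].
  apply/seteqP; split=> z /=.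
    move=> [Pz fz]; split=> //.
    have [W [oW Wz] WP] := near_open (loc z Pz).
    by exists W => //; split=> // w Ww Pw; rewrite WP.
  by move=> [Pz [W [oW WP] Wz]]; split=> //; exact: WP.
- exists (~` \bigcup_(O in [set O : set T | open O /\ forall w, O w -> P w -> f w <> f x]) O).
    by apply: open_closedC; apply: bigcup_open => O [].
  apply/seteqP; split=> z /=.
    by move=> [Pz fz]; split=> // -[W [oW WP] Wz]; exact: (WP z).
  move=> [Pz nO]; split=> //; apply: contrapT => fz; apply: nO.
  have [W [oW Wz] WP] := near_open (loc z Pz).
  by exists W => //; split=> // w Ww Pw; rewrite WP.
Qed.

(** Two close points of a connected part of a plaque have the same transverse
    coordinates, so that the mean value theorem on the segment joining them in the chart
    only sees derivatives along the leaf. Thus f is locally constant on that part. *)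
Lemma foliated_on_pderiv0 V f : open V -> (forall x, V x -> snear x f) ->
  (forall x c, V x -> fcharts F c -> cdom c x -> forall u : 'I_q,
     pderiv c (rshift p u) f x = 0) ->
  foliated_on F V f.
Proof.
move=> oV Sf df x y _ _; elim=> // {x y} [x y [c Fc [P [cP PV Px Py Pa]]]|x y z _ xy _ yz].
  apply: connected_locally_constant cP _ Px Py => z Pz.
  have [Vz cz] := PV z Pz; have Ac := fcharts_atlas Fc.
  have [d Bd] := nbhs_ex (chart_img_nbhs oV Vz cz).
  have nw : \forall w \near z, ball (cmap c z) d%:num (cmap c w).
    exact: (cmap_cts cz (nbhsx_ballx (cmap c z) _ (gt0 d))).
  apply: filterS nw => w Bw Pw; have [Vw cw] := PV w Pw.
  pose u := cmap c w - cmap c z.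
  have inB t : 0 <= t <= 1 -> (cmap c @` (V `&` cdom c)) (cmap c z + t *: u).
    move=> /andP[t0 t1]; apply: Bd; rewrite -ball_normE /= opprD addNKr normrN normrZ ger0_norm //.
    move: Bw; rewrite -ball_normE /= distrC => Bw.
    by apply: le_lt_trans Bw; rewrite ler_piMl.
  have [t tI|t /andP[t0 t1]] := mvt_dir (f := f \o cinv c) (y := cmap c z) (u := u) ltr01.
    by have [y1 [Vy cy] <-] := inB t tI; apply: snear_differentiable (Sf y1 Vy).
  have [|y1 [Vy cy] yE] := inB t; first by rewrite !ltW.
  rewrite /= scale1r [cmap c z + u]addrC subrK !cmapK // mul1r -yE => E.
  apply/eqP; rewrite -subr_eq0 E; apply/eqP.
  have Sy := Sf y1 Vy; have dy := snear_differentiable Ac cy Sy.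
  rewrite deriveE // (row_sum_delta u) linear_sum big1 // => i _ /=.
  rewrite linearZ /= -deriveE // -/(pderiv c i f y1).
  have [a ia|b ib] := fintype.splitP i.
    have -> : i = lshift q a by apply/val_inj.
    have H1 := Pa w Pw a; have H2 := Pa z Pz a.
    rewrite /coordf in H1 H2; by rewrite /u !mxE H1 H2 subrr scale0r.
  have -> : i = rshift p b by apply/val_inj.
  by rewrite df // scaler0.
by rewrite xy.
Qed.

(** A short coordinate segment in a leaf direction is connected and keeps the transverse
    coordinates, so f is constant on it. *)
Lemma pderiv_foliated_on V f x c u : open V -> foliated_on F V f -> V x ->
  fcharts F c -> cdom c x -> pderiv c (rshift p u) f x = 0.
Proof.
move=> oV Ff Vx Fc cx.
have [d Bd] := nbhs_ex (chart_img_nbhs oV Vx cx).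
pose e : 'rV[R]_(p + q) := delta_mx ord0 (rshift p u).
have inB (t : R) : `|t| < d%:num -> (cmap c @` (V `&` cdom c)) (cmap c x + t *: e).
  move=> td; apply: Bd; rewrite -ball_normE /= opprD addNKr normrN normrZ.
  apply: le_lt_trans td; rewrite ler_piMr //.
  rewrite [leLHS]mx_normrE; apply/bigmax_leP; split=> // -[i j] _ /=.
  by rewrite !mxE; case: eqP => _; case: eqP => _; rewrite ?normr1 ?normr0.
have const (t : R) : `|t| < d%:num -> f (cinv c (cmap c x + t *: e)) = f x.
  move=> td; have [y [Vy cy] yE] := inB t td.
  rewrite -yE cmapK //; symmetry; apply: Ff => //; apply: Relation_Operators.rt_step; exists c => //.
  pose g (s : R) := cinv c (cmap c x + (s * t) *: e).
  have sd s : 0 <= s <= 1 -> `|s * t| < d%:num.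
    move=> /andP[s0 s1]; rewrite normrM; apply: le_lt_trans td.
    by rewrite ler_piMl // ger0_norm.
  exists (g @` `[0, 1]); split.
  - apply: connected_continuous_connected; first exact: segment_connected.
    apply: continuous_in_subspaceT => s /[1!inE] /=; rewrite in_itv /= => sI.
    apply: (@continuous_comp _ _ _ (fun s : R => cmap c x + (s * t) *: e) (cinv c)); last first.
      by apply: cinv_cts; have [z [_ cz] <-] := inB _ (sd s sI); exists z.
    apply: (@cvgD _ _ _ (nbhs s)); first exact: cvg_cst.
    apply: cvgZl; apply: cvgMl; exact: cvg_id.
  - move=> z0 [s sI0 <-]; rewrite /g; have sI : 0 <= s <= 1 by move: sI0; rewrite /= in_itv.
    by have [z [Vz cz] <-] := inB _ (sd s sI); rewrite cmapK.
  - exists 0; first by rewrite /= in_itv /= lexx ler01.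
    by rewrite /g mul0r scale0r addr0 cmapK.
  - exists 1; first by rewrite /= in_itv /= lexx ler01.
    by rewrite /g mul1r -yE cmapK.
  move=> z0 [s sI0 <-] a; rewrite /g /coordf.
  have sI : 0 <= s <= 1 by move: sI0; rewrite /= in_itv.
  have [z [Vz cz] zE] := inB _ (sd s sI); rewrite -zE cmapK // zE !mxE.
  by rewrite eq_lrshift andbF mulr0 addr0.
rewrite /pderiv -(derive_cst (f x : R) (cmap c x) e).
have nE : \forall h \near (0 : R)^',
    h^-1 *: ((cst (f x) \o shift (cmap c x)) (h *: e) - cst (f x) (cmap c x)) =
    h^-1 *: (((f \o cinv c) \o shift (cmap c x)) (h *: e) - (f \o cinv c) (cmap c x)).
  near=> h; rewrite /= [h *: e + _]addrC const ?cmapK //.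
  by near: h; exact: dnbhs0_lt.
rewrite /derive; symmetry; apply: (congr1 (fun G => lim G)); apply/seteqP; split.
  by apply: near_eq_cvg; apply: filterS nE => h ->.
by apply: (near_eq_cvg (F := 0^')); apply: filterS nE => h.
Unshelve. all: by end_near. Qed.

End FoliatedFunctions.

Section FoliatedLeafwise.
Variables (R : realType) (p q : nat) (M : manifold R (p + q)) (F : foliation M).
Implicit Types (x y : M) (V U : set M) (f : M -> R).

Lemma foliated_on_sub V U f : V `<=` U -> foliated_on F U f -> foliated_on F V f.
Proof.
move=> VU Ff x y Vx Vy xy; apply: Ff; [exact: VU|exact: VU|].
elim: xy => [a b [c Fc [P [cP PV Pa Pb PE]]]|a|a b d _ ab _ bd].
- apply: Relation_Operators.rt_step; exists c => //; exists P; split=> //.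
  by move=> z /PV[Vz cz]; split=> //; exact: VU.
- exact: Relation_Operators.rt_refl.
- exact: Relation_Operators.rt_trans ab bd.
Qed.

Lemma leaf_tangent_chart c x v : fcharts F c -> cdom c x ->
  (forall a : 'I_p, tcomp c x v (lshift q a) = 0) -> leaf_tangent F x v.
Proof.
move=> Fc cx va c' Fc' cx' a; have Ac := fcharts_atlas Fc; have Ac' := fcharts_atlas Fc'.
rewrite /tcomp (tderivE _ Ac cx (snear_coordf _ Ac' cx')) big_split_ord /=.
rewrite !big1 ?addr0 // => [u _|b _]; last by rewrite va mul0r.
by rewrite (fcharts_adapted Fc Fc') // mulr0.
Qed.

(** The bridge between leaves and brackets: constancy along leaves becomes a condition
    on derivatives, and tangent vectors to leaves are anchors of sections of B. *)
Lemma foliated_onP V f : open V -> (forall x, V x -> snear x f) ->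
  foliated_on F V f <-> (forall x v, V x -> leaf_tangent F x v -> tderiv x v f = 0).
Proof.
move=> oV Sf; split=> [Ff x v Vx lv|H].
  have [c Fc cx] := fcharts_cover F x; have Ac := fcharts_atlas Fc.
  rewrite (tderivE _ Ac cx (Sf x Vx)) big_split_ord /= !big1 ?addr0 // => [u _|a _].
    by rewrite (pderiv_foliated_on u oV Ff Vx Fc cx) mulr0.
  by rewrite lv // mul0r.
apply: foliated_on_pderiv0 => // x c Vx Fc cx u; have Ac := fcharts_atlas Fc.
pose w : 'rV[R]_(p + q) := delta_mx ord0 (rshift p u).
have <- : tderiv x (tvec c x w) f = pderiv c (rshift p u) f x.
  rewrite (tderivE _ Ac cx (Sf x Vx)) (bigD1 (rshift p u)) //= big1 ?addr0.
    by rewrite tcomp_tvec // mxE !eqxx mul1r.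
  by move=> i iu; rewrite tcomp_tvec // mxE (negbTE iu) andbF mul0r.
apply: H => //; apply: (leaf_tangent_chart Fc cx) => a.
by rewrite tcomp_tvec // mxE eq_lrshift andbF.
Qed.

End FoliatedLeafwise.

(** * Grassmann polynomials of degree at most three *)

Section GrassmannAlgebra.
Import mathcomp.boot.fintype mathcomp.boot.finset.
Local Close Scope classical_set_scope.
Variables (R : realType) (m : nat).
Implicit Types (G H X : grassmann R m) (I J K : {set 'I_m}).

Lemma gsignUl I I' J : [disjoint I & I'] -> gsign R (I :|: I')%SET J = gsign R I J * gsign R I' J.
Proof.
move=> dI; rewrite /gsign -exprD -bigU //=; congr (_ ^+ _).
by apply: eq_bigl => i; rewrite !inE.
Qed.

Lemma gsignUr I J J' : [disjoint J & J'] -> gsign R I (J :|: J')%SET = gsign R I J * gsign R I J'.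
Proof.
move=> dJ; rewrite /gsign -exprD -big_split /=; congr (_ ^+ _).
apply: eq_bigr => i _; rewrite -cardUI [X in (_ + X)%N]eq_card0 ?addn0.
  by apply: eq_card => j; rewrite !inE /= andb_orl.
move=> j; rewrite !inE /=; apply/negbTE/negP => /andP[/andP[jJ _] /andP[jJ' _]].
by have := disjointFr dJ jJ; rewrite jJ'.
Qed.

Lemma gsign_sqr I J : gsign R I J * gsign R I J = 1.
Proof. by rewrite /gsign -expr2 sqrr_sign. Qed.

Lemma gsign1 (i j : 'I_m) : gsign R [set i]%SET [set j]%SET = (-1) ^+ (j < i)%N.
Proof.
rewrite /gsign big_set1; case: ltnP => ji.
  by rewrite (eq_card (B := pred1 j)) ?card1 // => l; rewrite !inE; case: eqP => // ->.
rewrite (eq_card0 (A := _)) // => l; rewrite !inE; case: eqP => // ->.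
by rewrite ltnNge ji.
Qed.

Lemma gsign1_swap (i j : 'I_m) : i != j ->
  gsign R [set i]%SET [set j]%SET * gsign R [set j]%SET [set i]%SET = -1.
Proof.
move=> ij; rewrite !gsign1; case: ltngtP => [_|_|/val_inj E]; rewrite ?mul1r ?mulr1 //.
by rewrite E eqxx in ij.
Qed.

Lemma gmulE G H K : gmul G H K =
  \sum_(I : {set 'I_m} | I \subset K) gsign R I (K :\: I)%SET * G I * H (K :\: I)%SET.
Proof. by rewrite ffunE. Qed.

Lemma gmulDl G G' H : gmul (G + G') H = gmul G H + gmul G' H.
Proof.
apply/ffunP => K; rewrite [RHS]ffunE !gmulE -big_split; apply: eq_bigr => I _ /=.
by rewrite ffunE mulrDr mulrDl.
Qed.

Lemma gmulDr G H H' : gmul G (H + H') = gmul G H + gmul G H'.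
Proof.
apply/ffunP => K; rewrite [RHS]ffunE !gmulE -big_split; apply: eq_bigr => I _ /=.
by rewrite ffunE mulrDr.
Qed.

Lemma gmulZl (a : R) G H : gmul (a *: G) H = a *: gmul G H.
Proof.
apply/ffunP => K; rewrite [RHS]ffunE !gmulE scaler_sumr; apply: eq_bigr => I _ /=.
by rewrite ffunE -![_ *: _]/(_ * _); ring.
Qed.

Lemma gmulZr (a : R) G H : gmul G (a *: H) = a *: gmul G H.
Proof.
apply/ffunP => K; rewrite [RHS]ffunE !gmulE scaler_sumr; apply: eq_bigr => I _ /=.
by rewrite ffunE -![_ *: _]/(_ * _); ring.
Qed.

Lemma gmul0l H : gmul 0 H = 0.
Proof. by rewrite -[0 in LHS](scale0r (0 : grassmann R m)) gmulZl scale0r. Qed.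

Lemma gmul0r H : gmul H 0 = 0.
Proof. by rewrite -[0 in LHS](scale0r (0 : grassmann R m)) gmulZr scale0r. Qed.

Lemma gmul_suml (T : Type) (r : seq T) (P : pred T) (F : T -> grassmann R m) H :
  gmul (\sum_(i <- r | P i) F i) H = \sum_(i <- r | P i) gmul (F i) H.
Proof. by elim/big_rec2: _ => [|i y1 y2 _ <-]; rewrite ?gmul0l ?gmulDl. Qed.

Lemma gmul_sumr (T : Type) (r : seq T) (P : pred T) (F : T -> grassmann R m) H :
  gmul H (\sum_(i <- r | P i) F i) = \sum_(i <- r | P i) gmul H (F i).
Proof. by elim/big_rec2: _ => [|i y1 y2 _ <-]; rewrite ?gmul0r ?gmulDr. Qed.

(** Both sides are sums over the splittings of S into three disjoint parts; the signs
    agree because [gsign] is multiplicative in each argument. *)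
Lemma gmulA G H X : gmul (gmul G H) X = gmul G (gmul H X).
Proof.
apply/ffunP => S; rewrite !gmulE.
under eq_bigr => U US do rewrite gmulE mulr_sumr mulr_suml.
under [RHS]eq_bigr => I IS do rewrite gmulE mulr_sumr.
rewrite (exchange_big_dep (fun I : {set 'I_m} => I \subset S)) /=; last first.
  by move=> U I US IU; exact: subset_trans IU US.
apply: eq_bigr => I IS.
rewrite (reindex_onto (fun J => I :|: J)%SET (fun U => U :\: I)%SET) /=; last first.
  move=> U /andP[_ IU]; apply/setP => i; rewrite !inE; have := subsetP IU i.
  by case: (i \in I) => // /(_ isT) ->.
have dj J : (J \subset S :\: I) -> [disjoint I & J].
  by rewrite subsetD => /andP[_]; rewrite disjoint_sym.
apply: eq_big => [J|J JP].
  rewrite subUset IS subsetUl !andbT subsetD; case: (J \subset S) => //=.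
  rewrite setDUl setDv set0U; apply/eqP/idP => [<-|dJ].
    by rewrite disjoint_sym disjoints_subset; apply/subsetP => i; rewrite !inE => ->.
  by apply/setDidPl.
have JSI : J \subset (S :\: I)%SET.
  move: JP; rewrite subUset IS subsetUl /= andbT => /andP[JS /eqP <-].
  by apply: setSD; rewrite subUset IS.
have -> : ((I :|: J) :\: I = J)%SET.
  by move: JP => /andP[_ /eqP].
have -> : (S :\: (I :|: J) = (S :\: I) :\: J)%SET.
  by apply/setP => i; rewrite !inE negb_or andbCA andbA.
have dJ : [disjoint J & (S :\: I) :\: J]%SET.
  by rewrite disjoint_sym disjoints_subset; apply/subsetP => i; rewrite !inE => /andP[].
have SE : (S :\: I = J :|: ((S :\: I) :\: J))%SET.
  apply/setP => i; rewrite !inE; have := subsetP JSI i; rewrite !inE.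
  by case: (i \in J) => //= ->.
rewrite [in gsign R I (S :\: I)%SET]SE (gsignUr _ dJ) (gsignUl _ (dj _ JSI)).
by ring.
Qed.

Lemma gmul_etaE i H K : gmul (geta R i) H K =
  if i \in K then gsign R [set i]%SET (K :\ i)%SET * H (K :\ i)%SET else 0.
Proof.
rewrite gmulE; case: ifP => iK.
  rewrite (bigD1 [set i]%SET) ?sub1set //= [geta _ _ _]ffunE eqxx mulr1 big1 ?addr0 // => I /andP[_ nI].
  by rewrite [geta _ _ _]ffunE (negbTE nI) mulr0 mul0r.
rewrite big1 // => I IK; rewrite [geta _ _ _]ffunE; case: eqP => [E|]; last by rewrite mulr0 mul0r.
by rewrite E sub1set iK in IK.
Qed.

Lemma gmul_gconst G (a : R) : gmul G (gconst m a) = a *: G.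
Proof.
apply/ffunP => K; rewrite gmulE [RHS]ffunE (bigD1 K) //= setDv [gconst _ _ _]ffunE eqxx big1 ?addr0.
  rewrite /gsign big1 ?expr0 ?mul1r 1?mulrC // => i _; apply: eq_card0 => j; by rewrite !inE.
move=> I /andP[IK nI]; rewrite [gconst _ _ _]ffunE ifF ?mulr0 //; apply/negbTE/negP => /eqP/eqP.
by rewrite setD_eq0 => KI; case/negP: nI; rewrite eqEsubset IK.
Qed.

Lemma gderivE i G K : gderiv i G K =
  if i \in K then 0 else gsign R [set i]%SET K * G (i |: K)%SET.
Proof. by rewrite ffunE. Qed.

Lemma gderivD i G H : gderiv i (G + H) = gderiv i G + gderiv i H.
Proof.
apply/ffunP => K; rewrite [RHS]ffunE !gderivE; case: ifP; rewrite ?addr0 // => _.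
by rewrite ffunE mulrDr.
Qed.

Lemma gderivZ i (a : R) G : gderiv i (a *: G) = a *: gderiv i G.
Proof.
apply/ffunP => K; rewrite [RHS]ffunE !gderivE; case: ifP; rewrite ?scaler0 // => _.
by rewrite ffunE -![_ *: _]/(_ * _) mulrCA.
Qed.

Lemma gderiv0 i : gderiv i (0 : grassmann R m) = 0.
Proof. by rewrite -[0 in LHS](scale0r (0 : grassmann R m)) gderivZ scale0r. Qed.

Lemma gderiv_sum i (T : Type) (r : seq T) (P : pred T) (F : T -> grassmann R m) :
  gderiv i (\sum_(j <- r | P j) F j) = \sum_(j <- r | P j) gderiv i (F j).
Proof. by elim/big_rec2: _ => [|j y1 y2 _ <-]; rewrite ?gderiv0 ?gderivD. Qed.

Lemma gderiv_eta i j : gderiv i (geta R j) = gconst m (i == j)%:R.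
Proof.
apply/ffunP => K; rewrite gderivE !ffunE; case: ifP => iK.
  by case: eqP => // K0; rewrite K0 inE in iK.
case: eqP => [E|nE].
  have /eqP ij : i == j.
    have : i \in (i |: K)%SET by rewrite setU11.
    by rewrite (eqP (introT eqP E)) inE.
  have K0 : K == set0.
    apply/eqP/setP => l; rewrite inE; apply/negbTE/negP => lK.
    have : l \in (i |: K)%SET by rewrite inE lK orbT.
    by rewrite E inE => /eqP lj; rewrite ij -lj lK in iK.
  rewrite K0 ij eqxx mulr1 /gsign big1 ?expr0 // => l _; apply: eq_card0 => l'.
  by rewrite (eqP K0) !inE.
rewrite mulr0; case: eqP => // K0; case: eqP => // ij; case: nE.
by rewrite K0 ij setU0.
Qed.

Lemma gderiv_gconst i (a : R) : gderiv i (gconst m a) = 0.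
Proof.
apply/ffunP => K; rewrite gderivE !ffunE; case: ifP => // _.
rewrite ifF ?mulr0 //; apply/negbTE/eqP => /setP/(_ i); by rewrite !inE eqxx.
Qed.

(** The graded Leibniz rule, for a product by a generator. *)
Lemma gderiv_gmul_eta i j H :
  gderiv i (gmul (geta R j) H) = (i == j)%:R *: H - gmul (geta R j) (gderiv i H).
Proof.
apply/ffunP => K; rewrite gderivE [RHS]ffunE [X in X + _]ffunE [X in _ + X]ffunE !gmul_etaE gderivE.
have [<-|ij] := eqVneq i j.
  rewrite scale1r !inE eqxx /=; case: ifP => iK; last first.
    by rewrite subr0 setU1K ?iK // mulrA gsign_sqr mul1r.
  by rewrite setD1K // mulrA gsign_sqr mul1r subrr.
rewrite scale0r add0r !inE [j == i]eq_sym (negbTE ij) /=.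
case: ifP => iK; first by rewrite mulr0 if_same oppr0.
case: ifP => jK; last by rewrite mulr0 oppr0.
have -> : ((i |: K) :\ j = i |: (K :\ j))%SET.
  apply/setP => l; rewrite !inE; case: eqP => //= ->.
  by rewrite eq_sym (negbTE ij).
have d1 : [disjoint [set j]%SET & K :\ j]%SET by rewrite disjoints1 !inE eqxx.
have d2 : [disjoint [set i]%SET & K :\ j]%SET by rewrite disjoints1 !inE iK andbF.
rewrite -[in gsign R [set i]%SET K](setD1K jK) (gsignUr _ d1) (gsignUr _ d2).
have := gsign1_swap ij; set a := gsign _ _ _; set b := gsign _ _ _ => ab.
set c := gsign _ _ _; set d := gsign _ _ _; set e := H _.
have -> : a * c * (b * d * e) = (a * b) * (c * d * e) by ring.
by rewrite ab; ring.
Qed.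

(** An identity of degree d is reduced to identities of degree d - 1 between
    derivatives; this replaces computations with the signs of monomials. *)
Lemma grassmann_eq0 X : X set0 = 0 -> (forall i, gderiv i X = 0) -> X = 0.
Proof.
move=> X0 dX; apply/ffunP => K; rewrite ffunE.
have [->//|/set0Pn[i iK]] := eqVneq K set0.
have := congr1 (fun G : grassmann R m => G (K :\ i)%SET) (dX i).
rewrite gderivE !inE eqxx /= ffunE setD1K // => E.
by rewrite -[LHS]mul1r -(gsign_sqr [set i]%SET (K :\ i)%SET) -mulrA E mulr0.
Qed.

Lemma grassmann_eq G H : G set0 = H set0 ->
  (forall i, gderiv i G = gderiv i H) -> G = H.
Proof.
move=> E0 Ed; apply/eqP; rewrite -subr_eq0; apply/eqP; apply: grassmann_eq0.
  by rewrite !ffunE E0 subrr.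
by move=> i; rewrite -scaleN1r gderivD gderivZ Ed scaleN1r subrr.
Qed.

Definition glin (a : 'I_m -> R) : grassmann R m := \sum_b a b *: geta R b.
(** The coefficients are not supposed antisymmetric, so they are not determined by the
    element: see [gbil_eq]. *)
Definition gbil (S : 'I_m -> 'I_m -> R) : grassmann R m :=
  \sum_b \sum_g S b g *: gmul (geta R b) (geta R g).
Definition gcub (T : 'I_m -> 'I_m -> 'I_m -> R) : grassmann R m :=
  \sum_b \sum_g \sum_d T b g d *: gmul (geta R b) (gmul (geta R g) (geta R d)).

Lemma geta_set0 (i : 'I_m) : geta R i set0 = 0.
Proof.
by rewrite ffunE; case: eqP => // /setP/(_ i); rewrite !inE eqxx.
Qed.

Lemma gmul_eta_set0 i H : gmul (geta R i) H set0 = 0.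
Proof. by rewrite gmul_etaE inE. Qed.

Lemma glin_set0 a : glin a set0 = 0.
Proof.
rewrite sum_ffunE big1 // => i _. by rewrite ffunE geta_set0 scaler0.
Qed.

Lemma gbil_set0 S : gbil S set0 = 0.
Proof.
rewrite sum_ffunE big1 // => i _; rewrite sum_ffunE big1 // => j _.
by rewrite ffunE gmul_eta_set0 scaler0.
Qed.

Lemma gcub_set0 T : gcub T set0 = 0.
Proof.
rewrite sum_ffunE big1 // => i _; rewrite sum_ffunE big1 // => j _.
rewrite sum_ffunE big1 // => l _; by rewrite ffunE gmul_eta_set0 scaler0.
Qed.

Lemma glinE a i : glin a [set i]%SET = a i.
Proof.
rewrite sum_ffunE (bigD1 i) //= !ffunE eqxx big1 => [|j ji].
  by rewrite addr0 -[_ *: _]/(_ * _) mulr1.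
rewrite !ffunE; case: eqP => [/set1_inj E|]; last by rewrite scaler0.
by rewrite E eqxx in ji.
Qed.

Lemma eq_glin a a' : a =1 a' -> glin a = glin a'.
Proof. by move=> E; apply: eq_bigr => i _; rewrite E. Qed.

Lemma eq_gbil S S' : S =2 S' -> gbil S = gbil S'.
Proof. by move=> E; apply: eq_bigr => i _; apply: eq_bigr => j _; rewrite E. Qed.

Lemma glin_inj a a' : glin a = glin a' -> a =1 a'.
Proof. by move=> E i; rewrite -glinE E glinE. Qed.

Lemma glin0 : glin (fun=> 0) = 0.
Proof. by apply: big1 => i _; rewrite scale0r. Qed.

Lemma gderiv_glin i a : gderiv i (glin a) = gconst m (a i).
Proof.
rewrite gderiv_sum (bigD1 i) //= gderivZ gderiv_eta eqxx big1 ?addr0.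
  by apply/ffunP => K; rewrite !ffunE; case: ifP; rewrite ?scaler0 // -[_ *: _]/(_ * _) mulr1.
move=> j ji; rewrite gderivZ gderiv_eta eq_sym (negbTE ji).
by apply/ffunP => K; rewrite !ffunE if_same scaler0.
Qed.

Lemma gmul_glin a a' : gmul (glin a) (glin a') = gbil (fun b g => a b * a' g).
Proof.
rewrite gmul_suml; apply: eq_bigr => b _; rewrite gmul_sumr; apply: eq_bigr => g _.
by rewrite gmulZl gmulZr scalerA.
Qed.

Lemma gconst_mul (a c : R) : a *: gconst m c = gconst m (a * c).
Proof. by apply/ffunP => K; rewrite !ffunE; case: ifP; rewrite ?scaler0. Qed.

Lemma gderiv_gmul2 (i b g : 'I_m) : gderiv i (gmul (geta R b) (geta R g)) =
  (i == b)%:R *: geta R g - (i == g)%:R *: geta R b.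
Proof. by rewrite gderiv_gmul_eta gderiv_eta gmul_gconst. Qed.

Lemma sum_delta_l (V : lmodType R) (i : 'I_m) (F : 'I_m -> V) :
  \sum_b (i == b)%:R *: F b = F i.
Proof.
rewrite (bigD1 i) //= eqxx scale1r big1 ?addr0 // => j ji.
by rewrite eq_sym (negbTE ji) scale0r.
Qed.

Lemma gderiv_gbil i S : gderiv i (gbil S) = glin (fun g => S i g - S g i).
Proof.
rewrite gderiv_sum.
under eq_bigr => b _ do (rewrite gderiv_sum; under eq_bigr => g _ do
  (rewrite gderivZ gderiv_gmul2 scalerBr !scalerA ![S b g * _]mulrC -!scalerA)).
under eq_bigr => b _ do rewrite big_split /= -scaler_sumr sumrN sum_delta_l.
rewrite big_split /= sum_delta_l sumrN -sumrB; apply: eq_bigr => g _.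
by rewrite scalerBl.
Qed.

Lemma gbil_eq S S' :
  gbil S = gbil S' <-> forall b g, S b g - S g b = S' b g - S' g b.
Proof.
split=> [E b g|E].
  have := congr1 (gderiv b) E; rewrite !gderiv_gbil => /glin_inj; exact.
apply: grassmann_eq; first by rewrite !gbil_set0.
by move=> i; rewrite !gderiv_gbil; apply: eq_glin => g.
Qed.

Lemma gbil0 : gbil (fun _ _ => 0) = 0.
Proof. by apply: big1 => i _; apply: big1 => j _; rewrite scale0r. Qed.

Lemma gbilD S S' : gbil S + gbil S' = gbil (fun b g => S b g + S' b g).
Proof.
rewrite -big_split; apply: eq_bigr => b _; rewrite -big_split; apply: eq_bigr => g _ /=.
by rewrite scalerDl.
Qed.

Lemma gbil_sum (I : Type) (r : seq I) (F : I -> 'I_m -> 'I_m -> R) :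
  \sum_(i <- r) gbil (F i) = gbil (fun b g => \sum_(i <- r) F i b g).
Proof.
elim: r => [|i r IH].
  by rewrite big_nil -gbil0; apply: eq_gbil => b g; rewrite big_nil.
by rewrite big_cons IH gbilD; apply: eq_gbil => b g; rewrite big_cons.
Qed.

Lemma glinD S S' : glin S + glin S' = glin (fun b => S b + S' b).
Proof.
by rewrite -big_split; apply: eq_bigr => b _; rewrite scalerDl.
Qed.

Lemma glinZ (a : R) S : a *: glin S = glin (fun b => a * S b).
Proof. by rewrite scaler_sumr; apply: eq_bigr => b _; rewrite scalerA. Qed.

Lemma gbilZ (a : R) S : a *: gbil S = gbil (fun b g => a * S b g).
Proof.
rewrite scaler_sumr; apply: eq_bigr => b _; rewrite scaler_sumr; apply: eq_bigr => g _.
by rewrite scalerA.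
Qed.

Lemma glin_sum (I : Type) (r : seq I) (F : I -> 'I_m -> R) :
  \sum_(i <- r) glin (F i) = glin (fun b => \sum_(i <- r) F i b).
Proof.
elim: r => [|i r IH].
  by rewrite big_nil -glin0; apply: eq_glin => b; rewrite big_nil.
by rewrite big_cons IH glinD; apply: eq_glin => b; rewrite big_cons.
Qed.

Lemma gcubD S S' : gcub S + gcub S' = gcub (fun b g d => S b g d + S' b g d).
Proof.
rewrite -big_split; apply: eq_bigr => b _; rewrite -big_split; apply: eq_bigr => g _ /=.
by rewrite -big_split; apply: eq_bigr => d _ /=; rewrite scalerDl.
Qed.

Lemma gcub_sum (I : Type) (r : seq I) (F : I -> 'I_m -> 'I_m -> 'I_m -> R) :
  \sum_(i <- r) gcub (F i) = gcub (fun b g d => \sum_(i <- r) F i b g d).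
Proof.
elim: r => [|i r IH].
  rewrite big_nil; symmetry; apply: big1 => b _; apply: big1 => g _; apply: big1 => d _.
  by rewrite big_nil scale0r.
rewrite big_cons IH gcubD; apply: eq_bigr => b _; apply: eq_bigr => g _; apply: eq_bigr => d _.
by rewrite big_cons.
Qed.

Lemma gmul_glin_gbil a S : gmul (glin a) (gbil S) = gcub (fun b g d => a b * S g d).
Proof.
rewrite gmul_suml; apply: eq_bigr => b _; rewrite gmul_sumr; apply: eq_bigr => g _.
rewrite gmul_sumr; apply: eq_bigr => d _.
by rewrite gmulZl gmulZr scalerA.
Qed.

Lemma gmul_gbil_glin S a : gmul (gbil S) (glin a) = gcub (fun b g d => S b g * a d).
Proof.
rewrite gmul_suml; apply: eq_bigr => b _; rewrite gmul_suml; apply: eq_bigr => g _.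
rewrite gmul_sumr; apply: eq_bigr => d _.
by rewrite gmulZl gmulZr scalerA gmulA.
Qed.

Lemma gderiv_gcub i T : gderiv i (gcub T) =
  gbil (fun g d => T i g d - T g i d + T g d i).
Proof.
have E b g d : gderiv i (T b g d *: gmul (geta R b) (gmul (geta R g) (geta R d))) =
  (i == b)%:R *: (T b g d *: gmul (geta R g) (geta R d))
  - (i == g)%:R *: (T b g d *: gmul (geta R b) (geta R d))
  + (i == d)%:R *: (T b g d *: gmul (geta R b) (geta R g)).
  rewrite gderivZ gderiv_gmul_eta gderiv_gmul2 gmulDr -scaleN1r scaleN1r -scaleNr !gmulZr.
  rewrite scaleNr opprD opprK addrA scalerDr scalerBr !scalerA.
  by rewrite ![T b g d * _]mulrC.
rewrite gderiv_sum; under eq_bigr => b _ do (rewrite gderiv_sum; under eq_bigr => g _ do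
  (rewrite gderiv_sum; under eq_bigr => d _ do rewrite E)).
under eq_bigr => b _ do under eq_bigr => g _ do
  rewrite !big_split /= sumrN -!scaler_sumr sum_delta_l.
under eq_bigr => b _ do rewrite !big_split /= sumrN -!scaler_sumr sum_delta_l.
rewrite !big_split /= sumrN sum_delta_l -sumrB -big_split /=; apply: eq_bigr => g _.
rewrite -sumrB -big_split; apply: eq_bigr => d _ /=.
by rewrite scalerDl scalerBl.
Qed.

Lemma gcub_eq0 T : gcub T = 0 <-> forall b g d,
  T b g d - T g b d + T g d b - (T b d g - T d b g + T d g b) = 0.
Proof.
split=> [E b g d|E].
  have := congr1 (gderiv b) E; rewrite gderiv_gcub gderiv0 -gbil0 => /gbil_eq/(_ g d) ->.
  by rewrite subrr.
apply: grassmann_eq0; first exact: gcub_set0.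
move=> i; rewrite gderiv_gcub -gbil0; apply/gbil_eq => g d.
by rewrite E subrr.
Qed.

Lemma gsubst_sum (T : Type) (r : seq T) (F : T -> grassmann R m) b :
  gsubst b (\sum_(i <- r) F i) = \sum_(i <- r) gsubst b (F i).
Proof.
rewrite /gsubst exchange_big /=; apply: eq_bigr => I _.
by rewrite -scaler_suml sum_ffunE.
Qed.

Lemma gsubstZ (a : R) G b : gsubst b (a *: G) = a *: gsubst b G.
Proof.
rewrite /gsubst scaler_sumr; apply: eq_bigr => I _.
by rewrite ffunE scalerA.
Qed.

Lemma gsubst_basis b I : gsubst b [ffun J => (J == I)%:R : R^o] =
   \big[@gmul R m/gconst m 1]_(i <- enum I) glin (b i).
Proof.
rewrite /gsubst (bigD1 I) //= ffunE eqxx scale1r big1 ?addr0 => [|J JI].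
  by rewrite -[in LHS]big_filter [index_enum _]unlock.
by rewrite ffunE (negbTE JI) scale0r.
Qed.

Lemma gsubst_eta b i : gsubst b (geta R i) = glin (b i).
Proof.
have -> : geta R i = [ffun J => (J == [set i]%SET)%:R : R^o] by [].
rewrite gsubst_basis enum_set1 big_cons big_nil gmul_gconst scale1r //.
Qed.

Lemma enum_set2 (i j : 'I_m) : (i < j)%N -> enum [set i; j]%SET = [:: i; j].
Proof.
move=> ij; apply: (irr_sorted_eq (leT := relpre val ltn)).
- by move=> a b d /=; exact: ltn_trans.
- by move=> a /=; exact: ltnn.
- rewrite /enum_mem -enumT; apply: sorted_filter; first by move=> a b d /=; exact: ltn_trans.
  by rewrite -sorted_map val_enum_ord iota_ltn_sorted.
- by rewrite /= ij.
- by move=> l; rewrite mem_enum !inE.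
Qed.

Lemma gmul_eta_anticomm (i j : 'I_m) : gmul (geta R i) (geta R j) = - gmul (geta R j) (geta R i).
Proof.
apply: grassmann_eq; first by rewrite [RHS]ffunE !gmul_eta_set0 oppr0.
by move=> l; rewrite -scaleN1r gderivZ !gderiv_gmul2 scaleN1r opprB.
Qed.

(** A substitution is defined on increasing products of generators; the other products
    reduce to these by anticommutation, which their images also satisfy. *)
Lemma gsubst_eta2 b i j :
  gsubst b (gmul (geta R i) (geta R j)) = gmul (glin (b i)) (glin (b j)).
Proof.
have anti a a' : gmul (glin a) (glin a') = - gmul (glin a') (glin a).
  rewrite !gmul_glin -scaleN1r gbilZ; apply/gbil_eq => l l'; ring.
have eq2 G : G = - G -> G = 0.
  move=> E; have : (2 : R) *: G = 0 by rewrite scaler_nat mulr2n {1}E addNr.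
  move/eqP; rewrite scaler_eq0 pnatr_eq0 /= => /eqP //.
have lt2 (l l' : 'I_m) : (l < l')%N ->
    gsubst b (gmul (geta R l) (geta R l')) = gmul (glin (b l)) (glin (b l')).
  move=> ll'; have nl : l != l' by apply/eqP => E; rewrite E ltnn in ll'.
  have -> : gmul (geta R l) (geta R l') = [ffun J => (J == [set l; l']%SET)%:R : R^o].
    apply/ffunP => K; rewrite gmul_etaE !ffunE; case: ifP => lK; last first.
      by case: eqP => // E; rewrite E !inE eqxx in lK.
    case: eqP => [E|nE]; last first.
      rewrite mulr0; case: eqP => // KE; case: nE; apply/setP => z; rewrite KE !inE.
      by case: eqP => //= ->; rewrite (negbTE nl).
    by rewrite E gsign1 ltnNge ltnW // expr0 mul1r -[in RHS](setD1K lK) E eqxx.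
  by rewrite gsubst_basis enum_set2 // !big_cons big_nil gmul_gconst scale1r.
have [ij|ij|/val_inj ->] := ltngtP i j.
- exact: lt2.
- by rewrite gmul_eta_anticomm -scaleN1r gsubstZ lt2 // scaleN1r -anti.
- rewrite [RHS]eq2 -?anti // [gmul (geta R j) _]eq2; last exact: gmul_eta_anticomm.
  by rewrite -(scale0r (0 : grassmann R m)) gsubstZ !scale0r.
Qed.

Lemma gsubst_glin b a : gsubst b (glin a) = glin (fun j => \sum_i a i * b i j).
Proof.
rewrite gsubst_sum; under eq_bigr do rewrite gsubstZ gsubst_eta glinZ.
by rewrite glin_sum.
Qed.

Lemma gsubst_gbil b S : gsubst b (gbil S) =
  gbil (fun j l => \sum_i \sum_i' S i i' * (b i j * b i' l)).
Proof.
rewrite gsubst_sum; under eq_bigr => i _ do (rewrite gsubst_sum; under eq_bigr => i' _ do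
  rewrite gsubstZ gsubst_eta2 gmul_glin gbilZ).
by under eq_bigr do rewrite gbil_sum; rewrite gbil_sum.
Qed.

End GrassmannAlgebra.

Section Restriction.
Import mathcomp.boot.fintype mathcomp.boot.finset.
Local Close Scope classical_set_scope.
Variables (R : realType) (k s : nat).
Implicit Types (G : grassmann R (k + s)).

(** The inclusion [lshift] of indices is increasing, hence preserves signs. *)
Lemma restr_gderiv (h : 'I_k) G : gderiv h (restr G) = restr (gderiv (lshift s h) G).
Proof.
apply/ffunP => J; rewrite gderivE !ffunE (mem_imset _ _ (@lshift_inj k s)).
case: ifP => // hJ; rewrite imsetU1; congr (_ * _).
rewrite /gsign !big_set1; congr (_ ^+ _).
rewrite -(card_imset _ (@lshift_inj k s)); apply: eq_card => j.
rewrite !inE; apply/imsetP/andP => [[l /[!inE] /andP[lJ lh] ->]|[/imsetP[l lJ ->] lh]].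
  by split=> //; apply/imsetP; exists l.
by exists l => //; rewrite inE lJ.
Qed.

Lemma restr_set0 G : restr G set0 = G set0.
Proof. by rewrite ffunE imset0. Qed.

Lemma restr_gconst (a : R) : restr (gconst (k + s) a) = gconst k a.
Proof.
apply/ffunP => J; rewrite !ffunE; congr (if _ then _ else _).
by rewrite imset_eq0.
Qed.

Lemma restr_glin (a : 'I_(k + s) -> R) : restr (glin a) = glin (fun h => a (lshift s h)).
Proof.
apply: grassmann_eq; first by rewrite restr_set0 !glin_set0.
by move=> h; rewrite restr_gderiv !gderiv_glin restr_gconst.
Qed.

Lemma restr_gbil (S : 'I_(k + s) -> 'I_(k + s) -> R) :
  restr (gbil S) = gbil (fun h h' => S (lshift s h) (lshift s h')).
Proof.
apply: grassmann_eq; first by rewrite restr_set0 !gbil_set0.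
by move=> h; rewrite restr_gderiv !gderiv_gbil restr_glin.
Qed.

End Restriction.

(** * Sections, local frames and dual frames *)

Section LinearAlgebra.
Variables (R : realType) (V : vectType R).

(** It is enough to use the coordinates of the component of a vector along a complement
    of B. *)
Lemma hom_separates (B : {vspace V}) v :
  (forall xi : 'Hom(V, R^o), (forall b, b \in B -> xi b = 0) -> xi v = 0) -> v \in B.
Proof.
move=> H; pose w u := u - projv B u.
suff w0 : w v = 0.
  by move/eqP: w0; rewrite /w subr_eq0 => /eqP ->; exact: memv_proj.
rewrite (coord_vbasis (memvf (w v))) big1 // => i _.
pose xi : 'Hom(V, R^o) := linfun (coord (vbasis fullv) i : V -> R^o).
have := H (xi - (xi \o projv B))%VF.
have xiE u : (xi - (xi \o projv B))%VF u = xi (w u).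
  by rewrite /w add_lfunE opp_lfunE comp_lfunE [RHS]linearB.
rewrite xiE /xi lfunE /= => -> //; first by rewrite scale0r.
by move=> b Bb; rewrite xiE /w projv_id // subrr linear0.
Qed.

(** The chosen members of Y are recorded by their positions and not by their values,
    because Y will list values at a point of sections that have to be recovered. *)
Lemma free_extend (X Y : seq V) : free X -> exists I : seq nat,
  [/\ all (fun i => (i < size Y)%N) I, free (X ++ [seq Y`_i | i <- I]) &
      (<<Y>> <= <<X ++ [seq Y`_i | i <- I]>>)%VS].
Proof.
elim/last_ind: Y => [|Y y IH] fX.
  by exists [::]; split=> //=; rewrite ?cats0 // span_nil sub0v.
have [I [aI fI sI]] := IH fX.
have EI J : all (fun i => (i < size Y)%N) J -> [seq (rcons Y y)`_i | i <- J] = [seq Y`_i | i <- J].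
  by move=> /allP H; apply/eq_in_map => i /H iY; rewrite nth_rcons iY.
have aI' : all (fun i => (i < size (rcons Y y))%N) I.
  by apply: sub_all aI => i; rewrite size_rcons => /ltnW.
have [yI|nyI] := boolP (y \in <<X ++ [seq Y`_i | i <- I]>>%VS).
  exists I; split=> //; rewrite EI // -cats1 span_cat subv_add sI span_seq1.
  by rewrite -memvE.
exists (rcons I (size Y)); split.
- by rewrite all_rcons aI' size_rcons leqnn.
- rewrite map_rcons EI // nth_rcons ltnn eqxx -cats1 catA.
  rewrite (@perm_free _ _ _ (y :: (X ++ [seq Y`_i | i <- I]))).
    by rewrite free_cons nyI.
  by rewrite perm_catC.
- rewrite map_rcons EI // nth_rcons ltnn eqxx -!cats1 catA !span_cat.
  by apply: addvS => //; rewrite -span_cat.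
Qed.

End LinearAlgebra.

Section Frames.
Variables (R : realType) (n : nat) (M : manifold R n) (r : nat) (A : vbundle M r).
Implicit Types (x y : M) (s : forall y, A y) (e : lframe A r).

Lemma ftup_nth (E : M -> vectType R) k (e : lframe E k) (i : 'I_k) x : (ftup e x)`_i = fsec e i x.
Proof. by rewrite (nth_map i) ?size_enum_ord // nth_ord_enum. Qed.

Lemma frame_expand (E : M -> vectType R) k (e : lframe E k) x (S : {vspace E x}) v :
  basis_of S (ftup e x) -> v \in S -> v = \sum_i fcoord e i v *: fsec e i x.
Proof.
move=> be vS; rewrite {1}(coord_basis be vS).
by apply: eq_bigr => i _; rewrite ftup_nth.
Qed.

Lemma fcoord_sum (E : M -> vectType R) k (e : lframe E k) x (S : {vspace E x}) (f : 'I_k -> R) j :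
  basis_of S (ftup e x) -> fcoord e j (\sum_i f i *: fsec e i x) = f j.
Proof.
move=> be; rewrite -[RHS](coord_sum_free f j (basis_free be)); congr (coord _ _ _).
by apply: eq_bigr => i _; rewrite ftup_nth.
Qed.

Lemma fcoord_fsec (E : M -> vectType R) k (e : lframe E k) x (S : {vspace E x}) i j :
  basis_of S (ftup e x) -> fcoord e i (fsec e j x) = (i == j)%:R.
Proof.
move=> be; rewrite -ftup_nth /fcoord coord_free ?(basis_free be) // eq_sym //.
Qed.

Lemma fsec_in (E : M -> vectType R) k (e : lframe E k) x (S : {vspace E x}) i :
  basis_of S (ftup e x) -> fsec e i x \in S.
Proof.
move=> be; rewrite -ftup_nth; apply: (basis_mem be); apply: mem_nth; by rewrite size_tuple.
Qed.

Lemma snear_det k (P : M -> 'M[R]_k) x :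
  (forall i j, snear x (fun y => P y i j)) -> snear x (fun y => \det (P y)).
Proof.
move=> SP; rewrite /determinant; apply: snear_sum => s _.
by apply: snearM; [exact: snear_cst|apply: snear_prod => i].
Qed.

Lemma snear_invmx k (P : M -> 'M[R]_k) x i j : \det (P x) != 0 ->
  (forall i j, snear x (fun y => P y i j)) -> snear x (fun y => invmx (P y) i j).
Proof.
move=> d0 SP; have Sd := snear_det SP.
have nd : \forall y \near x, \det (P y) != 0.
  exact: snear_neq0 d0 Sd.
apply: (@snear_ext _ _ _ _ (fun y => (\det (P y))^-1 * (\adj (P y)) i j)).
  by apply: filterS nd => y d; rewrite /invmx unitmxE unitfE d [RHS]mxE.
apply: snearM; first exact: snear_inv.
apply: (@snear_ext _ _ _ _ (fun y => cofactor (P y) j i)).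
  by apply: nearW => y; rewrite mxE.
rewrite /cofactor; apply: snearM; first exact: snear_cst.
by apply: snear_det => i' j'; apply: snear_ext (SP _ _); apply: nearW => y; rewrite !mxE.
Qed.

Lemma det_neq0_near k (P : M -> 'M[R]_k) x : \det (P x) != 0 ->
  (forall i j, snear x (fun y => P y i j)) -> \forall y \near x, \det (P y) != 0.
Proof.
move=> d0 /snear_det Sd.
exact: snear_neq0 d0 Sd.
Qed.

Definition coord_mx (e : lframe A r) x (w : 'I_r -> A x) : 'M[R]_r :=
  \matrix_(i, j) fcoord e i (w j).

Lemma cmx_basis e x (w : 'I_r -> A x) : basis_of fullv (ftup e x) ->
  basis_of fullv [tuple w j | j < r] <-> \det (coord_mx e w) != 0.
Proof.
move=> be; have wn (j : 'I_r) : [tuple w j | j < r]`_j = w j.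
  by rewrite (nth_map j) ?size_enum_ord // nth_ord_enum.
split=> [bw|].
  pose Q : 'M[R]_r := \matrix_(i, j) coord [tuple w j | j < r] i (fsec e j x).
  have : coord_mx e w *m Q = 1%:M.
    apply/matrixP => i j; rewrite !mxE.
    have E := coord_basis bw (memvf (fsec e j x)).
    transitivity (fcoord e i (\sum_l coord [tuple w j | j < r] l (fsec e j x) *: w l)).
      rewrite /fcoord linear_sum; apply: eq_bigr => l _; rewrite !mxE linearZ mulrC //.
    transitivity (fcoord e i (fsec e j x)); last exact: fcoord_fsec be.
    by congr (fcoord _ _ _); rewrite [RHS]E; apply: eq_bigr => l _; rewrite wn.
  move=> /(congr1 determinant); rewrite det_mulmx det1 => E; apply/eqP => d.
  by move/eqP: E; rewrite d mul0r eq_sym oner_eq0.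
move=> d0; rewrite basisEfree subvf size_tuple /=; apply/andP; split; last first.
  by rewrite (size_basis be).
apply/(@freeP _ _ _ [tuple w j | j < r]) => f f0 i; pose F : 'cV[R]_r := \col_i f i.
have : coord_mx e w *m F = 0.
  apply/colP => l; rewrite !mxE -[RHS](linear0 (coord (ftup e x) l)) -[in RHS]f0 linear_sum.
  by apply: eq_bigr => j _; rewrite !mxE linearZ /= wn mulrC.
have u : coord_mx e w \in unitmx by rewrite unitmxE unitfE.
move=> /(congr1 (mulmx (invmx (coord_mx e w)))); rewrite mulKmx // mulmx0.
by move/colP/(_ i); rewrite !mxE.
Qed.

Definition secnear x s := forall t, trivs t -> fdom t x ->
  forall i, snear x (fun y => fcoord t i (s y)).

Lemma triv_near t x : trivs (v := A) t -> fdom t x -> \forall y \near x, fdom t y.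
Proof. by move=> Tt tx; apply: open_nbhs_nbhs; split=> //; exact: triv_open. Qed.

Lemma secnear_of_triv t x s : trivs t -> fdom t x ->
  (forall i, snear x (fun y => fcoord t i (s y))) -> secnear x s.
Proof.
move=> Tt tx St t' Tt' tx' i.
apply: (@snear_ext _ _ _ _ (fun y => \sum_j fcoord t j (s y) * fcoord t' i (fsec t j y))).
  apply: filterS (triv_near Tt tx) => y ty.
  rewrite [in RHS](frame_expand (triv_basis Tt ty) (memvf (s y))) [RHS]/fcoord linear_sum.
  by apply: eq_bigr => j _; rewrite linearZ.
apply: snear_sum => j _; apply: snearM => //.
apply: snear_on (openI (triv_open Tt) (triv_open Tt')) _ (triv_smooth Tt Tt' i j).
by split.
Qed.

Lemma secnear_on U s x : open U -> U x -> smooth_section_on U s -> secnear x s.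
Proof.
move=> oU Ux Ss t Tt tx i; apply: snear_on (openI oU (triv_open Tt)) _ (Ss t Tt i).
by split.
Qed.

Lemma section_secnear (s : section A) x : secnear x s.
Proof. by apply: secnear_on openT _ (section_smooth s). Qed.

Lemma smooth_section_of U s : (forall x, U x -> secnear x s) -> smooth_section_on U s.
Proof. by move=> H t Tt i; apply: smooth_on_local => x [Ux tx]; exact: H. Qed.

Lemma secnear_ext x s s' : (\forall y \near x, s y = s' y) -> secnear x s -> secnear x s'.
Proof.
move=> ss' Ss t Tt tx i; apply: snear_ext (Ss t Tt tx i).
by apply: filterS ss' => y ->.
Qed.

Lemma secnear_near x s : secnear x s -> \forall y \near x, secnear y s.
Proof.
move=> Ss; have [t Tt tx] := triv_cover A x.
have H : \forall y \near x, forall i, snear y (fun y => fcoord t i (s y)).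
  by apply: filter_forall => i; exact/snear_near/Ss.
by apply: filterS2 H (triv_near Tt tx) => y Hy ty; exact: secnear_of_triv ty Hy.
Qed.

Lemma secnear_sum (I : Type) (l : seq I) (P : pred I) (f : I -> M -> R)
    (w : I -> forall y, A y) x :
  (forall i, P i -> snear x (f i)) -> (forall i, P i -> secnear x (w i)) ->
  secnear x (fun y => \sum_(i <- l | P i) f i y *: w i y).
Proof.
move=> Sf Sw t Tt tx i.
apply: (@snear_ext _ _ _ _ (fun y => \sum_(j <- l | P j) f j y * fcoord t i (w j y))).
  apply: nearW => y; rewrite {2}/fcoord linear_sum; apply: eq_bigr => j _.
  by rewrite linearZ.
by apply: snear_sum => j Pj; apply: snearM; [exact: Sf|exact: Sw].
Qed.

Lemma secnearZ f s x : snear x f -> secnear x s -> secnear x (fun y => f y *: s y).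
Proof.
move=> Sf Ss t Tt tx i; apply: snear_ext (snearM Sf (Ss t Tt tx i)).
by apply: nearW => y; rewrite /fcoord linearZ.
Qed.

Lemma frame_near e x : local_frame e -> fdom e x -> \forall y \near x, fdom e y.
Proof. by move=> [oe _ _] ex; apply: open_nbhs_nbhs. Qed.

Lemma fsec_secnear e x i : local_frame e -> fdom e x -> secnear x (fsec e i).
Proof. by move=> [oe Se _] ex; exact: secnear_on oe ex (Se i). Qed.

Lemma frame_basis e x : local_frame e -> fdom e x -> basis_of fullv (ftup e x).
Proof. by move=> [_ _]; exact. Qed.

(** By Cramer's formulas: the coordinates in e are those in a trivialization multiplied
    by the inverse of a smooth invertible matrix. *)
Lemma fcoord_snear e x s i : local_frame e -> fdom e x -> secnear x s ->
  snear x (fun y => fcoord e i (s y)).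
Proof.
move=> Le ex Ss; have [t Tt tx] := triv_cover A x.
pose P y := coord_mx t (fun j => fsec e j y).
have dP y : fdom e y -> fdom t y -> \det (P y) != 0.
  move=> ey ty; apply/(cmx_basis _ (triv_basis Tt ty)); exact: frame_basis ey.
have SP i' j' : snear x (fun y => P y i' j').
  apply: snear_ext (fsec_secnear j' Le ex Tt tx i').
  by apply: nearW => y; rewrite mxE.
apply: (@snear_ext _ _ _ _ (fun y => \sum_j invmx (P y) i j * fcoord t j (s y))).
  apply: filterS2 (frame_near Le ex) (triv_near Tt tx) => y ey ty.
  have u : P y \in unitmx by rewrite unitmxE unitfE dP.
  pose S : 'cV[R]_r := \col_j fcoord e j (s y).
  transitivity ((invmx (P y) *m (P y *m S)) i ord0); last by rewrite mulKmx // mxE.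
  rewrite mxE; apply: eq_bigr => j _; congr (_ * _).
  rewrite {1}(frame_expand (frame_basis Le ey) (memvf (s y))) /fcoord linear_sum mxE.
  by apply: eq_bigr => l _; rewrite !mxE linearZ /= mulrC.
apply: snear_sum => j _; apply: snearM; last exact: Ss.
by apply: snear_invmx => //; exact: dP.
Qed.

Lemma secnear_of_frame e x s : local_frame e -> fdom e x ->
  (forall i, snear x (fun y => fcoord e i (s y))) -> secnear x s.
Proof.
move=> Le ex Sf.
apply: (@secnear_ext _ (fun y => \sum_i fcoord e i (s y) *: fsec e i y)).
  apply: filterS (frame_near Le ex) => y ey.
  by rewrite -(frame_expand (frame_basis Le ey) (memvf (s y))).
by apply: secnear_sum => i _ //; exact: fsec_secnear.
Qed.

Lemma triv_local_frame (t : lframe A r) : trivs t -> local_frame t.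
Proof.
move=> Tt; split; [exact: triv_open|move=> i|by move=> x; exact: triv_basis].
apply: smooth_section_of => x tx; apply: (secnear_of_triv Tt tx) => l.
apply: (@snear_ext _ _ _ _ (fun=> (l == i)%:R)); last exact: snear_cst.
by apply: filterS (triv_near Tt tx) => y ty; rewrite (fcoord_fsec _ _ (triv_basis Tt ty)).
Qed.

Lemma frame_inj e x (v w : A x) : local_frame e -> fdom e x ->
  (forall l, fcoord e l v = fcoord e l w) -> v = w.
Proof.
move=> Le ex vw; have be := frame_basis Le ex.
rewrite (frame_expand be (memvf v)) (frame_expand be (memvf w)).
by apply: eq_bigr => l _; rewrite vw.
Qed.

(** Being a basis is the nonvanishing of a determinant, an open condition. *)
Lemma basis_near (w : 'I_r -> forall y, A y) x : (forall j, secnear x (w j)) ->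
  basis_of fullv [tuple w j x | j < r] ->
  \forall y \near x, basis_of fullv [tuple w j y | j < r].
Proof.
move=> Sw bw; have [t Tt tx] := triv_cover A x.
pose P y := coord_mx t (fun j => w j y).
have d0 : \det (P x) != 0 by apply/(cmx_basis _ (triv_basis Tt tx)).
have SP i' j' : snear x (fun y => P y i' j').
  by apply: snear_ext (Sw j' t Tt tx i'); apply: nearW => y; rewrite mxE.
apply: filterS2 (det_neq0_near d0 SP) (triv_near Tt tx) => y dy ty.
exact/(cmx_basis _ (triv_basis Tt ty)).
Qed.

Lemma local_frame_near (w : 'I_r -> forall y, A y) x (P : M -> Prop) :
  (forall j, secnear x (w j)) -> basis_of fullv [tuple w j x | j < r] ->
  (\forall y \near x, P y) ->
  exists U : set M, [/\ U x, local_frame (LFrame U w) & forall y, U y -> P y].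
Proof.
move=> Sw bw nP.
have nS : \forall y \near x, forall j, secnear y (w j).
  by apply: filter_forall => j; exact: secnear_near.
have [U [oU Ux] HU] := near_open (filterI nP (filterI nS (basis_near Sw bw))).
exists U; split=> //; last by move=> y /HU[].
split=> //; last by move=> y /HU[_ []].
by move=> j; apply: smooth_section_of => y /HU[_ [+ _]]; exact.
Qed.

Lemma local_basis_restrict k (S : forall x, {vspace A x}) (e : lframe A k) U : open U ->
  U `<=` fdom e -> local_basis S e -> local_basis S (LFrame U (fsec e)).
Proof.
move=> oU Ue [oe Se be]; split => //; last by move=> x /Ue; exact: be.
by move=> i; apply: smooth_section_of => x /Ue ex; exact: secnear_on oe ex (Se i).
Qed.

Lemma section_eq (s t : section A) : (forall x, s x = t x) -> s = t.
Proof.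
case: s t => s Ss [t St] /= E.
have {}E : s = t by apply: functional_extensionality_dep.
by subst t; congr MkSection; exact: Prop_irrelevance.
Qed.

Lemma exists_section U x s : open U -> U x -> (forall y, U y -> secnear y s) ->
  exists (S : section A) (chi : cfun M),
    [/\ \forall y \near x, chi y = 1, forall y, S y = chi y *: s y &
        forall y, ~ U y -> chi y = 0].
Proof.
move=> oU Ux Ss; have [chi [chi1 chi0]] := exists_bump oU Ux.
have SS : smooth_section_on setT (fun y => chi y *: s y).
  apply: smooth_section_of => y _; have [Uy|nUy] := pselect (U y).
    by apply: secnearZ; [exact: cfun_snear|exact: Ss].
  move=> t Tt ty i; apply: snear_ext (snear_cst y 0).
  by apply: filterS (chi0 y nUy) => z ->; rewrite scale0r /fcoord linear0.
exists (MkSection SS), chi; split=> // y /chi0/nbhs_singleton //.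
Qed.

Lemma extend_section x s : secnear x s -> exists S : section A, \forall y \near x, S y = s y.
Proof.
move=> Ss; have [U [oU Ux] HU] := near_open (secnear_near Ss).
have [S [chi [chi1 SE _]]] := exists_section oU Ux HU.
by exists S; apply: filterS chi1 => y cy; rewrite SE cy scale1r.
Qed.

Lemma section_through x (v : A x) : exists S : section A, S x = v.
Proof.
have [t Tt tx] := triv_cover A x.
have Ss : secnear x (fun y => \sum_i fcoord t i v *: fsec t i y).
  apply: secnear_sum => i _; first exact: snear_cst.
  exact: fsec_secnear (triv_local_frame Tt) tx.
have [S SE] := extend_section Ss; exists S; rewrite (nbhs_singleton SE).
by rewrite -(frame_expand (triv_basis Tt tx) (memvf v)).
Qed.

End Frames.

Section DualFrames.
Variables (R : realType) (n : nat) (M : manifold R n) (r : nat) (A : vbundle M r).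
Implicit Types (x y : M) (e : lframe A r).

Lemma dual_coord e i x (xi : dual A x) : basis_of fullv (ftup e x) ->
  fcoord (dual_frame e) i xi = (xi : 'Hom(A x, R^o)) (fsec e i x).
Proof.
move=> be; rewrite {1}(dual_expand xi be).
exact: (fcoord_sum _ _ (dual_frame_basis be)).
Qed.

Lemma dual_fsecE e i x (v : A x) :
  (fsec (dual_frame e) i x : 'Hom(A x, R^o)) v = fcoord e i v.
Proof. by rewrite /= lfunE. Qed.

Lemma snear_pair x (xi : forall y, dual A y) (s : forall y, A y) :
  secnear x xi -> secnear x s ->
  snear x (fun y => (xi y : 'Hom(A y, R^o)) (s y)).
Proof.
move=> Sxi Ss; have [t Tt tx] := triv_cover A x.
apply: (@snear_ext _ _ _ _ (fun y => \sum_i fcoord t i (s y) * fcoord (dual_frame t) i (xi y))).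
  apply: filterS (triv_near Tt tx) => y ty; have bt := triv_basis Tt ty.
  rewrite {2}(frame_expand bt (memvf (s y))) linear_sum; apply: eq_bigr => i _.
  by rewrite linearZ /= dual_coord.
by apply: snear_sum => i _; apply: snearM; [exact: Ss|apply: Sxi => //; exists t].
Qed.

Lemma secnear_dual e x (xi : forall y, dual A y) : local_frame e -> fdom e x ->
  (forall i, snear x (fun y => (xi y : 'Hom(A y, R^o)) (fsec e i y))) -> secnear x xi.
Proof.
move=> Le ex Sxi _ [t Tt <-] /= tx i.
apply: (@snear_ext _ _ _ _ (fun y => \sum_j fcoord e j (fsec t i y)
   * (xi y : 'Hom(A y, R^o)) (fsec e j y))).
  apply: filterS2 (frame_near Le ex) (triv_near Tt tx) => y ey ty.
  rewrite dual_coord; last exact: triv_basis.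
  rewrite {2}(frame_expand (frame_basis Le ey) (memvf (fsec t i y))) linear_sum.
  by apply: eq_bigr => j _; rewrite linearZ.
apply: snear_sum => j _; apply: snearM => //; apply: fcoord_snear => //.
exact: fsec_secnear (triv_local_frame Tt) tx.
Qed.

Lemma dual_fsec_secnear e x i : local_frame e -> fdom e x ->
  secnear (A := dual A) x (fsec (dual_frame e) i).
Proof.
move=> Le ex; apply: (secnear_dual Le ex) => j.
apply: (@snear_ext _ _ _ _ (fun=> (i == j)%:R)); last exact: snear_cst.
apply: filterS (frame_near Le ex) => y ey.
by rewrite dual_fsecE (fcoord_fsec _ _ (frame_basis Le ey)).
Qed.

End DualFrames.

Section Completion.
Variables (R : realType) (n : nat) (M : manifold R n) (k s : nat) (A : vbundle M (k + s)).
Implicit Types (x y : M).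

Lemma complete_rows (Z : 'M[R]_(s, k + s)) : row_free Z ->
  exists C : 'M[R]_(k, k + s), \det (col_mx C Z) != 0.
Proof.
move=> fZ.
have rk : \rank (Z^C)%MS = k by rewrite mxrank_compl (eqP fZ) addnK.
pose C : 'M[R]_(k, k + s) := castmx (rk, erefl) (row_base (Z^C)%MS).
exists C; rewrite -unitfE -unitmxE -row_full_unit -sub1mx.
rewrite -addsmxE.
have CE : (C :=: Z^C)%MS.
  have aux m m' l (E : m = m') (W : 'M[R]_(m, k + s)) (X : 'M[R]_(l, k + s)) :
    (W :=: X)%MS -> (castmx (E, erefl) W :=: X)%MS by case: _ / E; rewrite castmx_id.
  exact/aux/eq_row_base.
rewrite (adds_eqmx CE (eqmx_refl Z)) addsmxC sub1mx.
exact: addsmx_compl_full.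
Qed.

(** In a trivialization the forms z_i are the rows of a matrix; constant rows complete
    it to a square matrix that is invertible at x, hence near x. The columns of the
    inverse matrix are the frame. *)
Lemma dual_completion (z : 'I_s -> forall y, dual A y) x (P : M -> Prop) :
  (forall i, secnear x (z i)) -> free [tuple z i x | i < s] ->
  (\forall y \near x, P y) ->
  exists e : lframe A (k + s), [/\ local_frame e, fdom e x,
    forall y, fdom e y -> P y &
    forall y, fdom e y -> forall i j,
      (z i y : 'Hom(A y, R^o)) (fsec e j y) = (rshift k i == j)%:R].
Proof.
move=> Sz fz nP; have [t Tt tx] := triv_cover A x.
have St m : secnear x (fsec t m) by exact: fsec_secnear (triv_local_frame Tt) tx.
pose Z y : 'M[R]_(s, k + s) := \matrix_(i, m) (z i y : 'Hom(A y, R^o)) (fsec t m y).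
have fZ : row_free (Z x).
  rewrite -kermx_eq0; apply/eqP/row_matrixP => l; rewrite row0.
  set w := row l _; have wZ : w *m Z x = 0.
    by apply/sub_kermxP; rewrite /w row_sub.
  apply/rowP => i; rewrite [RHS]mxE.
  move/freeP: fz => /(_ (w ord0)); apply.
  apply/lfunP => v; rewrite sum_lfunE lfunE /=.
  rewrite {1}(frame_expand (triv_basis Tt tx) (memvf v)).
  transitivity (\sum_m fcoord t m v * (w *m Z x) ord0 m); last first.
    by rewrite wZ big1 // => m _; rewrite mxE mulr0.
  transitivity (\sum_(i < s) \sum_m w ord0 i * (fcoord t m v * Z x i m)).
    apply: eq_bigr => i' _; rewrite (nth_map i') ?size_enum_ord // nth_ord_enum.
    rewrite lfunE /= linear_sum scaler_sumr.
    by apply: eq_bigr => m _; rewrite [Z x i' m]mxE [X in _ *: X]linearZ.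
  rewrite exchange_big; apply: eq_bigr => m _; rewrite mxE mulr_sumr.
  by apply: eq_bigr => i' _; rewrite mulrCA.
have [C dC] := complete_rows fZ.
pose G y := col_mx C (Z y).
have SG i j : snear x (fun y => G y i j).
  have [a ->|b ->] := split_ordP i.
    apply: (@snear_ext _ _ _ _ (fun=> C a j)); last exact: snear_cst.
    by apply: nearW => y; rewrite col_mxEu.
  apply: snear_ext (snear_pair (Sz b) (St j)).
  by apply: nearW => y; rewrite col_mxEd mxE.
pose w j y := \sum_m invmx (G y) m j *: fsec t m y.
have Sw j : secnear x (w j).
  by apply: secnear_sum => m _ //; exact: snear_invmx.
have cw y : fdom t y -> coord_mx t (fun j => w j y) = invmx (G y).
  move=> ty; apply/matrixP => i j; rewrite mxE.
  exact: (fcoord_sum _ _ (triv_basis Tt ty)).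
have bw : basis_of fullv [tuple w j x | j < k + s].
  apply/(cmx_basis _ (triv_basis Tt tx)).
  by rewrite cw // det_inv invr_neq0.
have [U [Ux LU HU]] := local_frame_near Sw bw
  (filterI nP (filterI (triv_near Tt tx) (det_neq0_near dC SG))).
exists (LFrame U w); split=> //; first by move=> y /HU[].
move=> y /HU[_ [ty dy]] i j /=.
have u : G y \in unitmx by rewrite unitmxE unitfE.
transitivity ((G y *m invmx (G y)) (rshift k i) j); last by rewrite mulmxV // mxE.
rewrite linear_sum mxE; apply: eq_bigr => m _.
by rewrite linearZ /= col_mxEd mxE [RHS]mulrC.
Qed.

End Completion.

(** * Super-vector fields of degree 1 in coordinates *)

Section SuperFieldCoefficients.
Variables (R : realType) (n : nat) (M : manifold R n) (m : nat).
Variables (c : chart R n M) (Ac : atlas c).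
Implicit Types (V : lsfield M m) (x : M).

Lemma superpderiv_sum (T : finType) (f : T -> M -> R) (X : T -> grassmann R m) G i x :
  cdom c x -> (\forall y \near x, G y = \sum_j f j y *: X j) -> (forall j, snear x (f j)) ->
  superpderiv c i G x = \sum_j pderiv c i (f j) x *: X j.
Proof.
move=> cx GE Sf; apply/ffunP => I; rewrite sum_ffunE [LHS]ffunE.
rewrite -[pderiv _ _ _ _]/(dv c x _ _).
rewrite (@dv_ext _ _ _ c x _ cx _ (fun y => \sum_j f j y * X j I)); last first.
  apply: filterS GE => y ->; rewrite sum_ffunE; apply: eq_bigr => j _; by rewrite ffunE.
have SX j : snear x (fun y => f j y * X j I) by apply: snearM => //; exact: snear_cst.
rewrite dv_sum //; apply: eq_bigr => j _.
rewrite (dvM _ Ac cx (Sf j) (snear_cst x (X j I))) dv_cst mulr0 add0r ffunE.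
by rewrite [RHS]mulrC.
Qed.

Lemma superpderiv_glin (t : 'I_m -> M -> R) G i x :
  cdom c x -> (\forall y \near x, G y = glin (fun b => t b y)) -> (forall b, snear x (t b)) ->
  superpderiv c i G x = glin (fun b => pderiv c i (t b) x).
Proof. exact: superpderiv_sum. Qed.

Lemma superpderiv_gbil (t : 'I_m -> 'I_m -> M -> R) G i x :
  cdom c x -> (\forall y \near x, G y = gbil (fun b g => t b g y)) ->
  (forall b g, snear x (t b g)) ->
  superpderiv c i G x = gbil (fun b g => pderiv c i (t b g) x).
Proof.
move=> cx GE St; rewrite (@superpderiv_sum _ (fun p : 'I_m * 'I_m => t p.1 p.2)
   (fun p => gmul (geta R p.1) (geta R p.2))) //.
  by rewrite /gbil pair_bigA.
by apply: filterS GE => y ->; rewrite /gbil pair_bigA.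
Qed.

Lemma superpderiv_gconst (t : M -> R) G i x :
  cdom c x -> (\forall y \near x, G y = gconst m (t y)) -> snear x t ->
  superpderiv c i G x = gconst m (pderiv c i t x).
Proof.
move=> cx GE St.
rewrite (@superpderiv_sum 'I_1 (fun=> t) (fun=> gconst m 1) _ i) //.
  by rewrite big_ord1 gconst_mul mulr1.
by apply: filterS GE => y ->; rewrite big_ord1 gconst_mul mulr1.
Qed.

Section Values.
Variables (V : lsfield M m) (x : M) (cx : cdom c x).
Variables (w1 : 'I_m -> 'I_n -> R) (w2 : 'I_m -> 'I_m -> 'I_m -> R).
Hypothesis V1 : forall i, sfx V i x = glin (fun b => w1 b i).
Hypothesis V2 : forall l, sfeta V l x = gbil (fun b g => 2^-1 * w2 b g l).

Lemma sfapply_gconst (t : M -> R) G :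
  (\forall y \near x, G y = gconst m (t y)) -> snear x t ->
  sfapply c V G x = glin (fun b => \sum_i w1 b i * pderiv c i t x).
Proof.
move=> GE St; rewrite /sfapply [X in _ + X]big1 ?addr0; last first.
  by move=> l _; rewrite (nbhs_singleton GE) gderiv_gconst gmul0r.
rewrite (eq_bigr (fun i => glin (fun b => w1 b i * pderiv c i t x))) ?glin_sum // => i _.
rewrite (superpderiv_gconst i cx GE St) gmul_gconst V1 glinZ.
by apply: eq_glin => b; rewrite mulrC.
Qed.

Lemma sfapply_glin (t : 'I_m -> M -> R) G :
  (\forall y \near x, G y = glin (fun b => t b y)) -> (forall b, snear x (t b)) ->
  sfapply c V G x = gbil (fun b g => \sum_i w1 b i * pderiv c i (t g) x
                                    + \sum_l 2^-1 * w2 b g l * t l x).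
Proof.
move=> GE St; rewrite -gbilD -!gbil_sum; congr (_ + _); apply: eq_bigr => i _.
  by rewrite (superpderiv_glin i cx GE St) V1 gmul_glin.
rewrite (nbhs_singleton GE) gderiv_glin gmul_gconst V2 gbilZ.
by apply: eq_gbil => b g; rewrite mulrC.
Qed.

Lemma sfapply_gbil (t : 'I_m -> 'I_m -> M -> R) G :
  (\forall y \near x, G y = gbil (fun b g => t b g y)) -> (forall b g, snear x (t b g)) ->
  sfapply c V G x = gcub (fun b g d => \sum_i w1 b i * pderiv c i (t g d) x
                           + \sum_l 2^-1 * w2 b g l * (t l d x - t d l x)).
Proof.
move=> GE St; rewrite -gcubD -!gcub_sum; congr (_ + _); apply: eq_bigr => i _.
  by rewrite (superpderiv_gbil i cx GE St) V1 gmul_glin_gbil.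
by rewrite (nbhs_singleton GE) gderiv_gbil V2 gmul_gbil_glin.
Qed.

End Values.

Variables (D : set M) (oD : open D) (Dc : D `<=` cdom c).
Variables (V : lsfield M m).
Variables (a2 : 'I_m -> 'I_m -> 'I_m -> M -> R) (a1 : 'I_m -> 'I_n -> M -> R).
Hypothesis VF : degree1_form D V a2 a1.

Let Dnear x : D x -> \forall y \near x, D y.
Proof. by move=> Dx; apply: open_nbhs_nbhs. Qed.

Lemma form_sfx x i : D x -> sfx V i x = glin (fun b => a1 b i x).
Proof. by case: VF => _ _ _ _ H /H. Qed.

Lemma form_sfeta x l : D x -> sfeta V l x = gbil (fun b g => 2^-1 * a2 b g l x).
Proof. by case: VF => _ _ _ H _ /H. Qed.

Lemma form_a1 x b i : D x -> a1 b i x = sfx V i x [set b]%SET.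
Proof. by move=> Dx; rewrite form_sfx // glinE. Qed.

Lemma form_anti x b g l : D x -> a2 b g l x = - a2 g b l x.
Proof. by case: VF => _ _ H _ _ /H. Qed.

Lemma form_a2 x b g l : D x -> a2 b g l x = gderiv b (sfeta V l x) [set g]%SET.
Proof.
move=> Dx; rewrite form_sfeta // gderiv_gbil glinE (form_anti g b l Dx).
by rewrite mulrN; field.
Qed.

Lemma form_snear1 x b i : D x -> snear x (a1 b i).
Proof. by case: VF => _ S _ _ _ Dx; exact: snear_on oD Dx (S b i). Qed.

Lemma form_snear2 x b g l : D x -> snear x (a2 b g l).
Proof. by case: VF => S _ _ _ _ Dx; exact: snear_on oD Dx (S b g l). Qed.

(** When a1 is an anchor and a2 the opposite of structure functions, [anchor_eq] says
    that the anchor carries the bracket of two members of the frame to the bracket of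
    vector fields, and [jacobi_eq] is the Jacobi identity for three members. *)
Definition anchor_eq x := forall b g i,
  \sum_j (a1 b j x * pderiv c j (a1 g i) x - a1 g j x * pderiv c j (a1 b i) x)
    + \sum_l a2 b g l x * a1 l i x = 0.

Definition jacobi_term x b g d l :=
  \sum_j a1 b j x * pderiv c j (a2 g d l) x + \sum_e a2 b g e x * a2 e d l x.

Definition jacobi_eq x := forall b g d l,
  jacobi_term x b g d l + jacobi_term x g d b l + jacobi_term x d b g l = 0.

(** For odd V, [V, V] = 2 V^2. The coefficients of V x^i and V eta^l have degrees 1 and
    2, so V^2 x^i and V^2 eta^l have degrees 2 and 3; they vanish when their
    antisymmetrized coefficients do, which are the left-hand sides of [anchor_eq] and
    [jacobi_eq]. *)
Lemma homological_eqs :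
  homological_on c D V <-> forall x, D x -> anchor_eq x /\ jacobi_eq x.
Proof.
(* The bracket of odd fields is an anticommutator. *)
have tw (G : grassmann R m) : G - (-1) ^+ (true && true) *: G = 0 <-> G = 0.
  rewrite expr1 scaleN1r opprK; split=> [G2|->]; last by rewrite addr0.
  have : (2 : R) *: G = 0 by rewrite scaler_nat mulr2n.
  by move/eqP; rewrite scaler_eq0 pnatr_eq0 /= => /eqP.
suff H x : D x -> ((forall i, sfapply c V (sfx V i) x = 0) <-> anchor_eq x) /\
                  ((forall l, sfapply c V (sfeta V l) x = 0) <-> jacobi_eq x).
  split=> [h x Dx|h x Dx]; have [H1 H2] := H x Dx.
    by have [h1 h2] := h x Dx; split; [apply/H1 => i|apply/H2 => l]; apply/tw; [exact: h1|exact: h2].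
  have [/H1 h1 /H2 h2] := h x Dx.
  by split=> [i|l]; apply/tw; [exact: h1|exact: h2].
move=> Dx; have cx := Dc Dx; have V1 i := form_sfx i Dx; have V2 l := form_sfeta l Dx.
have N1 i : \forall y \near x, sfx V i y = glin (fun b => a1 b i y).
  by apply: filterS (Dnear Dx) => y; exact: form_sfx.
have N2 l : \forall y \near x, sfeta V l y = gbil (fun b g => 2^-1 * a2 b g l y).
  by apply: filterS (Dnear Dx) => y; exact: form_sfeta.
have half (u : R) : 2^-1 * u + 2^-1 * u = u by field.
split.
  have E i : sfapply c V (sfx V i) x = gbil (fun b g => \sum_j a1 b j x * pderiv c j (a1 g i) x
      + \sum_l 2^-1 * a2 b g l x * a1 l i x).
    by apply: (sfapply_glin cx V1 V2 (N1 i)) => b; exact: form_snear1.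
  have E2 i b g : \sum_j (a1 b j x * pderiv c j (a1 g i) x - a1 g j x * pderiv c j (a1 b i) x)
    + \sum_l a2 b g l x * a1 l i x =
    (\sum_j a1 b j x * pderiv c j (a1 g i) x + \sum_l 2^-1 * a2 b g l x * a1 l i x)
    - (\sum_j a1 g j x * pderiv c j (a1 b i) x + \sum_l 2^-1 * a2 g b l x * a1 l i x).
    rewrite opprD addrACA sumrB; congr (_ + _); rewrite -sumrB; apply: eq_bigr => l _.
    by rewrite (form_anti g b l Dx) mulrN mulNr opprK -mulrDl half.
  split=> [h b g i|h i].
    have := h i; rewrite E -gbil0 => /gbil_eq/(_ b g); rewrite -E2 => ->.
    by rewrite subrr.
  by rewrite E -gbil0; apply/gbil_eq => b g; rewrite -E2 h subrr.
pose P1 b g d l := \sum_j a1 b j x * pderiv c j (a2 g d l) x.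
pose P2 b g d l := \sum_e a2 b g e x * a2 e d l x.
have A1 b g d l : P1 b g d l = - P1 b d g l.
  rewrite /P1 -sumrN; apply: eq_bigr => j _; rewrite -mulrN; congr (_ * _).
  rewrite -[LHS]/(dv c x _ _) -[X in - X]/(dv c x _ _) -(dvN _ Ac cx (form_snear2 d g l Dx)).
  by apply: (dv_ext _ cx); apply: filterS (Dnear Dx) => y; exact: form_anti.
have A2 b g d l : P2 b g d l = - P2 g b d l.
  by rewrite /P2 -sumrN; apply: eq_bigr => e _; rewrite (form_anti b g e Dx) mulNr.
have S2 l b g : snear x (fun y => 2^-1 * a2 b g l y).
  by apply: snearM; [exact: snear_cst|exact: form_snear2].
have E l : sfapply c V (sfeta V l) x = gcub (fun b g d => 2^-1 * (P1 b g d l + P2 b g d l)).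
  rewrite (sfapply_gbil cx V1 V2 (N2 l) (S2 l)); apply: eq_bigr => b _; apply: eq_bigr => g _.
  apply: eq_bigr => d _; congr (_ *: _); rewrite mulrDr !mulr_sumr; congr (_ + _).
    apply: eq_bigr => j _; rewrite -[pderiv c j _ x]/(dv c x _ _).
    rewrite (dvM _ Ac cx (snear_cst x _) (form_snear2 g d l Dx)) dv_cst mulr0 addr0.
    by rewrite mulrCA.
  apply: eq_bigr => e _; rewrite (form_anti d e l Dx) mulrN opprK half.
  by rewrite mulrA.
have E3 (b g d l : 'I_m) :
  2^-1 * (P1 b g d l + P2 b g d l) - 2^-1 * (P1 g b d l + P2 g b d l)
  + 2^-1 * (P1 g d b l + P2 g d b l) - (2^-1 * (P1 b d g l + P2 b d g l)
  - 2^-1 * (P1 d b g l + P2 d b g l) + 2^-1 * (P1 d g b l + P2 d g b l)) =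
  jacobi_term x b g d l + jacobi_term x g d b l + jacobi_term x d b g l.
  rewrite /jacobi_term -!/(P1 _ _ _ _) -!/(P2 _ _ _ _).
  rewrite (A1 g b d l) (A1 b d g l) (A1 d g b l) (A2 g b d l) (A2 b d g l) (A2 d g b l).
  move: (P1 g d b l) (P1 b g d l) (P1 d b g l) (P2 b g d l) (P2 d b g l) (P2 g d b l).
  by move=> *; field.
split=> [h b g d l|h l].
  by have := h l; rewrite E => /gcub_eq0/(_ b g d); rewrite E3.
by rewrite E; apply/gcub_eq0 => b g d; rewrite E3; exact: h.
Qed.

End SuperFieldCoefficients.

(** * The bracket of a Lie algebroid in a local frame *)

Section BracketLocal.
Variables (R : realType) (n : nat) (M : manifold R n) (r : nat) (A : vbundle M r).
Variable L : lie_algebroid A.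
Implicit Types (x y : M) (s t u : section A) (e : lframe A r).

Lemma section0_subproof : smooth_section_on setT (fun x => 0 : A x).
Proof.
apply: smooth_section_of => x _ t Tt tx i; apply: snear_ext (snear_cst x 0).
by apply: nearW => y; rewrite /fcoord linear0.
Qed.
Definition section0 := MkSection section0_subproof.

Definition sec_sum (I : Type) (l : seq I) (f : I -> cfun M) (w : I -> section A) : section A :=
  foldr (fun i acc => sectionD (sectionZ (f i) (w i)) acc) section0 l.

Lemma sec_sumE (I : Type) (l : seq I) f w x :
  @sec_sum I l f w x = \sum_(i <- l) f i x *: w i x.
Proof. by elim: l => [|i l IH]; rewrite ?big_nil // big_cons -IH. Qed.

Lemma bracketDr s t t' x : bracket L s (sectionD t t') x = bracket L s t x + bracket L s t' x.
Proof. by rewrite bracket_anti bracketDl opprD -!bracket_anti. Qed.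

Lemma bracket0r s x : bracket L s section0 x = 0.
Proof.
have E : sectionD section0 section0 = section0 by apply: section_eq => y /=; rewrite addr0.
have := bracketDr s section0 section0 x; rewrite E => /eqP.
by rewrite -subr_eq subrr => /eqP.
Qed.

Lemma bracket_sumr (I : Type) (l : seq I) f w s x :
  bracket L s (@sec_sum I l f w) x = \sum_(i <- l)
    (f i x *: bracket L s (w i) x + tderiv x (anchor L x (s x)) (f i) *: w i x).
Proof.
elim: l => [|i l IH]; first by rewrite big_nil bracket0r.
by rewrite big_cons -IH /= bracketDr leibniz.
Qed.

(** If chi is 1 near x and vanishes where t and t' may differ, then chi t = chi t', and
    the Leibniz rule gives [s, chi t] = [s, t] at x. *)
Lemma bracket_near_r s t t' x : (\forall y \near x, t y = t' y) ->
  bracket L s t x = bracket L s t' x.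
Proof.
move=> tt'; have [U [oU Ux] UE] := near_open tt'.
have [chi [chi1 chi0]] := exists_bump oU Ux.
have E : sectionZ chi t = sectionZ chi t'.
  apply: section_eq => y /=; have [Uy|nUy] := pselect (U y); first by rewrite UE.
  by rewrite (nbhs_singleton (chi0 y nUy)) !scale0r.
have H t1 : bracket L s (sectionZ chi t1) x = bracket L s t1 x.
  rewrite leibniz (tderiv_near_cst _ chi1) (nbhs_singleton chi1).
  by rewrite scale1r scale0r addr0.
by rewrite -(H t) E H.
Qed.

Lemma bracket_near s s' t t' x : (\forall y \near x, s y = s' y) ->
  (\forall y \near x, t y = t' y) -> bracket L s t x = bracket L s' t' x.
Proof.
move=> ss' tt'; rewrite (bracket_near_r s tt') bracket_anti (bracket_near_r t' ss').
by rewrite -bracket_anti.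
Qed.

Definition extends e x (E : 'I_r -> section A) :=
  forall b, \forall y \near x, E b y = fsec e b y.

Lemma exists_extends e x : local_frame e -> fdom e x -> exists E, extends e x E.
Proof.
move=> Le ex; have H b : exists S : section A, \forall y \near x, S y = fsec e b y.
  by apply: extend_section; exact: fsec_secnear.
by have [E HE] := choice H; exists E.
Qed.

(** Near x a section is a combination of the E l with globally defined smooth
    coefficients, so locality of the bracket allows the Leibniz rule. *)
Lemma bracket_expand_r e x E s t : local_frame e -> fdom e x -> extends e x E ->
  bracket L s t x = \sum_l (fcoord e l (t x) *: bracket L s (E l) x
    + tderiv x (anchor L x (s x)) (fun y => fcoord e l (t y)) *: fsec e l x).
Proof.
move=> Le ex EE.
have St l : snear x (fun y => fcoord e l (t y)).
  by apply: fcoord_snear => //; exact: section_secnear.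
have [T HT] := choice (fun l => exists_cfun (St l)).
have tE : \forall y \near x, t y = sec_sum (index_enum 'I_r) T E y.
  have nT : \forall y \near x, forall l, T l y = fcoord e l (t y) by apply: filter_forall.
  have nE : \forall y \near x, forall l, E l y = fsec e l y by apply: filter_forall.
  apply: filterS3 (frame_near Le ex) nT nE => y ey Ty Ey.
  rewrite sec_sumE {1}(frame_expand (frame_basis Le ey) (memvf (t y))).
  by apply: eq_bigr => l _; rewrite Ty Ey.
rewrite (bracket_near_r s tE) bracket_sumr; apply: eq_bigr => l _.
by rewrite (nbhs_singleton (HT l)) (tderiv_ext _ (HT l)) (nbhs_singleton (EE l)).
Qed.

Lemma bracket_expand e x E s t : local_frame e -> fdom e x -> extends e x E ->
  bracket L s t x =
   \sum_l (tderiv x (anchor L x (s x)) (fun y => fcoord e l (t y))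
         - tderiv x (anchor L x (t x)) (fun y => fcoord e l (s y))) *: fsec e l x
   + \sum_b \sum_g (fcoord e b (s x) * fcoord e g (t x)) *: bracket L (E b) (E g) x.
Proof.
move=> Le ex EE; have Ss b : snear x (fun y => fcoord e b (s y)).
  by apply: fcoord_snear => //; exact: section_secnear.
have H g : bracket L s (E g) x = \sum_b fcoord e b (s x) *: bracket L (E b) (E g) x
    - \sum_b tderiv x (anchor L x (E g x)) (fun y => fcoord e b (s y)) *: fsec e b x.
  rewrite bracket_anti (bracket_expand_r (E g) s Le ex EE) big_split opprD /=; congr (_ - _).
  by rewrite -sumrN; apply: eq_bigr => b _; rewrite [in RHS]bracket_anti scalerN.
have anchorE b : tderiv x (anchor L x (t x)) (fun y => fcoord e b (s y)) =
    \sum_g fcoord e g (t x) * tderiv x (anchor L x (E g x)) (fun y => fcoord e b (s y)).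
  rewrite {1}(frame_expand (frame_basis Le ex) (memvf (t x))) linear_sum tderiv_suml //.
  by apply: eq_bigr => g _; rewrite linearZ (tderivZl _ _ (Ss b)) (nbhs_singleton (EE g)).
rewrite (bracket_expand_r s t Le ex EE) big_split /= addrC.
have -> : \sum_g fcoord e g (t x) *: bracket L s (E g) x =
   \sum_b \sum_g (fcoord e b (s x) * fcoord e g (t x)) *: bracket L (E b) (E g) x
   - \sum_b tderiv x (anchor L x (t x)) (fun y => fcoord e b (s y)) *: fsec e b x.
  under eq_bigr => g _ do rewrite H scalerBr !scaler_sumr.
  rewrite sumrB; congr (_ - _); rewrite exchange_big; apply: eq_bigr => b _ /=.
    by apply: eq_bigr => g _; rewrite scalerA mulrC.
  by rewrite anchorE scaler_suml; apply: eq_bigr => g _; rewrite scalerA.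
rewrite addrCA addrC; congr (_ + _).
by rewrite -sumrB; apply: eq_bigr => l _; rewrite scalerBl.
Qed.

Definition structure_fun e (E : 'I_r -> section A) b g l x := fcoord e l (bracket L (E b) (E g) x).

Lemma fcoord_bracket e x E s t l : local_frame e -> fdom e x -> extends e x E ->
  fcoord e l (bracket L s t x) =
    tderiv x (anchor L x (s x)) (fun y => fcoord e l (t y))
    - tderiv x (anchor L x (t x)) (fun y => fcoord e l (s y))
    + \sum_b \sum_g fcoord e b (s x) * fcoord e g (t x) * structure_fun e E b g l x.
Proof.
move=> Le ex EE; rewrite (bracket_expand s t Le ex EE) {1}/fcoord linearD /=.
congr (_ + _); first exact: (fcoord_sum _ _ (frame_basis Le ex)).
rewrite linear_sum; apply: eq_bigr => b _; rewrite linear_sum; apply: eq_bigr => g _.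
by rewrite linearZ.
Qed.

Lemma extensions_exist e x :
  exists E : 'I_r -> section A, local_frame e -> fdom e x -> extends e x E.
Proof.
have [[Le ex]|H] := pselect (local_frame e /\ fdom e x).
  by have [E HE] := exists_extends Le ex; exists E.
by exists (fun=> section0) => Le ex; case: H.
Qed.

(** A choice of extensions of the members of e near x; the choice made when e is not a
    frame around x has no meaning. *)
Definition frame_ext e x : 'I_r -> section A := sval (cid (extensions_exist e x)).

Lemma frame_extP e x : local_frame e -> fdom e x -> extends e x (frame_ext e x).
Proof. by rewrite /frame_ext; case: cid. Qed.

(** The structure functions of L in the frame e. The extensions depend on the point x,
    but the value does not depend on them ([structure_coefE]). *)
Definition structure_coef e b g l x := structure_fun e (frame_ext e x) b g l x.

Lemma extends_near e x E : local_frame e -> fdom e x -> extends e x E ->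
  \forall y \near x, fdom e y /\ extends e y E.
Proof.
move=> Le ex EE.
have nE : \forall y \near x, forall b, \forall z \near y, E b z = fsec e b z.
  apply: filter_forall => b; have [U [oU Ux] UE] := near_open (EE b).
  have := open_nbhs_nbhs (conj oU Ux); apply: filterS => y Uy.
  by have := open_nbhs_nbhs (conj oU Uy); apply: filterS.
by apply: filterS2 (frame_near Le ex) nE => y.
Qed.

Lemma structure_coefE e x E b g l : local_frame e -> fdom e x -> extends e x E ->
  structure_coef e b g l x = fcoord e l (bracket L (E b) (E g) x).
Proof.
move=> Le ex EE; rewrite /structure_coef /structure_fun; congr (fcoord _ _ _); apply: bracket_near.
  by apply: filterS2 (frame_extP Le ex b) (EE b) => y -> ->.
by apply: filterS2 (frame_extP Le ex g) (EE g) => y -> ->.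
Qed.

Lemma structure_coef_anti e x b g l : structure_coef e b g l x = - structure_coef e g b l x.
Proof. by rewrite /structure_coef /structure_fun bracket_anti /fcoord linearN. Qed.

Lemma structure_coef_snear e x b g l : local_frame e -> fdom e x -> snear x (structure_coef e b g l).
Proof.
move=> Le ex; have [E EE] := exists_extends Le ex.
apply: (@snear_ext _ _ _ _ (fun y => fcoord e l (bracket L (E b) (E g) y))).
  by apply: filterS (extends_near Le ex EE) => y [ey Ey]; rewrite (structure_coefE b g l Le ey Ey).
by apply: fcoord_snear => //; exact: section_secnear.
Qed.

Lemma fcoord_bracketE e x s t l : local_frame e -> fdom e x ->
  fcoord e l (bracket L s t x) =
    tderiv x (anchor L x (s x)) (fun y => fcoord e l (t y))
    - tderiv x (anchor L x (t x)) (fun y => fcoord e l (s y))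
    + \sum_b \sum_g fcoord e b (s x) * fcoord e g (t x) * structure_coef e b g l x.
Proof. by move=> Le ex; apply: fcoord_bracket => //; exact: frame_extP. Qed.

Definition anchor_coef c e b i x := tcomp c x (anchor L x (fsec e b x)) i.

Lemma anchor_coef_snear c e x b i : atlas c -> cdom c x -> local_frame e -> fdom e x ->
  snear x (anchor_coef c e b i).
Proof.
move=> Ac cx Le ex; have [E EE] := exists_extends Le ex.
apply: (@snear_ext _ _ _ _ (fun y => tcomp c y (anchor L y (E b y)) i)).
  by apply: filterS (EE b) => y; rewrite /anchor_coef => ->.
apply: snear_on (@cdom_open _ _ _ c) cx _; exact: (anchor_smooth L (E b) Ac i).
Qed.

Lemma tderiv_anchor_sum e x (v : A x) f : local_frame e -> fdom e x -> snear x f ->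
  tderiv x (anchor L x v) f = \sum_b fcoord e b v * tderiv x (anchor L x (fsec e b x)) f.
Proof.
move=> Le ex Sf.
rewrite {1}(frame_expand (frame_basis Le ex) (memvf v)) linear_sum tderiv_suml //.
by apply: eq_bigr => b _; rewrite linearZ /= tderivZl.
Qed.

Lemma fcoord_ext_near e x E b l : local_frame e -> fdom e x -> extends e x E ->
  \forall y \near x, fcoord e l (E b y) = (l == b)%:R.
Proof.
move=> Le ex EE; apply: filterS2 (frame_near Le ex) (EE b) => y ey ->.
by rewrite (fcoord_fsec _ _ (frame_basis Le ey)).
Qed.

Lemma sum_delta_mul k (i : 'I_k) (F : 'I_k -> R) : \sum_b (b == i)%:R * F b = F i.
Proof.
rewrite (bigD1 i) //= eqxx mul1r big1 ?addr0 // => j ji.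
by rewrite (negbTE ji) mul0r.
Qed.

Lemma fcoord_bracket_ext e x E b t l : local_frame e -> fdom e x -> extends e x E ->
  fcoord e l (bracket L (E b) t x) =
    tderiv x (anchor L x (fsec e b x)) (fun y => fcoord e l (t y))
    + \sum_g fcoord e g (t x) * structure_coef e b g l x.
Proof.
move=> Le ex EE; rewrite fcoord_bracketE // (nbhs_singleton (EE b)).
rewrite (tderiv_near_cst _ (fcoord_ext_near b l Le ex EE)) subr0; congr (_ + _).
under eq_bigr => b' _ do rewrite (fcoord_fsec _ _ (frame_basis Le ex));
  under eq_bigr => b' _ do (under eq_bigr => g _ do rewrite -mulrA; rewrite -mulr_sumr).
exact: sum_delta_mul.
Qed.

Section StructureEquations.
Variables (c : chart R n M) (e : lframe A r).
Hypotheses (Ac : atlas c) (Le : local_frame e).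
Variables (x : M) (cx : cdom c x) (ex : fdom e x).

Lemma algebroid_anchor_eq : anchor_eq c (fun b g l y => - structure_coef e b g l y) (anchor_coef c e) x.
Proof.
move=> b g i; have [E EE] := exists_extends Le ex.
have H := anchor_bracket L (E b) (E g) Ac cx i.
apply/eqP; rewrite addr_eq0 -sumrN; apply/eqP.
transitivity (lie_bracket_comp c (fun y => anchor L y (E b y)) (fun y => anchor L y (E g y)) i x).
  apply: eq_bigr => j _; rewrite (nbhs_singleton (EE b)) (nbhs_singleton (EE g)).
  have N b' : pderiv c j (fun y => tcomp c y (anchor L y (E b' y)) i) x =
      pderiv c j (anchor_coef c e b' i) x.
    apply: (dv_ext _ cx); by apply: filterS (EE b') => y ->.
  by rewrite (N b) (N g).
rewrite -H /tcomp (tderiv_anchor_sum _ Le ex (snear_coordf i Ac cx)).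
by apply: eq_bigr => l _; rewrite mulNr opprK (structure_coefE b g l Le ex EE).
Qed.

Lemma algebroid_jacobi_eq : jacobi_eq c (fun b g l y => - structure_coef e b g l y) (anchor_coef c e) x.
Proof.
move=> b g d l; have [E EE] := exists_extends Le ex.
have J := jacobi L (E b) (E g) (E d) x.
have H b1 g1 d1 : fcoord e l (bracket L (E b1) (bracket L (E g1) (E d1)) x) =
  \sum_j anchor_coef c e b1 j x * pderiv c j (structure_coef e g1 d1 l) x
  + \sum_m structure_coef e g1 d1 m x * structure_coef e b1 m l x.
  rewrite (fcoord_bracket_ext _ _ _ Le ex EE); congr (_ + _); last first.
    by apply: eq_bigr => m _; rewrite (structure_coefE g1 d1 m Le ex EE).
  rewrite -(tderivE _ Ac cx); last exact: structure_coef_snear.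
  apply: tderiv_ext; apply: filterS (extends_near Le ex EE) => y [ey Ey].
  by rewrite (structure_coefE _ _ _ Le ey Ey).
have JT b1 g1 d1 : jacobi_term c (fun b g l y => - structure_coef e b g l y) (anchor_coef c e) x b1 g1 d1 l =
  - \sum_j anchor_coef c e b1 j x * pderiv c j (structure_coef e g1 d1 l) x
  - \sum_m structure_coef e b1 g1 m x * structure_coef e d1 m l x.
  rewrite /jacobi_term -!sumrN; congr (_ + _); apply: eq_bigr => j _.
    rewrite -[pderiv _ _ _ _]/(dv c x _ _) dvN //; last exact: structure_coef_snear.
    by rewrite mulrN.
  by rewrite mulrNN [structure_coef e j _ _ _]structure_coef_anti mulrN.
have := congr1 (fun v : A x => fcoord e l v) J.
rewrite /fcoord linear0 !linearD /= -!/(fcoord _ _ _).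
rewrite (H b g d) (H g d b) (H d b g) (JT b g d) (JT g d b) (JT d b g).
set a1 := \sum_j _; set a2 := \sum_m _; set a3 := \sum_j _; set a4 := \sum_m _.
set a5 := \sum_j _; set a6 := \sum_m _ => E0.
have -> : - a1 - a6 + (- a3 - a2) + (- a5 - a4) = - (a1 + a2 + (a3 + a4) + (a5 + a6)) by ring.
by rewrite E0 oppr0.
Qed.

End StructureEquations.

Lemma differential_sfx (W : sfield A) : algebroid_differential L W ->
  forall c x b i, sdom c x ->
    sfx (sfloc W c) i x [set b]%SET = anchor_coef (schart c) (sframe c) b i x.
Proof.
move=> H c x b i cx; have [a2 [a1 [VF /(_ x cx)[H1 _]]]] := H c.
by rewrite -(form_a1 VF) //; exact: H1.
Qed.

Lemma differential_sfeta (W : sfield A) : algebroid_differential L W ->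
  forall c x b g l, sdom c x ->
    gderiv b (sfeta (sfloc W c) l x) [set g]%SET = - structure_coef (sframe c) b g l x.
Proof.
move=> H c x b g l cx; have [a2 [a1 [VF /(_ x cx)[_ H2]]]] := H c.
have Le := sframe_local c; have [_ ex] := cx.
rewrite -(form_a2 VF) // /structure_coef /structure_fun (H2 b g _ _ (frame_extP Le ex b) (frame_extP Le ex g)).
rewrite {1}/fcoord linearN /= opprK; symmetry.
exact: (fcoord_sum _ _ (frame_basis Le ex)).
Qed.

End BracketLocal.

(** * The Lie algebroid of a homological field *)

Section SuperFieldLaws.
Variables (R : realType) (n : nat) (M : manifold R n) (r : nat) (A : vbundle M r).
Implicit Types (x y : M) (c : scoord A).

Lemma sdom_open c : open (sdom c).
Proof. by apply: openI; [exact: cdom_open|case: (sframe_local c)]. Qed.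

Lemma sdom_sub c : sdom c `<=` cdom (schart c).
Proof. by move=> x []. Qed.

Lemma stransition_snear c c' x i j : sdom c x -> sdom c' x ->
  snear x (fun y => stransition c c' y i j).
Proof.
move=> [_ ex] [_ ex']; apply: fcoord_snear ex' _; first exact: sframe_local.
exact: fsec_secnear (sframe_local c) ex.
Qed.

Lemma fcoord_transition c c' x (v : A x) i : sdom c x -> sdom c' x ->
  fcoord (sframe c') i v = \sum_j stransition c c' x i j * fcoord (sframe c) j v.
Proof.
move=> [_ ex] [_ ex'].
rewrite {1}(frame_expand (frame_basis (sframe_local c) ex) (memvf v)) {1}/fcoord linear_sum.
by apply: eq_bigr => j _; rewrite linearZ /= mulrC.
Qed.

Section ChangeLaw.
Variables (c c' : scoord A) (V V' : lsfield M r).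
Variables (a2 a2' : 'I_r -> 'I_r -> 'I_r -> M -> R) (a1 a1' : 'I_r -> 'I_n -> M -> R).
Hypotheses (VF : degree1_form (sdom c) V a2 a1) (VF' : degree1_form (sdom c') V' a2' a1').
Variables (x : M) (cx : sdom c x) (cx' : sdom c' x).

(** Both sides have degree 1 in eta; their coefficients are compared. *)
Lemma sfx_change_law i :
  spullback c c' (sfx V' i) x
    = sfapply (schart c) V (fun y => gconst r (coordf (schart c') i y)) x <->
  forall g, \sum_b a1' b i x * stransition c c' x b g =
    \sum_j a1 g j x * pderiv (schart c) j (coordf (schart c') i) x.
Proof.
rewrite /spullback (form_sfx VF' i cx') gsubst_glin.
rewrite (@sfapply_gconst _ _ _ _ _ (schart_atlas c) V x (sdom_sub cx) _
  (fun j => form_sfx VF j cx) (coordf (schart c') i)).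
- by split=> [/glin_inj|E]; [exact|exact: eq_glin].
- exact: nearW.
- exact: snear_coordf (schart_atlas c') (sdom_sub cx').
Qed.

(** Both sides have degree 2 in eta. The equality of their antisymmetrized coefficients
    is the transformation law of structure functions, with its inhomogeneous terms
    coming from the derivatives of the transition matrix. *)
Lemma sfeta_change_law l :
  spullback c c' (sfeta V' l) x
    = sfapply (schart c) V (spullback c c' (fun=> geta R l)) x <->
  forall b g, \sum_i \sum_j a2' i j l x * (stransition c c' x i b * stransition c c' x j g) =
    \sum_j a1 b j x * pderiv (schart c) j (fun y => stransition c c' y l g) x
    - \sum_j a1 g j x * pderiv (schart c) j (fun y => stransition c c' y l b) x
    + \sum_m a2 b g m x * stransition c c' x l m.
Proof.
rewrite {1}/spullback (form_sfeta VF' l cx') gsubst_gbil.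
rewrite (@sfapply_glin _ _ _ _ _ (schart_atlas c) V x (sdom_sub cx) _ _
  (fun j => form_sfx VF j cx) (fun j => form_sfeta VF j cx)
  (fun b y => stransition c c' y l b)); first last.
- by move=> b; exact: stransition_snear.
- by apply: nearW => y; rewrite /spullback gsubst_eta.
have half (u : R) : 2^-1 * u + 2^-1 * u = u by field.
have E b g : \sum_i \sum_j 2^-1 * a2' i j l x * (stransition c c' x i b * stransition c c' x j g)
   - \sum_i \sum_j 2^-1 * a2' i j l x * (stransition c c' x i g * stransition c c' x j b)
   = \sum_i \sum_j a2' i j l x * (stransition c c' x i b * stransition c c' x j g).
  rewrite [X in _ - X]exchange_big -sumrB; apply: eq_bigr => i _ /=.
  rewrite -sumrB; apply: eq_bigr => j _; rewrite (form_anti VF' j i l cx') mulrN mulNr opprK.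
  by rewrite [X in _ + _ * X]mulrC -mulrDl half.
have E' b g : \sum_i a1 b i x * pderiv (schart c) i (fun y => stransition c c' y l g) x +
     \sum_m 2^-1 * a2 b g m x * stransition c c' x l m
   - (\sum_i a1 g i x * pderiv (schart c) i (fun y => stransition c c' y l b) x +
     \sum_m 2^-1 * a2 g b m x * stransition c c' x l m) =
    \sum_j a1 b j x * pderiv (schart c) j (fun y => stransition c c' y l g) x
    - \sum_j a1 g j x * pderiv (schart c) j (fun y => stransition c c' y l b) x
    + \sum_m a2 b g m x * stransition c c' x l m.
  rewrite opprD addrACA; congr (_ + _); rewrite -sumrB; apply: eq_bigr => m _.
  by rewrite (form_anti VF g b m cx) mulrN mulNr opprK -mulrDl half.
rewrite gbil_eq; split=> H b g; last by rewrite E E'.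
by have := H b g; rewrite E E'.
Qed.

End ChangeLaw.

Definition coef1 (W : sfield A) c b i x : R := sfx (sfloc W c) i x [set b]%SET.
Definition coef2 (W : sfield A) c b g l x : R := gderiv b (sfeta (sfloc W c) l x) [set g]%SET.

Lemma coef_form (W : sfield A) c : degree1 W ->
  degree1_form (sdom c) (sfloc W c) (coef2 W c) (coef1 W c).
Proof.
move=> /(_ c)[a2 [a1 VF]]; have [S2 S1 an H2 H1] := VF; split.
- move=> b g l; apply: smooth_on_ext (S2 b g l); first exact: sdom_open.
  by move=> x cx; rewrite (form_a2 VF).
- move=> b i; apply: smooth_on_ext (S1 b i); first exact: sdom_open.
  by move=> x cx; rewrite (form_a1 VF).
- by move=> b g l x cx; rewrite /coef2 -!(form_a2 VF) // an.
- move=> l x cx; rewrite H2 //; apply: eq_bigr => b _; apply: eq_bigr => g _.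
  by rewrite /coef2 -(form_a2 VF).
- by move=> i x cx; rewrite H1 //; apply: eq_bigr => b _; rewrite /coef1 -(form_a1 VF).
Qed.

Lemma exists_scoord_at x : exists c : scoord A, schart c = chart_at x /\ sdom c x.
Proof.
have [t Tt tx] := triv_cover A x.
exists (SCoord (chart_at_atlas x) (triv_local_frame Tt)); split=> //.
by split=> //; exact: chart_at_dom.
Qed.

Definition scoord_at x : scoord A := sval (cid (exists_scoord_at x)).

Lemma scoord_at_dom x : sdom (scoord_at x) x.
Proof. by rewrite /scoord_at; case: cid => c []. Qed.

End SuperFieldLaws.

Section AlgebroidOfField.
Variables (R : realType) (n : nat) (M : manifold R n) (r : nat) (A : vbundle M r).
Variables (W : sfield A) (hW : homological W).
Implicit Types (x y : M) (c : scoord A) (s t u : section A).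

Let dW := proj1 hW.
Let form c := coef_form c dW.
Local Notation a1 := (coef1 W).
Local Notation a2 := (coef2 W).

(** The anchor is computed in one system of coordinates at each point; [anchorW_comp]
    shows that all of them give the same vector. *)
Definition anchor_fun x (v : A x) : 'rV[R]_n :=
  \sum_b fcoord (sframe (scoord_at A x)) b v
     *: tvec (schart (scoord_at A x)) x (\row_i a1 (scoord_at A x) b i x).

Lemma anchor_fun_linear x : linear (@anchor_fun x).
Proof.
move=> a v w; rewrite /anchor_fun scaler_sumr -big_split; apply: eq_bigr => b _ /=.
by rewrite /fcoord linearP scalerDl scalerA.
Qed.

HB.instance Definition _ x := GRing.isLinear.Build R (A x) 'rV[R]_n _ (@anchor_fun x)
  (@anchor_fun_linear x).

Definition anchorW x : 'Hom(A x, 'rV[R]_n) := linfun (@anchor_fun x).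

Definition frame_field c b x f := \sum_j a1 c b j x * pderiv (schart c) j f x.

Lemma coef1_change c c' x i g : sdom c x -> sdom c' x ->
  \sum_b a1 c' b i x * stransition c c' x b g =
  frame_field c g x (coordf (schart c') i).
Proof.
move=> cx cx'; move: g; apply/(sfx_change_law (form c) (form c') cx cx').
exact: sfx_change.
Qed.

Lemma coef2_change c c' x l b g : sdom c x -> sdom c' x ->
  \sum_i \sum_j a2 c' i j l x * (stransition c c' x i b * stransition c c' x j g) =
  frame_field c b x (fun y => stransition c c' y l g)
  - frame_field c g x (fun y => stransition c c' y l b)
  + \sum_m a2 c b g m x * stransition c c' x l m.
Proof.
move=> cx cx'; move: b g; apply/(sfeta_change_law (form c) (form c') cx cx').
exact: sfeta_change.
Qed.

Lemma anchorW_comp c x (v : A x) i : sdom c x ->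
  tcomp (schart c) x (anchorW x v) i = \sum_b fcoord (sframe c) b v * a1 c b i x.
Proof.
move=> cx; have cx0 := scoord_at_dom A x; set c0 := scoord_at A x in cx0 *.
have A0 := schart_atlas c0; have Ac := schart_atlas c.
have Sc := snear_coordf i Ac (sdom_sub cx).
rewrite lfunE /= /anchor_fun -/c0 /tcomp tderiv_suml //.
transitivity (\sum_b0 \sum_b fcoord (sframe c0) b0 v * (a1 c b i x * stransition c0 c x b b0)).
  apply: eq_bigr => b0 _; rewrite tderivZl // -mulr_sumr; congr (_ * _).
  rewrite (coef1_change _ _ cx0 cx) (tderivE _ A0 (sdom_sub cx0) Sc); apply: eq_bigr => j _.
  by rewrite tcomp_tvec ?mxE //; exact: sdom_sub cx0.
rewrite exchange_big; apply: eq_bigr => b _; rewrite (fcoord_transition v b cx0 cx) mulr_suml.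
by apply: eq_bigr => b0 _; ring.
Qed.

Lemma tderiv_anchorW c x (v : A x) f : sdom c x -> snear x f ->
  tderiv x (anchorW x v) f = \sum_b fcoord (sframe c) b v * frame_field c b x f.
Proof.
move=> cx Sf; rewrite (tderivE _ (schart_atlas c) (sdom_sub cx) Sf).
under eq_bigr => j _ do rewrite (anchorW_comp _ _ cx) mulr_suml.
rewrite exchange_big; apply: eq_bigr => b _; rewrite mulr_sumr; apply: eq_bigr => j _.
by rewrite mulrA.
Qed.

Definition qform c (p q : 'I_r -> R) l x := \sum_b \sum_g p b * q g * a2 c b g l x.

(** The components of [s, t] when the members of the frame have anchors a1 and structure
    functions - a2. *)
Definition bracket_comp c s t l x :=
  tderiv x (anchorW x (s x)) (fun y => fcoord (sframe c) l (t y))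
  - tderiv x (anchorW x (t x)) (fun y => fcoord (sframe c) l (s y))
  - qform c (fun b => fcoord (sframe c) b (s x)) (fun g => fcoord (sframe c) g (t x)) l x.

Lemma fcoord_section_snear c s l x : sdom c x -> snear x (fun y => fcoord (sframe c) l (s y)).
Proof.
move=> [_ ex]; apply: fcoord_snear ex _; first exact: sframe_local.
exact: section_secnear.
Qed.

Lemma coef1_snear c b i x : sdom c x -> snear x (a1 c b i).
Proof. by move=> cx; case: (form c) => _ S _ _ _; exact: snear_on (sdom_open c) cx (S b i). Qed.

Lemma coef2_snear c b g l x : sdom c x -> snear x (a2 c b g l).
Proof. by move=> cx; case: (form c) => S _ _ _ _; exact: snear_on (sdom_open c) cx (S b g l). Qed.

Lemma sdom_near c x : sdom c x -> \forall y \near x, sdom c y.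
Proof. by move=> cx; apply: open_nbhs_nbhs; split=> //; exact: sdom_open. Qed.

(** The derivatives of the transition matrix that the two derivatives of components
    produce are cancelled by the inhomogeneous terms in the transformation law of a2. *)
Lemma bracket_comp_change c c' s t l x : sdom c x -> sdom c' x ->
  bracket_comp c' s t l x = \sum_m stransition c c' x l m * bracket_comp c s t m x.
Proof.
move=> cx cx'.
pose T := stransition c c' x l.
pose e := sframe c; pose sc (w : section A) b := fcoord e b (w x).
pose D (w : section A) f := tderiv x (anchorW x (w x)) f.
have ST m := stransition_snear l m cx cx'.
have DE (w w' : section A) : D w (fun y => fcoord (sframe c') l (w' y)) =
    \sum_m T m * D w (fun y => fcoord e m (w' y)) +
    \sum_m \sum_b sc w' m * sc w b * frame_field c b x (fun y => stransition c c' y l m).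
  rewrite /D (tderiv_ext _ (g := fun y => \sum_m stransition c c' y l m * fcoord e m (w' y))); last first.
    by apply: filterS2 (sdom_near cx) (sdom_near cx') => y cy cy'; exact: fcoord_transition.
  have Sw m := fcoord_section_snear w' m cx.
  rewrite tderiv_sum => [|m _]; last exact: snearM (ST m) (Sw m).
  rewrite -big_split; apply: eq_bigr => m _ /=; rewrite (tderivM _ (ST m) (Sw m)); congr (_ + _).
  by rewrite (tderiv_anchorW _ cx (ST m)) mulr_sumr; apply: eq_bigr => b _; rewrite mulrA.
have QE : qform c' (fun b => fcoord (sframe c') b (s x)) (fun g => fcoord (sframe c') g (t x)) l x =
  \sum_b \sum_g sc s b * sc t g * (\sum_i \sum_j a2 c' i j l x
    * (stransition c c' x i b * stransition c c' x j g)).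
  rewrite /qform.
  transitivity (\sum_i \sum_j \sum_b \sum_g sc s b * sc t g * (a2 c' i j l x
    * (stransition c c' x i b * stransition c c' x j g))).
    apply: eq_bigr => i _; apply: eq_bigr => j _.
    rewrite (fcoord_transition (s x) i cx cx') (fcoord_transition (t x) j cx cx').
    rewrite !mulr_suml; apply: eq_bigr => b _; rewrite mulr_sumr mulr_suml; apply: eq_bigr => g _.
    by rewrite /sc /e; ring.
  under eq_bigr => i _ do rewrite exchange_big /=; rewrite exchange_big /=; apply: eq_bigr => b _.
  under eq_bigr => i _ do rewrite exchange_big /=; rewrite exchange_big /=; apply: eq_bigr => g _.
  by rewrite mulr_sumr; apply: eq_bigr => i _; rewrite mulr_sumr.
rewrite {1}/bracket_comp -!/(D _ _) !DE QE.
under [X in _ - X]eq_bigr => b _ do under eq_bigr => g _ do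
  rewrite (coef2_change _ _ _ cx cx') mulrDr mulrBr.
under [X in _ - X]eq_bigr => b _ do rewrite big_split sumrB /=.
rewrite big_split sumrB /=.
set S1 := \sum_m T m * _; set S2 := \sum_m \sum_b _; set S3 := \sum_m T m * _.
set S4 := \sum_m \sum_b _; set S5 := \sum_b \sum_g _; set S6 := \sum_b \sum_g _.

have E25 : S2 = S5.
  rewrite /S2 exchange_big; apply: eq_bigr => b _; apply: eq_bigr => g _.
  by rewrite [sc t g * _]mulrC.
have E7 : S6 = \sum_m T m * qform c (sc s) (sc t) m x.
  rewrite /S6 /qform; under [RHS]eq_bigr => m _ do rewrite mulr_sumr.
  rewrite [RHS]exchange_big; apply: eq_bigr => b _.
  under [RHS]eq_bigr => m _ do rewrite mulr_sumr.
  rewrite [RHS]exchange_big; apply: eq_bigr => g _; rewrite mulr_sumr; apply: eq_bigr => m _.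
  by rewrite /T; ring.
have -> : \sum_m stransition c c' x l m * bracket_comp c s t m x =
   S1 - S3 - \sum_m T m * qform c (sc s) (sc t) m x.
  rewrite /S1 /S3 -!sumrB; apply: eq_bigr => m _; rewrite -!mulrBr //.
by rewrite -E7 E25; ring.
Qed.

Definition bracket_fun s t x : A x :=
  \sum_l bracket_comp (scoord_at A x) s t l x *: fsec (sframe (scoord_at A x)) l x.

Lemma fcoord_bracket_fun c s t l x : sdom c x ->
  fcoord (sframe c) l (bracket_fun s t x) = bracket_comp c s t l x.
Proof.
move=> cx; have cx0 := scoord_at_dom A x; rewrite (bracket_comp_change s t l cx0 cx).
rewrite (fcoord_transition _ l cx0 cx); apply: eq_bigr => m _; congr (_ * _).
apply: (fcoord_sum _ _ (frame_basis (sframe_local _) _)).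
by case: cx0.
Qed.

Lemma anchorW_snear c s i x : sdom c x ->
  snear x (fun y => tcomp (schart c) y (anchorW y (s y)) i).
Proof.
move=> cx.
apply: (@snear_ext _ _ _ _ (fun y => \sum_b fcoord (sframe c) b (s y) * a1 c b i y)).
  by apply: filterS (sdom_near cx) => y cy; rewrite anchorW_comp.
apply: snear_sum => b _; apply: snearM; first exact: fcoord_section_snear.
exact: coef1_snear.
Qed.

Lemma tderiv_anchorW_snear c s f x : sdom c x -> snear x f ->
  snear x (fun y => tderiv y (anchorW y (s y)) f).
Proof.
move=> cx Sf; apply: (snear_tderiv (schart_atlas c) (sdom_sub cx)) => // i.
exact: anchorW_snear.
Qed.

Lemma bracket_comp_snear c s t l x : sdom c x -> snear x (bracket_comp c s t l).
Proof.
move=> cx; apply: snearB; first apply: snearB.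
- by apply: (tderiv_anchorW_snear s cx); exact: fcoord_section_snear.
- by apply: (tderiv_anchorW_snear t cx); exact: fcoord_section_snear.
- apply: snear_sum => b _; apply: snear_sum => g _; apply: snearM.
    by apply: snearM; exact: fcoord_section_snear.
  exact: coef2_snear.
Qed.

Lemma bracket_fun_smooth s t : smooth_section_on setT (bracket_fun s t).
Proof.
apply: smooth_section_of => x _; have cx := scoord_at_dom A x; set c := scoord_at A x in cx.
apply: (secnear_of_frame (sframe_local c)); first by case: cx.
move=> l; apply: snear_ext (bracket_comp_snear s t l cx).
by apply: filterS (sdom_near cx) => y cy; rewrite fcoord_bracket_fun.
Qed.

Definition bracketW s t : section A := MkSection (bracket_fun_smooth s t).

Lemma fcoord_bracketW c s t l x : sdom c x ->
  fcoord (sframe c) l (bracketW s t x) = bracket_comp c s t l x.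
Proof. exact: fcoord_bracket_fun. Qed.

Lemma scoord_inj x (v w : A x) :
  (forall c l, sdom c x -> fcoord (sframe c) l v = fcoord (sframe c) l w) ->
  v = w.
Proof.
move=> H; have cx := scoord_at_dom A x.
apply: (frame_inj (sframe_local (scoord_at A x))); first by case: cx.
by move=> l; exact: H.
Qed.

Lemma qformDl c p p' q l x :
  qform c (fun b => p b + p' b) q l x = qform c p q l x + qform c p' q l x.
Proof.
rewrite /qform -big_split; apply: eq_bigr => b _; rewrite -big_split; apply: eq_bigr => g _ /=.
by rewrite !mulrDl.
Qed.

Lemma qform_anti c p q l x : sdom c x -> qform c p q l x = - qform c q p l x.
Proof.
move=> cx; rewrite /qform -sumrN exchange_big; apply: eq_bigr => b _; rewrite -sumrN.
apply: eq_bigr => g _; rewrite (form_anti (form c) _ _ _ cx); ring.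
Qed.

Lemma qformZr c p q (a : R) l x : qform c p (fun g => a * q g) l x = a * qform c p q l x.
Proof.
rewrite /qform mulr_sumr; apply: eq_bigr => b _; rewrite mulr_sumr; apply: eq_bigr => g _.
by ring.
Qed.

Lemma bracketWDl s s' t x : bracketW (sectionD s s') t x = bracketW s t x + bracketW s' t x.
Proof.
apply: scoord_inj => c l cx; rewrite [RHS]/fcoord linearD /= -!/(fcoord _ _ _) !fcoord_bracketW //.
rewrite /bracket_comp /= linearD tderivDl; last exact: fcoord_section_snear.
have -> : (fun y => fcoord (sframe c) l (s y + s' y)) =
  (fun y => fcoord (sframe c) l (s y) + fcoord (sframe c) l (s' y)).
  by apply/funext => y; rewrite /fcoord linearD.
rewrite tderivD; [|exact: fcoord_section_snear|exact: fcoord_section_snear].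
have -> : (fun b => fcoord (sframe c) b (s x + s' x)) =
  (fun b => fcoord (sframe c) b (s x) + fcoord (sframe c) b (s' x)).
  by apply/funext => b; rewrite /fcoord linearD.
by rewrite qformDl; ring.
Qed.

Lemma bracketW_anti s t x : bracketW s t x = - bracketW t s x.
Proof.
apply: scoord_inj => c l cx; rewrite [RHS]/fcoord linearN /= -!/(fcoord _ _ _) !fcoord_bracketW //.
by rewrite /bracket_comp [in LHS]qform_anti //; ring.
Qed.

Lemma bracketW_leibniz s t (f : cfun M) x :
  bracketW s (sectionZ f t) x
  = f x *: bracketW s t x + tderiv x (anchorW x (s x)) f *: t x.
Proof.
apply: scoord_inj => c l cx; rewrite [RHS]/fcoord linearD !linearZ /= -!/(fcoord _ _ _) !fcoord_bracketW //.
have Sf := cfun_snear f x; have St := fcoord_section_snear t l cx.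
rewrite /bracket_comp /= linearZ tderivZl; last exact: fcoord_section_snear.
have -> : (fun y => fcoord (sframe c) l (f y *: t y)) = (fun y => f y * fcoord (sframe c) l (t y)).
  by apply/funext => y; rewrite /fcoord linearZ.
rewrite tderivM //.
have -> : (fun b => fcoord (sframe c) b (f x *: t x)) = (fun b => f x * fcoord (sframe c) b (t x)).
  by apply/funext => b; rewrite /fcoord linearZ.
rewrite qformZr; ring.
Qed.

Lemma anchorW_smooth s ch : atlas ch -> forall i,
  smooth_on (cdom ch) (fun x => tcomp ch x (anchorW x (s x)) i).
Proof.
move=> Ac i; apply: smooth_on_local => x cx.
have [t Tt tx] := triv_cover A x.
exact: (@anchorW_snear (SCoord Ac (triv_local_frame Tt)) s i x (conj cx tx)).
Qed.

Lemma homological_coefs c x : sdom c x ->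
  anchor_eq (schart c) (a2 c) (a1 c) x /\ jacobi_eq (schart c) (a2 c) (a1 c) x.
Proof.
move=> cx; apply: (proj1 (homological_eqs (schart_atlas c) (sdom_open c)
  (@sdom_sub _ _ _ _ _ c) (form c)) (proj2 hW c) _ cx).
Qed.

(** The terms where the components of t and s are differentiated match by the Leibniz
    rule; the other ones are a combination of the equations [anchor_eq]. *)
Lemma anchorW_bracket s t ch x : atlas ch -> cdom ch x -> forall i,
  tcomp ch x (anchorW x (bracketW s t x)) i
  = lie_bracket_comp ch (fun y => anchorW y (s y)) (fun y => anchorW y (t y)) i x.
Proof.
move=> Ac chx i; have [tr Tt tx] := triv_cover A x.
pose c := SCoord Ac (triv_local_frame Tt); have cx : sdom c x by split.
have [MC _] := homological_coefs cx.
rewrite (anchorW_comp _ i cx : tcomp ch x _ i = _).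
under eq_bigr => l _ do rewrite fcoord_bracketW //.
pose sc (w : section A) b := fcoord (sframe c) b (w x).
pose D (w : section A) f := tderiv x (anchorW x (w x)) f.
have S1 b := coef1_snear b i cx.
pose RH (w w' : section A) :=
  \sum_b a1 c b i x * D w (fun y => fcoord (sframe c) b (w' y)) +
  \sum_b \sum_g sc w b * sc w' g * frame_field c b x (a1 c g i).
have DE (w w' : section A) :
  \sum_j tcomp ch x (anchorW x (w x)) j * pderiv ch j (fun y => tcomp ch y (anchorW y (w' y)) i) x
  = RH w w'.
  rewrite -(tderivE _ Ac chx); last exact: (anchorW_snear w' i cx).
  rewrite (tderiv_ext _ (g := fun y => \sum_b a1 c b i y * fcoord (sframe c) b (w' y))); last first.
    apply: filterS (sdom_near cx) => y cy; rewrite (anchorW_comp _ i cy : tcomp ch y _ i = _).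
    by apply: eq_bigr => b _; rewrite mulrC.
  have Sw b := fcoord_section_snear w' b cx.
  rewrite tderiv_sum => [|b _]; last exact: snearM (S1 b) (Sw b).
  under eq_bigr => b _ do rewrite (tderivM _ (S1 b) (Sw b)).
  rewrite big_split /=; congr (_ + _); rewrite [RHS]exchange_big; apply: eq_bigr => g _ /=.
  rewrite (tderiv_anchorW _ cx (S1 g)) mulr_sumr; apply: eq_bigr => b _.
  by rewrite mulrA [X in X * _]mulrC.
have -> : lie_bracket_comp ch (fun y => anchorW y (s y)) (fun y => anchorW y (t y)) i x =
    RH s t - RH t s.
  by rewrite /lie_bracket_comp sumrB; exact: (congr2 (fun a b => a - b) (DE s t) (DE t s)).
rewrite /RH.
under eq_bigr => l _ do rewrite mulrC !mulrBr.
rewrite !sumrB -!/(D _ _).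
pose U4 := \sum_b \sum_g sc s b * sc t g * frame_field c b x (a1 c g i).
pose U5 := \sum_b \sum_g sc t b * sc s g * frame_field c b x (a1 c g i).
pose U3 := \sum_m a1 c m i x * qform c (sc s) (sc t) m x.
rewrite -/U3 -/U4 -/U5.
(* All derivatives of components have been matched; the remaining sums have no
    derivative of s or t. *)
suff -> : U3 = U5 - U4.
  have sw (a b d f : R) : a - b - (d - f) = a + f - (b + d) by ring.
  exact: sw.
rewrite /U3 /U5 /U4 exchange_big -sumrB /=.
under eq_bigr => l _ do rewrite /qform mulr_sumr.
rewrite exchange_big /=; apply: eq_bigr => b _.
under eq_bigr => l _ do rewrite mulr_sumr.
rewrite exchange_big -sumrB /=; apply: eq_bigr => g _.
have /eqP := MC b g i; rewrite sumrB addr_eq0 => /eqP E.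
have E' : frame_field c g x (a1 c b i) - frame_field c b x (a1 c g i) =
    \sum_l a2 c b g l x * a1 c l i x by rewrite -opprB; apply/eqP; rewrite eqr_oppLR; apply/eqP.
rewrite [sc t g * sc s b]mulrC -mulrBr E' mulr_sumr.
by apply: eq_bigr => l _; rewrite [LHS]mulrC [RHS]mulrA.
Qed.

Definition triple (p q w : 'I_r -> R) (P : 'I_r -> 'I_r -> 'I_r -> R) :=
  \sum_d \sum_b \sum_g p d * q b * w g * P d b g.

Lemma triple_cycle p q w P : triple q w p P = triple p q w (fun d b g => P b g d).
Proof.
rewrite /triple; under eq_bigr => d _ do rewrite exchange_big /=.
rewrite exchange_big /=; apply: eq_bigr => d _; apply: eq_bigr => b _; apply: eq_bigr => g _.
by ring.
Qed.

Lemma tripleD p q w P P' :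
  triple p q w P + triple p q w P' = triple p q w (fun d b g => P d b g + P' d b g).
Proof.
rewrite /triple -big_split; apply: eq_bigr => d _; rewrite -big_split; apply: eq_bigr => b _ /=.
by rewrite -big_split; apply: eq_bigr => g _ /=; rewrite mulrDr.
Qed.

Definition along x (w : section A) f := tderiv x (anchorW x (w x)) f.
Definition comp_at c x (w : section A) b := fcoord (sframe c) b (w x).
Definition along_comp c x (w w' : section A) b := along x w (fun y => fcoord (sframe c) b (w' y)).
Definition along2 c x l (w w' w'' : section A) :=
  along x w (fun y => along y w' (fun z => fcoord (sframe c) l (w'' z))).

(** The derivative along the anchor of s of the value of the form with coefficients a2
    on t and u, expanded by the Leibniz rule. *)
Definition qform_deriv c x l (s t u : section A) :=
  qform c (along_comp c x s t) (comp_at c x u) l x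
  + qform c (comp_at c x t) (along_comp c x s u) l x
  + triple (comp_at c x s) (comp_at c x t) (comp_at c x u)
      (fun d b g => frame_field c d x (a2 c b g l)).

Lemma along_qform c x l (s t u : section A) : sdom c x ->
  along x s (fun y => qform c (fun b => fcoord (sframe c) b (t y))
    (fun g => fcoord (sframe c) g (u y)) l y) =
  qform_deriv c x l s t u.
Proof.
move=> cx; have St b := fcoord_section_snear t b cx; have Su b := fcoord_section_snear u b cx.
have S2 b g := coef2_snear b g l cx.
have Stu b g := snearM (St b) (Su g).
have St2 b g := snearM (Stu b g) (S2 b g).
rewrite /qform_deriv /triple exchange_big /along /qform tderiv_sum => [|b _]; last by apply: snear_sum => g _; exact: St2.
rewrite /qform -!big_split; apply: eq_bigr => b _ /=.
rewrite exchange_big tderiv_sum /= => [|g _]; last exact: St2.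
rewrite -!big_split; apply: eq_bigr => g _ /=.
rewrite (tderivM _ (Stu b g) (S2 b g)) (tderivM _ (St b) (Su g)) (tderiv_anchorW _ cx (S2 b g)).
rewrite [X in X + _]mulr_sumr -/(along _ _ _).
have -> : \sum_i fcoord (sframe c) b (t x) * fcoord (sframe c) g (u x) *
   (fcoord (sframe c) i (s x) * frame_field c i x (a2 c b g l)) =
  \sum_i comp_at c x s i * comp_at c x t b * comp_at c x u g * frame_field c i x (a2 c b g l).
  by apply: eq_bigr => d _; rewrite /comp_at; ring.
by rewrite addrC /along_comp /along /comp_at; congr (_ + _); ring.
Qed.

(** The expansion separates three kinds of terms: second derivatives of the components
    of the sections, first derivatives multiplied by a2, and terms without derivatives
    of the components. Under cyclic summation the first two kinds cancel by
    antisymmetry, and the third is [jacobi_eq]. *)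
Lemma fcoord_double_bracket c x l (s t u : section A) : sdom c x ->
  fcoord (sframe c) l (bracketW s (bracketW t u) x) =
  along2 c x l s t u - along2 c x l s u t - qform_deriv c x l s t u
  - (along2 c x l t u s - along2 c x l u t s)
  - (qform c (comp_at c x s) (along_comp c x t u) l x
   - qform c (comp_at c x s) (along_comp c x u t) l x
   - triple (comp_at c x s) (comp_at c x t) (comp_at c x u)
       (fun d b g => \sum_m a2 c b g m x * a2 c d m l x)).
Proof.
move=> cx; have Sf (w : section A) b := fcoord_section_snear w b cx.
have S1 (w w' : section A) b := tderiv_anchorW_snear w cx (Sf w' b).
have SQ : snear x (fun y => qform c (fun b => fcoord (sframe c) b (t y))
    (fun g => fcoord (sframe c) g (u y)) l y).
  apply: snear_sum => b _; apply: snear_sum => g _; apply: snearM (snearM (Sf t b) (Sf u g)) _.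
  exact: coef2_snear.
have P1 : along x s (fun y => fcoord (sframe c) l (bracketW t u y)) =
  along2 c x l s t u - along2 c x l s u t - qform_deriv c x l s t u.
  rewrite /along (tderiv_ext _ (g := bracket_comp c t u l)); last first.
    by apply: filterS (sdom_near cx) => y cy; rewrite fcoord_bracketW.
  rewrite /bracket_comp (tderivB _ (snearB (S1 t u l) (S1 u t l)) SQ) (tderivB _ (S1 t u l) (S1 u t l)).
  by congr (_ - _); exact: along_qform.
have P2 : tderiv x (anchorW x (bracketW t u x)) (fun y => fcoord (sframe c) l (s y)) =
  along2 c x l t u s - along2 c x l u t s.
  apply: (tderiv_lie_bracket (schart_atlas c) (sdom_sub cx)) (Sf s l) _.
  - by move=> i; exact: anchorW_snear.
  - by move=> i; exact: anchorW_snear.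
  - by move=> i; exact: anchorW_bracket (schart_atlas c) (sdom_sub cx) i.
have P3 : qform c (comp_at c x s) (fun g => fcoord (sframe c) g (bracketW t u x)) l x =
  qform c (comp_at c x s) (along_comp c x t u) l x
   - qform c (comp_at c x s) (along_comp c x u t) l x
   - triple (comp_at c x s) (comp_at c x t) (comp_at c x u)
       (fun d b g => \sum_m a2 c b g m x * a2 c d m l x).
  rewrite /qform /triple -!sumrB; apply: eq_bigr => d _.
  have -> : \sum_b \sum_g comp_at c x s d * comp_at c x t b * comp_at c x u g
      * (\sum_m a2 c b g m x * a2 c d m l x) =
    \sum_m \sum_b \sum_g comp_at c x s d * comp_at c x t b * comp_at c x u g
      * (a2 c b g m x * a2 c d m l x).
    rewrite [RHS]exchange_big; apply: eq_bigr => b _; rewrite [RHS]exchange_big; apply: eq_bigr => g _.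
    by rewrite mulr_sumr.
  rewrite -!sumrB; apply: eq_bigr => m _; rewrite fcoord_bracketW // /bracket_comp.
  rewrite mulrBr mulrBl; congr (_ - _); first by rewrite mulrBr mulrBl.
  rewrite /qform mulr_sumr mulr_suml; apply: eq_bigr => b _.
  rewrite mulr_sumr mulr_suml; apply: eq_bigr => g _; rewrite /comp_at; ring.
rewrite fcoord_bracketW //.
exact: (congr2 (fun a b => a - b) (congr2 (fun a b => a - b) P1 P2) P3).
Qed.

Lemma triple0 p q w : triple p q w (fun _ _ _ => 0) = 0.
Proof. by apply: big1 => d _; apply: big1 => b _; apply: big1 => g _; rewrite mulr0. Qed.

Lemma tripleN p q w P : - triple p q w P = triple p q w (fun d b g => - P d b g).
Proof.
rewrite /triple -sumrN; apply: eq_bigr => d _; rewrite -sumrN; apply: eq_bigr => b _.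
by rewrite -sumrN; apply: eq_bigr => g _; rewrite mulrN.
Qed.

Lemma bracketW_jacobi s t u x :
  bracketW s (bracketW t u) x + bracketW t (bracketW u s) x + bracketW u (bracketW s t) x = 0.
Proof.
apply: scoord_inj => c l cx; rewrite [RHS]/fcoord linear0 {1}/fcoord !linearD /= -!/(fcoord _ _ _).
rewrite (fcoord_double_bracket l s t u cx) (fcoord_double_bracket l t u s cx)
  (fcoord_double_bracket l u s t cx) /qform_deriv.
pose P d b g := frame_field c d x (a2 c b g l).
pose K d b g := \sum_m a2 c b g m x * a2 c d m l x.
pose S := comp_at c x s; pose T := comp_at c x t; pose U := comp_at c x u.
have E0 : triple S T U P + triple T U S P + triple U S T P
    - (triple S T U K + triple T U S K + triple U S T K) = 0.
  rewrite (triple_cycle S T U) (triple_cycle T U S) (triple_cycle S T U).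
  rewrite (triple_cycle S T U K) (triple_cycle T U S K) (triple_cycle S T U).
  rewrite !tripleD tripleN tripleD -(triple0 S T U); congr (triple _ _ _ _).
  apply/funext => d; apply/funext => b; apply/funext => g.
  have [_ J] := homological_coefs cx; have := J d b g l; rewrite /jacobi_term.
  have KE d' b' g' : K d' b' g' = - \sum_e a2 c b' g' e x * a2 c e d' l x.
    rewrite /K -sumrN; apply: eq_bigr => m _.
    by rewrite (form_anti (form c) d' m l cx) mulrN.
  rewrite !KE -!/(frame_field c _ x _) -!/(P _ _ _).
  set k1 := \sum_e _; set k2 := \sum_e _; set k3 := \sum_e _.
  by move: (P d b g) (P b g d) (P g d b) k1 k2 k3 => p1 p2 p3 k1 k2 k3 <-; ring.
rewrite (qform_anti (along_comp c x s t) U l cx) (qform_anti (along_comp c x t u) S l cx)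
  (qform_anti (along_comp c x u s) T l cx).
move: E0; rewrite -/S -/T -/U -/P -/K.
move: (triple S T U P) (triple T U S P) (triple U S T P) (triple S T U K) (triple T U S K) (triple U S T K).
move: (along2 c x l s t u) (along2 c x l s u t) (along2 c x l t s u) (along2 c x l t u s)
  (along2 c x l u s t) (along2 c x l u t s).
move: (qform c U (along_comp c x s t) l x) (qform c T (along_comp c x s u) l x)
  (qform c S (along_comp c x t u) l x) (qform c S (along_comp c x u t) l x)
  (qform c U (along_comp c x t s) l x) (qform c T (along_comp c x u s) l x).
move=> b1 b2 b3 b4 b5 b6 d1 d2 d3 d4 d5 d6 p1 p2 p3 k1 k2 k3 E0.
by rewrite -[RHS]oppr0 -[in RHS]E0; ring.
Qed.

Definition algebroidW : lie_algebroid A :=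
  LieAlgebroid anchorW_smooth bracketWDl bracketW_anti bracketW_jacobi bracketW_leibniz
    (fun s t ch x Ac chx i => anchorW_bracket s t Ac chx i).

Lemma algebroidW_differential : algebroid_differential algebroidW W.
Proof.
move=> c; exists (a2 c), (a1 c); split; first exact: form.
move=> x cx; have Le := sframe_local c; have [_ ex] := cx; have be := frame_basis Le ex.
split=> [b i|b g s t sb tg].
  rewrite (anchorW_comp _ i cx : tcomp _ _ (anchor algebroidW x _) _ = _).
  under eq_bigr => b' _ do rewrite (fcoord_fsec _ _ be).
  by rewrite sum_delta_mul.
apply: (frame_inj Le ex) => l; rewrite [RHS]/fcoord linearN /= -/(fcoord _ _ _).
rewrite (fcoord_sum _ _ be) (fcoord_bracketW s t l cx : fcoord _ _ (bracket algebroidW s t x) = _).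
have near_delta (w : section A) d m : (\forall y \near x, w y = fsec (sframe c) d y) ->
    \forall y \near x, fcoord (sframe c) m (w y) = (m == d)%:R.
  move=> wd; apply: filterS2 wd (frame_near Le ex) => y -> ey.
  by rewrite (fcoord_fsec _ _ (frame_basis Le ey)).
rewrite /bracket_comp (tderiv_near_cst _ (near_delta s b l sb)) (tderiv_near_cst _ (near_delta t g l tg)).
rewrite subrr sub0r /qform; congr (- _).
under eq_bigr => b' _ do under eq_bigr => g' _ do
  rewrite (nbhs_singleton (near_delta s b b' sb)) (nbhs_singleton (near_delta t g g' tg)) -mulrA.
under eq_bigr => b' _ do rewrite -mulr_sumr sum_delta_mul.
by rewrite sum_delta_mul.
Qed.

End AlgebroidOfField.

(** * The homological field of a Lie algebroid *)

Section FieldOfAlgebroid.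
Variables (R : realType) (n : nat) (M : manifold R n) (r : nat) (A : vbundle M r).
Variable L : lie_algebroid A.
Implicit Types (x y : M) (c : scoord A).

Definition diff_a1 c b i x := anchor_coef L (schart c) (sframe c) b i x.
Definition diff_a2 c b g l x := - structure_coef L (sframe c) b g l x.
Definition diff_loc c : lsfield M r := LSField
  (fun i x => glin (fun b => diff_a1 c b i x))
  (fun l x => gbil (fun b g => 2^-1 * diff_a2 c b g l x)).

Lemma diff_a1_snear c b i x : sdom c x -> snear x (diff_a1 c b i).
Proof. by move=> [cx ex]; apply: anchor_coef_snear cx _ ex; [exact: schart_atlas|exact: sframe_local]. Qed.

Lemma diff_a2_snear c b g l x : sdom c x -> snear x (diff_a2 c b g l).
Proof. by move=> [cx ex]; apply: snearN; apply: structure_coef_snear ex; exact: sframe_local. Qed.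

Lemma diff_form c : degree1_form (sdom c) (diff_loc c) (diff_a2 c) (diff_a1 c).
Proof.
split=> //.
- by move=> b g l; apply: smooth_on_local => x; exact: diff_a2_snear.
- by move=> b i; apply: smooth_on_local => x; exact: diff_a1_snear.
- by move=> b g l x _; rewrite /diff_a2 [in LHS]structure_coef_anti.
Qed.

Lemma diff_sfx_smooth c i I : smooth_on (sdom c) (fun x => sfx (diff_loc c) i x I).
Proof.
apply: smooth_on_local => x cx.
apply: (@snear_ext _ _ _ _ (fun y => \sum_b diff_a1 c b i y * geta R b I)).
  apply: nearW => y; rewrite /= [RHS]sum_ffunE; apply: eq_bigr => b _.
  by rewrite [RHS]ffunE.
by apply: snear_sum => b _; apply: snearM; [exact: diff_a1_snear|exact: snear_cst].
Qed.

Lemma diff_sfeta_smooth c l I : smooth_on (sdom c) (fun x => sfeta (diff_loc c) l x I).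
Proof.
apply: smooth_on_local => x cx.
apply: (@snear_ext _ _ _ _ (fun y =>
  \sum_b \sum_g (2^-1 * diff_a2 c b g l y) * gmul (geta R b) (geta R g) I)).
  apply: nearW => y; rewrite sum_ffunE; apply: eq_bigr => b _; rewrite sum_ffunE.
  by apply: eq_bigr => g _; rewrite [RHS]ffunE.
apply: snear_sum => b _; apply: snear_sum => g _; apply: snearM; last exact: snear_cst.
by apply: snearM; [exact: snear_cst|exact: diff_a2_snear].
Qed.

Lemma diff_sfx_change c c' i x : sdom c x -> sdom c' x ->
  spullback c c' (sfx (diff_loc c') i) x
    = sfapply (schart c) (diff_loc c) (fun y => gconst r (coordf (schart c') i y)) x.
Proof.
move=> cx cx'; apply/(sfx_change_law (diff_form c) (diff_form c') cx cx') => g.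
have Sc := snear_coordf i (schart_atlas c') (sdom_sub cx').
rewrite -(tderivE _ (schart_atlas c) (sdom_sub cx) Sc).
rewrite (tderiv_anchor_sum _ _ (sframe_local c') _ Sc); last by case: cx'.
by apply: eq_bigr => b _; rewrite mulrC.
Qed.

Lemma diff_sfeta_change c c' l x : sdom c x -> sdom c' x ->
  spullback c c' (sfeta (diff_loc c') l) x
    = sfapply (schart c) (diff_loc c) (spullback c c' (fun=> geta R l)) x.
Proof.
move=> cx cx'; apply/(sfeta_change_law (diff_form c) (diff_form c') cx cx') => b g.
have [_ ex] := cx; have [_ ex'] := cx'; have Le := sframe_local c; have Le' := sframe_local c'.
have [E EE] := exists_extends Le ex.
have Tn (d : 'I_r) : \forall y \near x, fcoord (sframe c') l (E d y) = stransition c c' y l d.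
  by apply: filterS (EE d) => y ->.
have TD b' d : \sum_j diff_a1 c b' j x * pderiv (schart c) j (fun y => stransition c c' y l d) x
    = tderiv x (anchor L x (E b' x)) (fun y => fcoord (sframe c') l (E d y)).
  rewrite (tderiv_ext _ (Tn d)) (nbhs_singleton (EE b')).
  by rewrite (tderivE _ (schart_atlas c) (sdom_sub cx) (stransition_snear l d cx cx')).
rewrite !TD.
have := fcoord_bracketE L (E b) (E g) l Le' ex'.
rewrite (fcoord_transition _ l cx cx').
under eq_bigr => m _ do rewrite -(structure_coefE L b g m Le ex EE).
move=> H; apply/eqP; rewrite -subr_eq0; apply/eqP.
move: H; set X := _ - _; set Y := \sum_b _ => /eqP; rewrite -subr_eq => /eqP XE.
rewrite -XE opprD opprB addrA.
have -> : \sum_m diff_a2 c b g m x * stransition c c' x l m =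
  - \sum_m stransition c c' x l m * structure_coef L (sframe c) b g m x.
  by rewrite -sumrN; apply: eq_bigr => m _; rewrite /diff_a2 mulNr mulrC.
have -> : \sum_i \sum_j diff_a2 c' i j l x * (stransition c c' x i b * stransition c c' x j g) = - Y.
  rewrite /Y -sumrN; apply: eq_bigr => i _; rewrite -sumrN; apply: eq_bigr => j _.
  by rewrite (nbhs_singleton (EE b)) (nbhs_singleton (EE g)) /diff_a2 /stransition; ring.
by rewrite opprK; ring.
Qed.

(** The components of the differential of L, glued by the transformation laws of the
    anchor and of the structure functions. *)
Definition field_of : sfield A :=
  SField diff_sfx_smooth diff_sfeta_smooth diff_sfx_change diff_sfeta_change.

Lemma field_of_homological : homological field_of.
Proof.
split=> c; first by exists (diff_a2 c), (diff_a1 c); exact: diff_form.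
apply/(homological_eqs (schart_atlas c) (sdom_open c) (@sdom_sub _ _ _ _ _ c) (diff_form c)).
move=> x [cx ex]; split.
  exact: (algebroid_anchor_eq L (schart_atlas c) (sframe_local c) cx ex).
exact: (algebroid_jacobi_eq L (schart_atlas c) (sframe_local c) cx ex).
Qed.

Lemma field_of_differential : algebroid_differential L field_of.
Proof.
move=> c; exists (diff_a2 c), (diff_a1 c); split; first exact: diff_form.
move=> x [cx ex]; split=> // b g s t sb tg; have Le := sframe_local c.
apply: (frame_inj Le ex) => l; rewrite [RHS]/fcoord linearN /= -/(fcoord _ _ _).
rewrite (fcoord_sum _ _ (frame_basis Le ex)) /diff_a2 opprK /structure_coef /structure_fun.
congr (fcoord _ _ _); apply: bracket_near.
  by apply: filterS2 sb (frame_extP Le ex b) => y -> ->.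
by apply: filterS2 tg (frame_extP Le ex g) => y -> ->.
Qed.

End FieldOfAlgebroid.

Section Extensionality.
Variables (R : realType) (n : nat) (M : manifold R n) (r : nat) (A : vbundle M r).

Lemma subbundle_eq k (B B' : subbundle A k) : (forall x, B x = B' x) -> B = B'.
Proof.
case: B B' => S loc [S' loc'] /= E.
have {}E : S = S' by apply: functional_extensionality_dep.
by subst S'; congr Subbundle; exact: Prop_irrelevance.
Qed.

Lemma differential_sfield_eq (L : lie_algebroid A) (W W' : sfield A) :
  algebroid_differential L W -> algebroid_differential L W' -> sfield_eq W' W.
Proof.
move=> dW dW' c x cx.
have [a2 [a1 [VF _]]] := dW c; have [a2' [a1' [VF' _]]] := dW' c.
split=> [i|l].
  rewrite (form_sfx VF i cx) (form_sfx VF' i cx); apply: eq_glin => b.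
  rewrite (form_a1 VF b i cx) (form_a1 VF' b i cx).
  by rewrite (differential_sfx dW _ _ cx) (differential_sfx dW' _ _ cx).
rewrite (form_sfeta VF l cx) (form_sfeta VF' l cx); apply: eq_gbil => b g.
congr (_ * _); rewrite (form_a2 VF b g l cx) (form_a2 VF' b g l cx).
by rewrite (differential_sfeta dW _ _ _ cx) (differential_sfeta dW' _ _ _ cx).
Qed.

Lemma lie_algebroid_eq (L L' : lie_algebroid A) :
  (forall x, anchor L x = anchor L' x) -> (forall s t, bracket L s t = bracket L' s t) -> L = L'.
Proof.
case: L L' => an br H1 H2 H3 H4 H5 H6 [an' br' H1' H2' H3' H4' H5' H6'] /= Ea Eb.
have {}Ea : an = an' by apply: functional_extensionality_dep.
have {}Eb : br = br' by apply/funext => s; apply/funext => t; exact: Eb.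
by subst an' br'; congr LieAlgebroid; exact: Prop_irrelevance.
Qed.

(** The differential contains the anchors and the brackets of the members of frames,
    which determine all anchors and all brackets. *)
Lemma differential_algebroid_eq (L L' : lie_algebroid A) (W : sfield A) :
  algebroid_differential L W -> algebroid_differential L' W -> L' = L.
Proof.
move=> dL dL'.
have EA x : anchor L' x = anchor L x.
  have cx := scoord_at_dom A x; set c := scoord_at A x in cx.
  have [cx' ex] := cx; have Le := sframe_local c; have be := frame_basis Le ex.
  apply/lfunP => v; rewrite (frame_expand be (memvf v)) !linear_sum; apply: eq_bigr => b _.
  rewrite !linearZ; congr (_ *: _); apply: (tcomp_inj (schart_atlas c) cx') => i.
  have [a2 [a1 [VF /(_ x cx)[H1 _]]]] := dL c.
  have [a2' [a1' [VF' /(_ x cx)[H1' _]]]] := dL' c.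
  by rewrite -H1 -H1' (form_a1 VF) // (form_a1 VF').
apply: lie_algebroid_eq => // s t; apply: section_eq => x.
have cx := scoord_at_dom A x; set c := scoord_at A x in cx.
have [cx' ex] := cx; have Le := sframe_local c.
apply: (frame_inj Le ex) => l; rewrite !fcoord_bracketE // !EA; congr (_ + _).
apply: eq_bigr => b _; apply: eq_bigr => g _; congr (_ * _); apply: oppr_inj.
have [a2 [a1 [VF /(_ x cx)[_ H2]]]] := dL c.
have [a2' [a1' [VF' /(_ x cx)[_ H2']]]] := dL' c.
have E2 : forall m, a2 b g m x = a2' b g m x by move=> m; rewrite (form_a2 VF) // (form_a2 VF').
rewrite /structure_coef /structure_fun (H2' b g _ _ (frame_extP Le ex b) (frame_extP Le ex g)).
rewrite (H2 b g _ _ (frame_extP Le ex b) (frame_extP Le ex g)); congr (- fcoord _ _ (- _)).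
by apply: eq_bigr => m _; rewrite E2.
Qed.

End Extensionality.

(** * Adapted frames *)

Section AdaptedFrames.
Variables (R : realType) (p q : nat) (M : manifold R (p + q)) (F : foliation M).
Variables (k s : nat) (A : vbundle M (k + s)).
Implicit Types (x y : M) (E : foliated_subbundle F (dual A) s).

Lemma foliated_subbundle_eq E E' : (forall x, E x = E' x) ->
  (forall z, foliated_bases E z <-> foliated_bases E' z) -> E' = E.
Proof.
case: E E' => S fb H1 H2 H3 H4 [S' fb' H1' H2' H3' H4'] /= ES Efb.
have {}ES : S = S' := @subbundle_eq _ _ _ _ (dual A) _ _ _ ES.
have {}Efb : fb = fb' by apply/seteqP; split=> z /Efb.
by subst S' fb'; congr FoliatedSubbundle; exact: Prop_irrelevance.
Qed.

Lemma annihilatorP E x (v : A x) :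
  v \in annihilator E x <-> forall xi : 'Hom(A x, R^o), xi \in E x -> xi v = 0.
Proof.
rewrite memvE; split=> [/subv_bigcapP H xi xiE|H].
  rewrite (coord_vbasis xiE) sum_lfunE big1 // => i _.
  have := H i isT; rewrite -memvE memv_ker => /eqP v0.
  by rewrite scale_lfunE v0 scaler0.
apply/subv_bigcapP => i _; rewrite -memvE memv_ker; apply/eqP; apply: H.
by apply: vbasis_mem; apply: mem_nth; rewrite size_tuple.
Qed.

Definition lframe_l (e : lframe A (k + s)) : lframe A k :=
  LFrame (fdom e) (fun h => fsec e (lshift s h)).

Definition dual_to (z : lframe (dual A) s) (e : lframe A (k + s)) x :=
  forall i j, (fsec z i x : 'Hom(A x, R^o)) (fsec e j x) = (rshift k i == j)%:R.

Section DualTo.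
Variables (z : lframe (dual A) s) (e : lframe A (k + s)) (x : M).
Hypotheses (be : basis_of fullv (ftup e x)) (ze : dual_to z e x).

Lemma dual_to_coord i (v : A x) :
  (fsec z i x : 'Hom(A x, R^o)) v = fcoord e (rshift k i) v.
Proof.
rewrite {1}(frame_expand be (memvf v)) linear_sum (bigD1 (rshift k i)) //=.
rewrite linearZ /= ze eqxx big1 => [|j ji]; first by rewrite addr0 [LHS]mulr1.
by rewrite linearZ /= ze eq_sym (negbTE ji) scaler0.
Qed.

Lemma lcoord0_expand (v : A x) : (forall j, fcoord e (rshift k j) v = 0) ->
  v = \sum_h fcoord e (lshift s h) v *: fsec e (lshift s h) x.
Proof.
move=> v0; rewrite {1}(frame_expand be (memvf v)) big_split_ord /= [X in _ + X]big1 ?addr0 //.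
by move=> j _; rewrite v0 scale0r.
Qed.

Lemma lframe_l_basis (B : {vspace A x}) :
  (forall v, v \in B <-> forall j, fcoord e (rshift k j) v = 0) ->
  basis_of B (ftup (lframe_l e) x).
Proof.
move=> BP.
have fl : free (ftup (lframe_l e) x).
  apply/(@freeP _ _ _ (ftup (lframe_l e) x)) => f f0 h.
  pose g (i : 'I_(k + s)) := if fintype.split i is inl h then f h else 0.
  have : \sum_i g i *: fsec e i x = 0.
    rewrite big_split_ord /= [X in _ + X]big1 ?addr0; last first.
      by move=> j _; rewrite /g (unsplitK (inr j)) scale0r.
    rewrite -[RHS]f0; apply: eq_bigr => h' _; rewrite /g (unsplitK (inl h')).
    by rewrite ftup_nth.
  move=> /(congr1 (fun v : A x => fcoord e (lshift s h) v)).
  by rewrite (fcoord_sum _ _ be) /fcoord linear0 /g (unsplitK (inl h)).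
apply/andP; split=> //; apply/eqP/vspaceP => v; apply/idP/idP => [|/BP v0].
  move=> /(coord_span (X := ftup (lframe_l e) x)) ->; apply: memv_suml => h _; apply: memvZ.
  by apply/BP => j; rewrite ftup_nth (fcoord_fsec _ _ be) eq_rlshift.
rewrite (lcoord0_expand v0); apply: memv_suml => h _; apply: memvZ; apply: memv_span.
by rewrite -[fsec e _ x]/(fsec (lframe_l e) h x) -ftup_nth; apply: mem_nth; rewrite size_tuple.
Qed.

Lemma dual_to_annihilator (S : {vspace dual A x}) (v : A x) : basis_of S (ftup z x) ->
  (forall xi : 'Hom(A x, R^o), xi \in S -> xi v = 0) <-> (forall j, fcoord e (rshift k j) v = 0).
Proof.
move=> bz; split=> [H j|v0 xi xiS].
  by rewrite -dual_to_coord; apply: H; exact: fsec_in bz.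
rewrite (frame_expand bz xiS) sum_lfunE big1 // => i _.
by rewrite scale_lfunE dual_to_coord v0 scaler0.
Qed.

(** The forms that vanish on the first k members of e are those spanned by z: this is
    the double annihilator theorem in a frame. *)
Lemma dual_to_expand (xi : 'Hom(A x, R^o)) : (forall h, xi (fsec e (lshift s h) x) = 0) ->
  xi = \sum_i xi (fsec e (rshift k i) x) *: fsec z i x.
Proof.
move=> xi0; apply/lfunP => v.
rewrite sum_lfunE {1}(frame_expand be (memvf v)) linear_sum big_split_ord /=.
rewrite big1 ?add0r => [|h _]; last by rewrite linearZ /= xi0 scaler0.
by apply: eq_bigr => j _; rewrite linearZ scale_lfunE dual_to_coord [LHS]mulrC.
Qed.

Lemma dual_to_biannihilator (S : {vspace dual A x}) (xi : 'Hom(A x, R^o)) : basis_of S (ftup z x) ->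
  (forall h, xi (fsec e (lshift s h) x) = 0) -> xi \in S.
Proof.
move=> bz /dual_to_expand ->.
by apply: memv_suml => i _; apply: memvZ; exact: fsec_in bz.
Qed.

End DualTo.

(** Foliated bases can be restricted because their set is maximal. *)
Lemma foliated_bases_restrict E z U : open U -> U `<=` fdom z ->
  foliated_bases E z -> foliated_bases E (LFrame U (fsec z)).
Proof.
move=> oU Uz fz; apply: foliated_bases_max.
  exact: local_basis_restrict oU Uz (foliated_bases_local fz).
move=> z' fz' i j; apply: foliated_on_sub (foliated_bases_transition fz fz' i j).
by move=> x [/Uz ? ?].
Qed.

(** A frame in which z is dual to the last s members: the first k members are then
    annihilated by z, hence form a basis of ann E^*. *)
Lemma exists_adapted_frame E z x (P : M -> Prop) : foliated_bases E z -> fdom z x ->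
  (\forall y \near x, P y) ->
  exists e : lframe A (k + s), [/\ adapted_frame E e, fdom e x, fdom e `<=` fdom z,
     forall y, fdom e y -> P y & forall y, fdom e y -> dual_to z e y].
Proof.
move=> fz zx nP; have [oz Sz bz] := foliated_bases_local fz.
have nz : \forall y \near x, fdom z y by apply: open_nbhs_nbhs.
have [|e [Le ex eP ze]] := dual_completion (fun i => secnear_on oz zx (Sz i)) _ (filterI nP nz).
  exact: basis_free (bz x zx).
have ez : fdom e `<=` fdom z by move=> y /eP[].
exists e; split=> //; last by move=> y /eP[].
have oe : open (fdom e) by case: Le.
split=> //.
  split=> // [h|y ey]; first by case: Le => _ + _; exact.
  apply: (lframe_l_basis (frame_basis Le ey)) => v; rewrite annihilatorP.
  exact (@dual_to_annihilator z e y (frame_basis Le ey) (ze y ey) (E y) v (bz y (ez y ey))).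
exists (LFrame (fdom e) (fsec z)); first by split=> //; exact: foliated_bases_restrict.
move=> y ey i j; rewrite /= ze // (inj_eq (@rshift_inj _ _)) //.
Qed.

Lemma exists_adapted E x : exists2 c : scoord A, adapted E c & sdom c x.
Proof.
have [z fz zx] := foliated_bases_cover E x.
have nT : \forall y \near x, True by apply: nearW.
have [e [ae ex _ _ _]] := exists_adapted_frame fz zx nT.
have [ch Fch chx] := fcharts_cover F x.
have Le : local_frame e by case: ae.
by exists (SCoord (fcharts_atlas Fch) Le); split.
Qed.

Lemma adapted_dual_to E e : adapted_frame E e -> exists z, [/\ foliated_bases E z, fdom z = fdom e &
  forall y, fdom e y -> dual_to z e y].
Proof.
move=> [Le [oe Se be] [z [fz dz] ze]]; exists z; split=> // y ey i j.
have [h ->|j' ->] := split_ordP j; last by rewrite ze // (inj_eq (@rshift_inj _ _)).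
rewrite eq_rlshift; have [_ _ bz] := foliated_bases_local fz.
have : fsec e (lshift s h) y \in annihilator E y by exact: fsec_in (be y ey).
move=> /annihilatorP; apply; apply: fsec_in; apply: bz; by rewrite dz.
Qed.

(** The double annihilator of B is B. *)
Lemma annihilator_eq E (B : subbundle A k) x :
  (forall xi : 'Hom(A x, R^o), xi \in E x <-> forall b, b \in B x -> xi b = 0) ->
  annihilator E x = B x.
Proof.
move=> EB; apply/vspaceP => v; apply/idP/idP => [/annihilatorP vE|vB].
  by apply: hom_separates => xi /EB; exact: vE.
by apply/annihilatorP => xi /EB; exact.
Qed.

Lemma adapted_annihilator E e x (v : A x) : adapted_frame E e -> fdom e x ->
  v \in annihilator E x <-> forall j, fcoord e (rshift k j) v = 0.
Proof.
move=> ae ex; have [z [fz dz ze]] := adapted_dual_to ae; have Le : local_frame e by case: ae.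
have [_ _ bz] := foliated_bases_local fz; rewrite annihilatorP.
apply (@dual_to_annihilator z e x (frame_basis Le ex) (ze x ex) (E x) v); apply: bz; by rewrite dz.
Qed.

End AdaptedFrames.

(** * From a couple to a foliated Lie algebroid *)

Section AlgebroidOfCouple.
Variables (R : realType) (p q : nat) (M : manifold R (p + q)) (F : foliation M).
Variables (k s : nat) (A : vbundle M (k + s)).
Variables (E : foliated_subbundle F (dual A) s) (W : sfield A).
Hypothesis SC : super_couple E W.
Implicit Types (x y : M) (c : scoord A).

Let hW : homological W. Proof. by case: SC. Qed.
Local Notation a1 := (coef1 W).
Local Notation a2 := (coef2 W).
Let L := algebroidW hW.

Lemma projectable_coef1 c x h a : adapted E c -> sdom c x -> a1 c (lshift s h) (lshift q a) x = 0.
Proof.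
move=> ac cx; have [_ pW _] := SC; have [/(_ a)[H _] _] := pW c ac.
by apply: (H _ h) => //; rewrite inE.
Qed.

Lemma projectable_coef2 c x h g j : adapted E c -> sdom c x ->
  a2 c (lshift s h) g (rshift k j) x = 0.
Proof.
move=> ac cx; have [_ pW _] := SC; have [_ /(_ j)[H _]] := pW c ac.
rewrite /coef2 gderivE; case: ifP => // _; rewrite (H _ h) ?mulr0 //.
exact: finset.setU11.
Qed.

Lemma qform_ann c x P Q j : adapted E c -> sdom c x -> (forall i, P (rshift k i) = 0) ->
  qform W c P Q (rshift k j) x = 0.
Proof.
move=> ac cx P0; rewrite /qform big1 // => b _; rewrite big1 // => g _.
have [h ->|i ->] := split_ordP b; first by rewrite projectable_coef2 // mulr0.
by rewrite P0 !mul0r.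
Qed.

Lemma ann_local x : exists2 e : lframe A k, local_basis (annihilator E) e & fdom e x.
Proof.
have [c [_ [_ lc _]] [_ ex]] := exists_adapted E x.
by exists (lframe_l (sframe c)).
Qed.

Definition annB : subbundle A k := Subbundle ann_local.

Lemma ann_coord c x (v : A x) : adapted E c -> sdom c x ->
  v \in annB x <-> forall j, fcoord (sframe c) (rshift k j) v = 0.
Proof. by move=> [_ ac] [_ ex]; exact: adapted_annihilator. Qed.

Lemma ann_section_near c x b j : adapted E c -> sdom c x -> section_of annB b ->
  \forall y \near x, fcoord (sframe c) (rshift k j) (b y) = 0.
Proof.
move=> ac cx bB; apply: filterS (sdom_near cx) => y cy.
by move: (bB y) => /(ann_coord _ ac cy); exact.
Qed.

(** For sections of ann E^*, the transverse components of the bracket reduce to the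
    terms a2_hh'^j, which vanish by projectability. *)
Lemma ann_subalgebroid : lie_subalgebroid L annB.
Proof.
move=> b b' bB b'B x; have [c ac cx] := exists_adapted E x.
apply/(ann_coord _ ac cx) => j.
rewrite (fcoord_bracketW hW b b' _ cx : fcoord _ _ (bracket L b b' x) = _) /bracket_comp.
rewrite (tderiv_near_cst _ (ann_section_near j ac cx bB)).
rewrite (tderiv_near_cst _ (ann_section_near j ac cx b'B)) qform_ann ?subrr //.
by move=> i; exact: nbhs_singleton (ann_section_near i ac cx bB).
Qed.

Lemma transitive_rank c x : adapted E c -> sdom c x ->
  \rank (\matrix_(h < k, u < q) a1 c (lshift s h) (rshift p u) x) = q.
Proof.
move=> ac cx; have [_ _ /(_ c ac)[_ _ _ [b2 [b1 [bF tF]]]]] := SC.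
rewrite -[RHS](tF x cx); congr (\rank _); apply/matrixP => h u; rewrite !mxE.
by rewrite (form_a1 bF) // /restr_field /= ffunE imset_set1.
Qed.

(** Projectability puts the anchors in TF; transitivity solves for the coefficients of a
    preimage. *)
Lemma ann_anchor x v : v \in (anchor L x @: annB x)%VS <-> leaf_tangent F x v.
Proof.
have [c ac cx] := exists_adapted E x; have [Fc _] := ac; have cx' := sdom_sub cx.
have be := frame_basis (sframe_local c) (proj2 cx).
split=> [/memv_imgP[b bB ->]|lv].
  apply: (leaf_tangent_chart Fc cx') => a.
  rewrite (anchorW_comp hW _ _ cx : tcomp _ _ (anchor L x b) _ = _) big1 // => d _.
  have [h ->|j ->] := split_ordP d; first by rewrite projectable_coef1 ?mulr0.
  by move/(ann_coord _ ac cx): bB => ->; rewrite mul0r.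
pose N := \matrix_(h < k, u < q) a1 c (lshift s h) (rshift p u) x.
pose w : 'rV[R]_q := \row_u tcomp (schart c) x v (rshift p u).
have /submxP[y wy] : (w <= N)%MS.
  by apply: submx_full; rewrite /row_full transitive_rank.
(* The row y solves for the components of a preimage in the basis of ann E^*. *)
pose b := \sum_h y ord0 h *: fsec (sframe c) (lshift s h) x.
have bc i : fcoord (sframe c) i b = if fintype.split i is inl h then y ord0 h else 0.
  have -> : b = \sum_i (if fintype.split i is inl h then y ord0 h else 0) *: fsec (sframe c) i x.
    rewrite big_split_ord /= [X in _ + X]big1 ?addr0.
      by apply: eq_bigr => h _; rewrite (unsplitK (inl h)).
    by move=> j _; rewrite (unsplitK (inr j)) scale0r.
  by rewrite (fcoord_sum _ _ be).
apply/memv_imgP; exists b.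
  by apply/(ann_coord _ ac cx) => j; rewrite bc (unsplitK (inr j)).
apply: (tcomp_inj (schart_atlas c) cx') => i.
rewrite (anchorW_comp hW _ _ cx : tcomp _ _ (anchor L x b) _ = _) big_split_ord /= [X in _ + X]big1.
  rewrite addr0; under eq_bigr => h _ do rewrite bc (unsplitK (inl h)).
  have [a ->|u ->] := split_ordP i.
    rewrite lv // big1 // => h _; by rewrite projectable_coef1 ?mulr0.
  have := congr1 (fun z : 'rV_q => z ord0 u) wy; rewrite !mxE => ->.
  by apply: eq_bigr => h _; rewrite mxE.
by move=> j _; rewrite bc (unsplitK (inr j)) mul0r.
Qed.

(** The members of an adapted frame are B-foliated, since the transverse components of
    their brackets with sections of ann E^* involve only a2_hg^j. A cut-off makes the
    coefficients global. *)
Lemma ann_spanned : spanned_by_B_foliated L annB.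
Proof.
move=> x0; have [c ac cx] := exists_adapted E x0.
have Le := sframe_local c; set e := sframe c in Le *.
have [chi [chi1 chi0]] := exists_bump (sdom_open c) cx.
have [S ES] := exists_extends Le (proj2 cx).
have nS : \forall y \near x0, fdom e y /\ extends e y S by exact: extends_near Le (proj2 cx) ES.
have [U [oU Ux] HU] := near_open (filterI chi1 (filterI (sdom_near cx) nS)).
exists U; split=> // t.
have St (b : 'I_(k + s)) y : sdom c y -> snear y (fun z => fcoord e b (t z)).
  by move=> cy; exact: fcoord_section_snear.
have [f Hf] := choice (fun b => cutoff_cfun chi0 (St b)).
exists (k + s)%N, f, S; split=> [g b bB x Ux'|x Ux']; last first.
  have [/= c1 [_ [ex Ex]]] := HU x Ux'.
  rewrite {1}(frame_expand (frame_basis Le ex) (memvf (t x))); apply: eq_bigr => b _.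
  by rewrite Hf c1 mul1r (nbhs_singleton (Ex b)).
have [_ [cx' [ex Ex]]] := HU x Ux'.
apply/(ann_coord _ ac cx') => j.
rewrite (fcoord_bracketW hW b (S g) _ cx' : fcoord _ _ (bracket L b (S g) x) = _) /bracket_comp.
rewrite (tderiv_near_cst _ (fcoord_ext_near g _ Le ex Ex)).
rewrite (tderiv_near_cst _ (ann_section_near j ac cx' bB)) qform_ann ?subrr //.
by move=> i; exact: nbhs_singleton (ann_section_near i ac cx' bB).
Qed.

Lemma ann_corresponds : corresponds L annB E W.
Proof.
split=> [x xi|]; last exact: algebroidW_differential.
split=> [xiE b /annihilatorP|H]; first exact.
have [c ac cx] := exists_adapted E x; have [Fc ae] := ac.
have [z [fz dz ze]] := adapted_dual_to ae; have ex := proj2 cx.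
have be := frame_basis (sframe_local c) ex.
have [_ _ bz] := foliated_bases_local fz.
apply (@dual_to_biannihilator _ _ _ _ _ _ _ z (sframe c) x be (ze x ex) (E x) xi).
  by apply: bz; rewrite dz.
move=> h; apply: H; apply/(ann_coord _ ac cx) => j.
by rewrite (fcoord_fsec _ _ be) eq_rlshift.
Qed.

Lemma couple_to_algebroid : exists (L : lie_algebroid A) (B : subbundle A k),
  [/\ foliated_lie_algebroid F L B, corresponds L B E W &
    forall (L' : lie_algebroid A) (B' : subbundle A k),
      foliated_lie_algebroid F L' B' -> corresponds L' B' E W -> L' = L /\ B' = B].
Proof.
exists L, annB; split; [|exact: ann_corresponds|].
  by split; [exact: ann_subalgebroid|exact: ann_anchor|exact: ann_spanned].
move=> L' B' _ [EB' dL']; split.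
  exact: differential_algebroid_eq (algebroidW_differential hW) dL'.
by apply: subbundle_eq => x; symmetry; apply: annihilator_eq => xi; exact: EB'.
Qed.

End AlgebroidOfCouple.

(** * Parallel frames of the conormal bundle *)

Section ConormalBundle.
Variables (R : realType) (p q : nat) (M : manifold R (p + q)) (F : foliation M).
Variables (k s : nat) (A : vbundle M (k + s)) (L : lie_algebroid A) (B : subbundle A k).
Implicit Types (x y : M) (c : scoord A) (z : lframe (dual A) s).

(** Evaluation at v as a linear form on the dual, so that the annihilator of B is an
    intersection of kernels. *)
Definition hom_eval x (v : A x) (xi : dual A x) : R^o := (xi : 'Hom(A x, R^o)) v.

Lemma hom_eval_linear x (v : A x) : linear (hom_eval v).
Proof. by move=> a xi xi'; rewrite /hom_eval add_lfunE scale_lfunE. Qed.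

HB.instance Definition _ x (v : A x) :=
  GRing.isLinear.Build R (dual A x) R^o _ (hom_eval v) (hom_eval_linear v).

Definition conormal x : {vspace dual A x} :=
  (\bigcap_(i < \dim (B x)) lker (linfun (hom_eval (vbasis (B x))`_i)))%VS.

Lemma conormalP x (xi : 'Hom(A x, R^o)) :
  xi \in conormal x <-> forall b, b \in B x -> xi b = 0.
Proof.
rewrite memvE; split=> [/subv_bigcapP H b bB|H].
  rewrite (coord_vbasis bB) linear_sum big1 // => i _.
  have := H i isT; rewrite -memvE memv_ker lfunE => /eqP v0.
  by rewrite linearZ /= [X in _ *: X]v0 scaler0.
apply/subv_bigcapP => i _; rewrite -memvE memv_ker lfunE; apply/eqP; apply: H.
by apply: vbasis_mem; apply: mem_nth; rewrite size_tuple.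
Qed.

Lemma extend_B_section x t : (\forall y \near x, t y \in B y) -> secnear x t ->
  exists2 b, section_of B b & \forall y \near x, b y = t y.
Proof.
move=> nB St; have [U [oU Ux] HU] := near_open (filterI nB (secnear_near St)).
have [|b [chi [chi1 bE chi0]]] := exists_section (s := t) oU Ux; first by move=> y /HU[].
exists b; last by apply: filterS chi1 => y cy; rewrite bE cy scale1r.
move=> y; rewrite bE; have [/HU[tB _]|nU] := pselect (U y); first exact: memvZ.
by rewrite chi0 // scale0r mem0v.
Qed.

Lemma B_section_through x v : v \in B x -> exists2 b, section_of B b & b x = v.
Proof.
move=> vB; have [e [oe Se be] ex] := subfib_local B x.
have [||b bB bE] := @extend_B_section x (fun y => \sum_i fcoord e i v *: fsec e i y).
- have := open_nbhs_nbhs (conj oe ex); apply: filterS => y ey.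
  by apply: memv_suml => i _; apply: memvZ; exact: fsec_in (be y ey).
- apply: secnear_sum => i _; first exact: snear_cst.
  exact: secnear_on oe ex (Se i).
by exists b => //; rewrite (nbhs_singleton bE) -(frame_expand (be x ex) vB).
Qed.

(** The members of z are parallel for the Bott connection of B on ann B, (nabla_b xi)(a)
    = (sharp b)(xi(a)) - xi([b, a]). *)
Definition bott_parallel z := forall b a : section A, section_of B b ->
  forall x, fdom z x -> forall i,
  tderiv x (anchor L x (b x)) (fun y => (fsec z i y : 'Hom(A y, R^o)) (a y))
  = (fsec z i x : 'Hom(A x, R^o)) (bracket L b a x).

Lemma conormal_coord_snear z x (xi : forall y, dual A y) i : local_basis conormal z -> fdom z x ->
  (\forall y \near x, xi y \in conormal y) -> secnear x xi -> snear x (fun y => fcoord z i (xi y)).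
Proof.
move=> [oz Sz bz] zx nxi Sxi.
have nz : \forall y \near x, fdom z y by apply: open_nbhs_nbhs.
have [|e [Le ex eP ze]] := dual_completion (fun i => secnear_on oz zx (Sz i)) _ (filterI nxi nz).
  exact: basis_free (bz x zx).
apply: snear_ext (snear_pair Sxi (fsec_secnear (rshift k i) Le ex)).
apply: filterS (frame_near Le ex) => y ey; have [xiC zy] := eP y ey.
rewrite {1}(frame_expand (bz y zy) xiC) sum_lfunE (bigD1 i) //= scale_lfunE ze // eqxx.
rewrite big1 ?addr0 => [|j ji]; first by rewrite [LHS]mulr1.
by rewrite scale_lfunE ze // (inj_eq (@rshift_inj _ _)) (negbTE ji) scaler0.
Qed.

Section Transition.
Variables (z z' : lframe (dual A) s).
Hypotheses (lz : local_basis conormal z) (lz' : local_basis conormal z').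

Lemma transition_snear i j x : fdom z x -> fdom z' x ->
  snear x (fun y => fcoord z' i (fsec z j y)).
Proof.
move=> zx z'x; have [oz Sz bz] := lz; apply: (conormal_coord_snear i lz' z'x).
  by have := open_nbhs_nbhs (conj oz zx); apply: filterS => y zy; exact: fsec_in (bz y zy).
exact: secnear_on oz zx (Sz j).
Qed.

Lemma transition_expand j x : fdom z x -> fdom z' x ->
  fsec z j x = \sum_i fcoord z' i (fsec z j x) *: fsec z' i x.
Proof.
move=> zx z'x; have [_ _ bz] := lz; have [_ _ bz'] := lz'.
by apply: (frame_expand (bz' x z'x)); exact: fsec_in (bz x zx).
Qed.

Lemma transition_deriv j x v (a : section A) : fdom z x -> fdom z' x ->
  tderiv x v (fun y => (fsec z j y : 'Hom(A y, R^o)) (a y)) =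
  \sum_i (fcoord z' i (fsec z j x)
      * tderiv x v (fun y => (fsec z' i y : 'Hom(A y, R^o)) (a y))
    + (fsec z' i x : 'Hom(A x, R^o)) (a x) * tderiv x v (fun y => fcoord z' i (fsec z j y))).
Proof.
move=> zx z'x; have [oz _ _] := lz; have [oz' Sz' _] := lz'.
rewrite (tderiv_ext _ (g := fun y => \sum_i fcoord z' i (fsec z j y)
    * (fsec z' i y : 'Hom(A y, R^o)) (a y))); last first.
  apply: filterS2 (open_nbhs_nbhs (conj oz zx)) (open_nbhs_nbhs (conj oz' z'x)) => y zy z'y.
  rewrite {1}(transition_expand j zy z'y) sum_lfunE; apply: eq_bigr => i _.
  by rewrite scale_lfunE.
have Sa i : snear x (fun y => (fsec z' i y : 'Hom(A y, R^o)) (a y)).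
  by apply: snear_pair; [exact: secnear_on oz' z'x (Sz' i)|exact: section_secnear].
have ST i := transition_snear i j zx z'x.
rewrite tderiv_sum => [|i _]; last exact: snearM (ST i) (Sa i).
by apply: eq_bigr => i _; rewrite (tderivM _ (ST i) (Sa i)).
Qed.

End Transition.

Hypothesis FL : foliated_lie_algebroid F L B.

(** If T is the transition matrix from z to z', parallelism of both gives sum_l (sharp
    b)(T_l) z'_l = 0, hence (sharp b)(T_l) = 0, and every tangent vector to a leaf is of
    the form sharp b. *)
Lemma bott_parallel_transition z z' : local_basis conormal z -> local_basis conormal z' ->
  bott_parallel z -> bott_parallel z' -> foliated_transition F z z'.
Proof.
move=> lz lz' pz pz' i j; have [oz _ _] := lz; have [oz' _ bz'] := lz'.
apply/foliated_onP; first exact: openI.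
  by move=> x [zx z'x]; exact: transition_snear.
move=> x v [zx z'x] lv; have [_ anch _] := FL.
have /memv_imgP[b0 b0B ->] : v \in (anchor L x @: B x)%VS by apply/anch.
have [b bB <-] := B_section_through b0B.
pose D l := tderiv x (anchor L x (b x)) (fun y => fcoord z' l (fsec z j y)).
suff D0 : \sum_l D l *: (fsec z' l x : 'Hom(A x, R^o)) = 0.
  have := basis_free (bz' x z'x) => /(@freeP _ _ _ (ftup z' x))/(_ D); apply.
  by rewrite -[RHS]D0; apply: eq_bigr => l _; rewrite ftup_nth.
apply/lfunP => w; have [a <-] := section_through w; rewrite lfunE /= sum_lfunE.
have := pz b a bB x zx j; rewrite (transition_deriv lz lz') //.
rewrite {2}(transition_expand lz lz' j zx z'x) sum_lfunE big_split /=.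
have -> : \sum_l fcoord z' l (fsec z j x) *
     tderiv x (anchor L x (b x)) (fun y => (fsec z' l y : 'Hom(A y, R^o)) (a y)) =
  \sum_l (fcoord z' l (fsec z j x) *: (fsec z' l x : 'Hom(A x, R^o))) (bracket L b a x).
  by apply: eq_bigr => l _; rewrite scale_lfunE pz'.
move=> /eqP; rewrite -subr_eq0 addrAC subrr add0r => /eqP E0.
by rewrite -[RHS]E0; apply: eq_bigr => l _; rewrite scale_lfunE [LHS]mulrC.
Qed.

(** Combinations of parallel forms with coefficients constant on the leaves are
    parallel. *)
Lemma foliated_transition_parallel z : local_basis conormal z ->
  (forall x, fdom z x -> exists z', [/\ fdom z' x, local_basis conormal z', bott_parallel z' &
     foliated_transition F z z']) -> bott_parallel z.
Proof.
move=> lz H b a bB x zx j; have [z' [z'x lz' pz' tz]] := H x zx.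
have [oz _ _] := lz; have [oz' _ _] := lz'; have [_ anch _] := FL.
have lv : leaf_tangent F x (anchor L x (b x)) by apply/anch/memv_img/bB.
rewrite (transition_deriv lz lz') //.
rewrite [in RHS](transition_expand lz lz' j zx z'x) sum_lfunE; apply: eq_bigr => i _.
have -> : tderiv x (anchor L x (b x)) (fun y => fcoord z' i (fsec z j y)) = 0.
  have/foliated_onP := tz i j; apply => //; first exact: openI.
  by move=> y [zy z'y]; exact: transition_snear.
by rewrite mulr0 addr0 pz' // scale_lfunE.
Qed.

(** The values at x0 of B-foliated sections span the fibre, because those sections
    generate all sections over a neighbourhood. So a basis of B can be completed at x0
    by such values, and the completed family is still a frame near x0. *)
Lemma exists_B_frame x0 : exists e : lframe A (k + s), [/\ local_frame e, fdom e x0,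
  forall y, fdom e y -> forall v : A y, v \in B y <-> forall j, fcoord e (rshift k j) v = 0 &
  forall j, exists2 a : section A, B_foliated_on L B (fdom e) a &
     forall y, fsec e (rshift k j) y = a y].
Proof.
have [_ _ sp] := FL; have [U [oU Ux0 HU]] := sp x0.
have [eb lb ebx] := subfib_local B x0; have [ob Sb bb] := lb.
have [t Tt tx] := triv_cover A x0; have Lt := triv_local_frame Tt.
have [S ES] := exists_extends Lt tx.
have Hspan i : exists d : {m : nat & 'I_m -> section A},
    (forall j, B_foliated_on L B U (tagged d j)) /\
    S i x0 \in <<[seq tagged d j x0 | j <- enum 'I_(tag d)]>>%VS.
  have [m [f [a [aB aE]]]] := HU (S i).
  exists (Tagged (fun m => 'I_m -> section A) a); split=> //=.
  rewrite aE //; apply: memv_suml => j _; apply: memvZ; apply: memv_span.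
  by apply/mapP; exists j => //; rewrite mem_enum.
have [d Hd] := choice Hspan.
pose Y : seq (section A) :=
  flatten [seq [seq tagged (d i) j | j <- enum 'I_(tag (d i))] | i <- enum 'I_(k + s)].
pose Yx : seq (A x0) := [seq (w : section A) x0 | w <- Y].
have YxE : Yx =
    flatten [seq [seq tagged (d i) j x0 | j <- enum 'I_(tag (d i))] | i <- enum 'I_(k + s)].
  by rewrite /Yx map_flatten -map_comp; congr flatten; apply: eq_map => i /=; rewrite -map_comp.
have YB n : (n < size Y)%N -> B_foliated_on L B U (nth (section0 A) Y n).
  have allB : all (fun w => `[< B_foliated_on L B U w >]) Y.
    rewrite /Y; elim: (enum 'I_(k + s)) => //= i l IH; rewrite all_cat IH andbT all_map.
    by apply/allP => j _ /=; apply/asboolP; exact: (proj1 (Hd i)).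
  by move=> nY; apply/asboolP; exact: (all_nthP _ allB).
have [I [Ilt If Isp]] := free_extend Yx (basis_free (bb x0 ebx)).
set Z := ftup eb x0 ++ _ in If Isp.
have Zfull : <<Z>>%VS = fullv.
  apply/eqP; rewrite eqEsubv subvf -(span_basis (frame_basis Lt tx)).
  apply/span_subvP => v /mapP[i _ ->]; apply: (subvP Isp).
  rewrite -(nbhs_singleton (ES i)); move: (proj2 (Hd i)); apply/subvP/sub_span => w wi.
  by rewrite YxE; apply/flattenP; exists [seq tagged (d i) j x0 | j <- enum 'I_(tag (d i))] => //;
     apply/mapP; exists i => //; rewrite mem_enum.
have sI : size I = s.
  have := size_basis (frame_basis Lt tx); rewrite -Zfull (eqP If) size_cat size_tuple size_map.
  by move/addnI.
pose a (j : 'I_s) := nth (section0 A) Y (nth 0%N I j).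
(* The frame consists of the given basis of B followed by the selected B-foliated
    sections. *)
pose w i : forall y, A y :=
  match fintype.split i with inl h => fsec eb h | inr j => a j end.
have wl h : w (lshift s h) = fsec eb h by rewrite /w (unsplitK (inl h)).
have wr j : w (rshift k j) = a j by rewrite /w (unsplitK (inr j)).
have Sw i : secnear x0 (w i).
  have [h ->|j ->] := split_ordP i; first by rewrite wl; exact: secnear_on ob ebx (Sb h).
  by rewrite wr; exact: section_secnear.
have wZ : [tuple w i x0 | i < k + s] = Z :> seq _.
  apply: (@eq_from_nth _ 0); first by rewrite size_cat !size_tuple size_map sI.
  rewrite size_tuple => n0 lt_n; rewrite -[n0]/(nat_of_ord (Ordinal lt_n)).
  move: (Ordinal lt_n) => i; rewrite -tnth_nth tnth_mktuple nth_cat size_tuple.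
  have [h ->|j ->] := split_ordP i.
    by rewrite wl ftup_nth.
  rewrite wr /= addKn (nth_map 0%N) ?sI // (nth_map (section0 A)) //.
  by rewrite -(size_map (fun u : section A => u x0)); apply: (all_nthP _ Ilt); rewrite sI.
have wB : basis_of fullv [tuple w i x0 | i < k + s].
  by rewrite wZ; apply/andP; split=> //; rewrite Zfull.
have nP : \forall y \near x0, fdom eb y /\ U y.
  by apply: filterI; apply: open_nbhs_nbhs.
have [V [Vx LV VP]] := local_frame_near Sw wB nP.
exists (LFrame V w); split=> // [y Vy v|j].
  have be := frame_basis LV Vy; have [eby _] := VP y Vy; split=> [vB j|v0]; last first.
    rewrite (lcoord0_expand be v0); apply: memv_suml => h _; apply: memvZ.
    by rewrite /= wl; exact: fsec_in (bb y eby).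
  rewrite (frame_expand (bb y eby) vB).
  pose f (i : 'I_(k + s)) := if fintype.split i is inl h then fcoord eb h v else 0.
  rewrite (_ : \sum_i _ = \sum_i f i *: fsec (LFrame V w) i y).
    by rewrite (fcoord_sum _ _ be) /f (unsplitK (inr j)).
  rewrite big_split_ord /= [X in _ = _ + X]big1 => [|i _].
    by rewrite addr0; apply: eq_bigr => h _; rewrite wl /f (unsplitK (inl h)).
  by rewrite /f (unsplitK (inr i)) scale0r.
exists (a j) => [b bB y /VP[_ Uy]|y]; last by rewrite /= wr.
apply: YB => //; rewrite -(size_map (fun u : section A => u x0)).
by apply: (all_nthP _ Ilt); rewrite sI.
Qed.

Section BFrame.
Variable e : lframe A (k + s).
Hypothesis Le : local_frame e.
Hypothesis eB : forall y, fdom e y -> forall v : A y,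
  v \in B y <-> forall j, fcoord e (rshift k j) v = 0.

Definition conormal_frame : lframe (dual A) s :=
  LFrame (fdom e) (fun j => fsec (dual_frame e) (rshift k j)).

Lemma conormal_frame_dual y : fdom e y -> dual_to conormal_frame e y.
Proof.
by move=> ey i j; rewrite dual_fsecE (fcoord_fsec _ _ (frame_basis Le ey)).
Qed.

Lemma conormal_frame_basis : local_basis conormal conormal_frame.
Proof.
have [oe _ _] := Le; split=> // [i|x ex].
  by apply: (smooth_section_of (A := dual A)) => x ex; exact: dual_fsec_secnear.
have be := frame_basis Le ex; have ze := conormal_frame_dual ex.
apply/andP; split.
  apply/eqP/vspaceP => xi; apply/idP/idP => [/(coord_span (X := ftup conormal_frame x)) ->|].
    apply: memv_suml => i _; apply: memvZ; apply/conormalP => b /(eB ex) b0.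
    by rewrite ftup_nth dual_fsecE.
  move=> /conormalP xi0; rewrite (dual_to_expand be ze (xi := xi)) => [|h].
    apply: memv_suml => i _; apply: memvZ; apply: memv_span.
    by rewrite -ftup_nth; apply: mem_nth; rewrite size_tuple.
  by apply: xi0; apply/(eB ex) => j; rewrite (fcoord_fsec _ _ be) eq_rlshift.
apply/(@freeP _ _ _ (ftup conormal_frame x)) => f f0 j.
have /(congr1 (fun xi : 'Hom(A x, R^o) => xi (fsec e (rshift k j) x))) := f0.
rewrite sum_lfunE lfunE /= (bigD1 j) //= big1 => [|i ij]; last first.
  rewrite scale_lfunE -[X in _ *: X]/((ftup conormal_frame x)`_i _) ftup_nth ze.
  by rewrite (inj_eq (@rshift_inj _ _)) (negbTE ij) scaler0.
rewrite addr0 scale_lfunE -[X in _ *: X]/((ftup conormal_frame x)`_j _) ftup_nth ze eqxx.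
by move=> <-; rewrite [RHS]mulr1.
Qed.

Hypothesis eF : forall j, exists2 a : section A, B_foliated_on L B (fdom e) a &
  forall y, fsec e (rshift k j) y = a y.

Lemma B_frame_bracket x E b l : fdom e x -> extends e x E -> section_of B b ->
  bracket L b (E l) x \in B x.
Proof.
move=> ex Ex bB; have [sub _ _] := FL.
have [h hE|j jE] := split_ordP l.
  have [||b' b'B b'E] := @extend_B_section x (fsec e (lshift s h)).
  - apply: filterS (frame_near Le ex) => y ey; apply/(eB ey) => j.
    by rewrite (fcoord_fsec _ _ (frame_basis Le ey)) eq_rlshift.
  - exact: fsec_secnear.
  rewrite (@bracket_near_r _ _ _ _ _ _ _ _ b'); first exact: sub.
  by apply: filterS2 b'E (Ex l) => y -> ->; rewrite hE.
have [a aB aE] := eF j; rewrite (@bracket_near_r _ _ _ _ _ _ _ _ a); first exact: aB.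
by apply: filterS (Ex l) => y ->; rewrite jE aE.
Qed.

(** The bracket of a section b of B with a member of the frame is in B, so that only the
    terms that differentiate the components of a remain in xi([b, a]). *)
Lemma conormal_frame_parallel : bott_parallel conormal_frame.
Proof.
move=> b a bB x ex i; have [E Ex] := exists_extends Le ex; have be := frame_basis Le ex.
under eq_fun do rewrite dual_fsecE; rewrite dual_fsecE.
rewrite (bracket_expand_r L b a Le ex Ex) /fcoord linear_sum /=.
under eq_bigr => l _.
  rewrite linearD !linearZ /= -!/(fcoord _ _ _).
  have /(eB ex)/(_ i) -> := B_frame_bracket l ex Ex bB.
  by rewrite mulr0 add0r (fcoord_fsec _ _ be); over.
by rewrite /= (bigD1 (rshift k i)) //= eqxx mulr1 big1 ?addr0 // => l li;
   rewrite eq_sym (negbTE li) mulr0.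
Qed.

End BFrame.

Lemma exists_parallel x : exists z, [/\ fdom z x, local_basis conormal z & bott_parallel z].
Proof.
have [e [Le ex eB eF]] := exists_B_frame x.
by exists (conormal_frame e); split=> //; [exact: conormal_frame_basis|exact: conormal_frame_parallel].
Qed.

Lemma conormal_local x : exists2 z : lframe (dual A) s, local_basis conormal z & fdom z x.
Proof. by have [z [zx lz _]] := exists_parallel x; exists z. Qed.

Definition conormal_subbundle : subbundle (dual A) s := Subbundle conormal_local.

Definition parallel_bases : set (lframe (dual A) s) :=
  [set z | local_basis conormal z /\ bott_parallel z].

Lemma parallel_cover x : exists2 z, parallel_bases z & fdom z x.
Proof. by have [z [zx lz pz]] := exists_parallel x; exists z. Qed.

Lemma parallel_transition z z' : parallel_bases z -> parallel_bases z' ->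
  foliated_transition F z z'.
Proof. by case=> lz pz [lz' pz']; exact: bott_parallel_transition. Qed.

Lemma parallel_max z : local_basis conormal_subbundle z ->
  (forall z', parallel_bases z' -> foliated_transition F z z') -> parallel_bases z.
Proof.
move=> lz H; split=> //; apply: foliated_transition_parallel => // x zx.
by have [z' [lz' pz'] z'x] := parallel_cover x; exists z'; split=> //; exact: H.
Qed.

Definition foliated_conormal : foliated_subbundle F (dual A) s :=
  @FoliatedSubbundle _ _ _ _ _ _ _ _ conormal_subbundle parallel_bases
    (fun z pz => proj1 pz) parallel_cover parallel_transition parallel_max.

Local Notation EB := foliated_conormal.

Section AdaptedCoordinates.
Variable c : scoord A.
Hypothesis ac : adapted EB c.
Let e := sframe c.
Let ch := schart c.
Let Le : local_frame e := sframe_local c.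
Let Fch : fcharts F ch := proj1 ac.
Let Ach := schart_atlas c.

Lemma adapted_B y (v : A y) : fdom e y ->
  v \in B y <-> forall j, fcoord e (rshift k j) v = 0.
Proof.
move=> ey; rewrite -(@annihilator_eq _ _ _ _ _ _ _ _ EB B y) => [|xi]; last exact: conormalP.
exact: adapted_annihilator (proj2 ac) ey.
Qed.

Lemma adapted_lshift_B y h : fdom e y -> fsec e (lshift s h) y \in B y.
Proof.
move=> ey; apply/(adapted_B _ ey) => j.
by rewrite (fcoord_fsec _ _ (frame_basis Le ey)) eq_rlshift.
Qed.

Lemma adapted_parallel b a x j : section_of B b -> fdom e x ->
  fcoord e (rshift k j) (bracket L b a x) =
  tderiv x (anchor L x (b x)) (fun y => fcoord e (rshift k j) (a y)).
Proof.
move=> bB ex; have [z [[lz pz] dz ze]] := adapted_dual_to (proj2 ac).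
rewrite -(dual_to_coord (frame_basis Le ex) (ze x ex)) -pz ?dz //; apply: tderiv_ext.
apply: filterS (frame_near Le ex) => y ey.
by rewrite (dual_to_coord (frame_basis Le ey) (ze y ey)).
Qed.

(** The forms z_j have constant values on the members of the frame, so parallelism
    annihilates the transverse components of these brackets. *)
Lemma adapted_bracket_B x E b g : fdom e x -> extends e x E -> section_of B b ->
  bracket L b (E g) x \in B x.
Proof.
move=> ex Ex bB; apply/(adapted_B _ ex) => j; rewrite adapted_parallel //.
by apply: tderiv_near_cst; exact: (fcoord_ext_near g _ Le ex Ex).
Qed.

Lemma anchor_B_tcomp x (b : A x) a : sdom c x -> b \in B x ->
  tcomp ch x (anchor L x b) (lshift q a) = 0.
Proof.
move=> [cx ex] bB; have [_ anch _] := FL.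
by apply: (proj1 (anch x _) (memv_img _ bB)).
Qed.

Lemma adapted_anchor_coef0 x h a : sdom c x -> anchor_coef L ch e (lshift s h) (lshift q a) x = 0.
Proof. by move=> cx; apply: anchor_B_tcomp => //; apply: adapted_lshift_B; case: cx. Qed.

Lemma adapted_structure_coef0 x h g j : sdom c x -> structure_coef L e (lshift s h) g (rshift k j) x = 0.
Proof.
move=> [_ ex]; have Ex := frame_extP Le ex.
have [||b bB bE] := @extend_B_section x (fsec e (lshift s h)).
- by apply: filterS (frame_near Le ex) => y ey; exact: adapted_lshift_B.
- exact: fsec_secnear.
rewrite /structure_coef /structure_fun (@bracket_near _ _ _ _ _ L _ b _ (frame_ext e x g)).
- by move/(adapted_B _ ex): (adapted_bracket_B g ex Ex bB).
- by apply: filterS2 bE (Ex (lshift s h)) => y -> ->.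
- exact: nearW.
Qed.

(** Derivatives along leaves are derivatives along anchors of global sections of B, to
    which the axioms of the algebroid apply. *)
Lemma leaf_tangent_section x v : leaf_tangent F x v ->
  exists2 b, section_of B b & v = anchor L x (b x).
Proof.
have [_ anch _] := FL; move=> /anch/memv_imgP[b0 /B_section_through[b bB bE] ->].
by exists b => //; rewrite bE.
Qed.

(** Let w be a section of B. The bracket [w, e_b] is in B, so its anchor has no
    transverse component. This anchor is the bracket of the vector fields sharp w and
    sharp e_b; as sharp w has no transverse component either, what remains is the
    derivative of rho_b^a along sharp w. *)
Lemma adapted_anchor_coef_foliated x v b a : sdom c x -> leaf_tangent F x v ->
  tderiv x v (anchor_coef L ch e b (lshift q a)) = 0.
Proof.
move=> cx /leaf_tangent_section[w wB ->]; have [chx ex] := cx; have Ex := frame_extP Le ex.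
have Sw i : snear x (fun y => tcomp ch y (anchor L y (w y)) i).
  by apply: snear_on (@cdom_open _ _ _ ch) chx _; exact: (anchor_smooth L w Ach i).
have SE i : snear x (fun y => tcomp ch y (anchor L y (frame_ext e x b y)) i).
  by apply: snear_on (@cdom_open _ _ _ ch) chx _; exact: (anchor_smooth L (frame_ext e x b) Ach i).
have := anchor_B_tcomp a cx (adapted_bracket_B b ex Ex wB).
rewrite (anchor_bracket L w _ Ach chx) /lie_bracket_comp.
under eq_bigr => j _.
  rewrite [X in _ - _ * X](_ : _ = 0); last first.
    have w0 : \forall y \near x, tcomp ch y (anchor L y (w y)) (lshift q a) = 0.
      by apply: filterS (sdom_near cx) => y cy; exact: anchor_B_tcomp.
    by rewrite -[LHS]/(dv _ _ (delta_mx ord0 j) _) (dv_ext _ chx w0) dv_cst.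
  by rewrite mulr0 subr0; over.
rewrite /= -(tderivE _ Ach chx (SE _)) => <-; apply: tderiv_ext.
by apply: filterS (Ex b) => y Ey; rewrite /anchor_coef Ey.
Qed.

(** By parallelism, the derivative of C_bg^j along sharp w is the transverse component
    of [w, [e_b, e_g]]. By the Jacobi identity this bracket is a sum of brackets of
    members of the frame with sections of B, hence in B. *)
Lemma adapted_structure_coef_foliated x v b g j : sdom c x -> leaf_tangent F x v ->
  tderiv x v (structure_coef L e b g (rshift k j)) = 0.
Proof.
move=> cx /leaf_tangent_section[w wB ->]; have [chx ex] := cx.
have Ex := frame_extP Le ex; set E := frame_ext e x in Ex.
rewrite (tderiv_ext _ (g := fun y => fcoord e (rshift k j) (bracket L (E b) (E g) y))); last first.
  by apply: filterS (extends_near Le ex Ex) => y [ey Ey]; exact: structure_coefE.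
rewrite -adapted_parallel //.
have bw f : \forall y \near x, bracket L w (E f) y \in B y.
  by apply: filterS (extends_near Le ex Ex) => y [ey Ey]; exact: adapted_bracket_B.
have dbl f (t : section A) : (\forall y \near x, t y \in B y) -> bracket L (E f) t x \in B x.
  move=> tB; have [w' w'B w'E] := extend_B_section tB (section_secnear t (x := x)).
  rewrite (@bracket_near_r _ _ _ _ _ _ _ _ w'); last by apply: filterS w'E => y ->.
  by rewrite bracket_anti memvN; exact: adapted_bracket_B.
have wb f : \forall y \near x, bracket L (E f) w y \in B y.
  by apply: filterS (bw f) => y; rewrite bracket_anti memvN.
have J : bracket L w (bracket L (E b) (E g)) x \in B x.
  have /eqP := jacobi L w (E b) (E g) x; rewrite -addrA addr_eq0 => /eqP ->.
  by rewrite memvN memvD ?dbl.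
by move/(adapted_B _ ex): J.
Qed.

End AdaptedCoordinates.

End ConormalBundle.

(** * From a foliated Lie algebroid to a couple *)

Section Projectability.
Variables (R : realType) (p q : nat) (M : manifold R (p + q)) (F : foliation M) (k s : nat).
Implicit Types (x y : M) (D : set M).

(** The criterion, monomial by monomial: either the coefficient vanishes, or the
    monomial is transverse and the coefficient is constant on the leaves. *)
Lemma projectable_sum D (T : finType) (f : T -> M -> R) (X : T -> grassmann R (k + s)) G :
  open D -> (forall t x, D x -> snear x (f t)) ->
  (forall x, D x -> G x = \sum_t f t x *: X t) ->
  (forall t, (forall x, D x -> f t x = 0) \/
    ((forall (I : {set 'I_(k + s)}) h, lshift s h \in I -> X t I = 0) /\
     (forall x v, D x -> leaf_tangent F x v -> tderiv x v (f t) = 0))) ->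
  projectable_function F D G.
Proof.
move=> oD Sf GE H.
have GI I x : D x -> G x I = \sum_t f t x * X t I.
  by move=> Dx; rewrite GE // sum_ffunE; apply: eq_bigr => t _; rewrite ffunE.
have nD x : D x -> \forall y \near x, D y by move=> Dx; apply: open_nbhs_nbhs.
have SfX t I x : D x -> snear x (fun y => f t y * X t I).
  by move=> Dx; apply: snearM; [exact: Sf|exact: snear_cst].
split=> [I h hI x Dx|I].
  rewrite GI // big1 // => t _; have [f0|[X0 _]] := H t; first by rewrite f0 // mul0r.
  by rewrite (X0 I h hI) mulr0.
have nGI x : D x -> \forall y \near x, \sum_t f t y * X t I = G y I.
  by move=> Dx; apply: filterS (nD x Dx) => y Dy; rewrite GI.
apply/foliated_onP => // [x Dx|x v Dx lv].
  by apply: snear_ext (nGI x Dx) _; apply: snear_sum => t _; exact: SfX.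
rewrite -(tderiv_ext _ (nGI x Dx)) tderiv_sum => [|t _]; last exact: SfX.
apply: big1 => t _; have [f0|[_ f0]] := H t.
  by apply: (@tderiv_near_cst _ _ _ _ _ _ 0); apply: filterS (nD x Dx) => y Dy; rewrite f0 ?mul0r.
by rewrite tderivM ?tderiv_cst ?f0 ?mulr0 ?addr0 //; [exact: Sf|exact: snear_cst].
Qed.

Lemma geta_rshift_lshift (h : 'I_k) (j : 'I_s) (I : {set 'I_(k + s)}) :
  lshift s h \in I -> geta R (rshift k j) I = 0.
Proof.
move=> hI; rewrite ffunE; case: eqP => // IE; move: hI.
by rewrite IE finset.inE eq_lrshift.
Qed.

Lemma gmul_eta_rshift_lshift (h : 'I_k) (i j : 'I_s) (I : {set 'I_(k + s)}) :
  lshift s h \in I -> gmul (geta R (rshift k i)) (geta R (rshift k j)) I = 0.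
Proof.
move=> hI; rewrite gmul_etaE; case: ifP => // _.
rewrite (@geta_rshift_lshift h) ?mulr0 //.
by rewrite !finset.inE hI andbT eq_lrshift.
Qed.

End Projectability.

Section FieldOfFoliatedAlgebroid.
Variables (R : realType) (p q : nat) (M : manifold R (p + q)) (F : foliation M).
Variables (k s : nat) (A : vbundle M (k + s)) (L : lie_algebroid A) (B : subbundle A k).
Hypothesis FL : foliated_lie_algebroid F L B.
Implicit Types (x y : M) (c : scoord A) (z : lframe (dual A) s).

Local Notation EB := (foliated_conormal FL).
Local Notation W := (field_of L).

Lemma field_of_projectable : projectable EB W.
Proof.
move=> c ac; split=> [a|j].
  apply: (@projectable_sum _ _ _ _ _ _ _ _ _ (fun b => diff_a1 L c b (lshift q a)) (fun b => geta R b)).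
  - exact: sdom_open.
  - by move=> b x; exact: diff_a1_snear.
  - by [].
  - move=> b; have [h ->|i ->] := split_ordP b.
      by left=> x cx; exact: (adapted_anchor_coef0 ac).
    right; split=> [I h|x v cx lv]; first exact: geta_rshift_lshift.
    exact: (adapted_anchor_coef_foliated ac).
apply: (@projectable_sum _ _ _ _ _ _ _ _ _
  (fun bg x => 2^-1 * diff_a2 L c bg.1 bg.2 (rshift k j) x)
  (fun bg => gmul (geta R bg.1) (geta R bg.2))).
- exact: sdom_open.
- by move=> bg x cx; apply: snearM; [exact: snear_cst|exact: diff_a2_snear].
- by move=> x cx; rewrite -[LHS]/(gbil _) /gbil pair_big.
- move=> [b g] /=; have [h ->|i ->] := split_ordP b.
    by left=> x cx; rewrite /diff_a2 (adapted_structure_coef0 ac) ?oppr0 ?mulr0.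
  have [h ->|i' ->] := split_ordP g.
    by left=> x cx; rewrite /diff_a2 structure_coef_anti (adapted_structure_coef0 ac) ?oppr0 ?mulr0.
  right; split=> [I h|x v cx lv]; first exact: gmul_eta_rshift_lshift.
  have Sf := diff_a2_snear L (rshift k i) (rshift k i') (rshift k j) cx.
  rewrite tderivM ?tderiv_cst ?mulr0 ?addr0 //; last exact: snear_cst.
  have [_ ex] := cx; rewrite /diff_a2 tderivN; last exact: structure_coef_snear (sframe_local c) ex.
  by rewrite (adapted_structure_coef_foliated ac) ?oppr0 ?mulr0.
Qed.

Section Restricted.
Variable c : scoord A.
Hypothesis ac : adapted EB c.

Let r1 (h : 'I_k) := diff_a1 L c (lshift s h).
Let r2 (h h' l : 'I_k) := diff_a2 L c (lshift s h) (lshift s h') (lshift s l).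

Lemma restr_field_form : degree1_form (sdom c) (restr_field c W) r2 r1.
Proof.
have [S2 S1 an _ _] := diff_form L c.
split=> [h h' l|h i|h h' l x cx|l x cx|i x cx].
- exact: S2.
- exact: S1.
- exact: an.
- by rewrite /= restr_gbil.
- by rewrite /= restr_glin.
Qed.

(** Since C_hh'^j = 0, the sums over all indices in the equations of W reduce to sums
    over the indices of B. *)
Lemma restr_field_homological : homological_on (schart c) (sdom c) (restr_field c W).
Proof.
apply/(homological_eqs (schart_atlas c) (sdom_open c) (@sdom_sub _ _ _ _ _ c) restr_field_form).
have /(homological_eqs (schart_atlas c) (sdom_open c) (@sdom_sub _ _ _ _ _ c) (diff_form L c)) H :=
  proj2 (field_of_homological L) c.
move=> x cx; have [H1 H2] := H x cx.
have a20 h g j : diff_a2 L c (lshift s h) g (rshift k j) x = 0.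
  by rewrite /diff_a2 (adapted_structure_coef0 ac) ?oppr0.
split=> [b g i|b g d l].
  rewrite -[RHS](H1 (lshift s b) (lshift s g) i); congr (_ + _).
  rewrite [RHS]big_split_ord /= [X in _ = _ + X]big1 ?addr0 //.
  by move=> j _; rewrite a20 mul0r.
have JE (b' g' d' : 'I_k) : jacobi_term (schart c) r2 r1 x b' g' d' l =
    jacobi_term (schart c) (diff_a2 L c) (diff_a1 L c) x
      (lshift s b') (lshift s g') (lshift s d') (lshift s l).
  rewrite /jacobi_term; congr (_ + _); rewrite [RHS]big_split_ord /=.
  rewrite [X in _ = _ + X]big1 ?addr0 //.
  by move=> j _; rewrite a20 mul0r.
by rewrite !JE; exact: H2.
Qed.

Lemma restr_field_transitive : transitive_form (sdom c) r1.
Proof.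
move=> x cx; have [chx ex] := cx; set N := \matrix_(_, _) _; have Fch := proj1 ac.
apply/eqP; rewrite -/(row_full N) -sub1mx; apply/row_subP => i; set w := row i _.
(* The leaf-tangent vector with leaf components w; a preimage in B gives the row of
    coefficients. *)
pose v := tvec (schart c) x (row_mx 0 w).
have lv : leaf_tangent F x v.
  by apply: (leaf_tangent_chart Fch chx) => a; rewrite tcomp_tvec ?row_mxEl ?mxE //; exact: schart_atlas.
have [_ anch _] := FL; have /memv_imgP[b bB vE] : v \in (anchor L x @: B x)%VS by apply/anch.
apply/submxP; exists (\row_h fcoord (sframe c) (lshift s h) b); apply/rowP => u.
have := tcomp_tvec (row_mx 0 w) (rshift p u) (schart_atlas c) chx.
rewrite -/v vE row_mxEr => <-.
have be := frame_basis (sframe_local c) ex.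
rewrite {1}(lcoord0_expand be (proj1 (adapted_B ac _ ex) bB)) linear_sum.
rewrite /tcomp tderiv_suml; last exact: snear_coordf (schart_atlas c) chx.
rewrite mxE; apply: eq_bigr => h _; rewrite linearZ tderivZl; last exact: snear_coordf (schart_atlas c) chx.
by rewrite !mxE.
Qed.

Lemma restr_field_in_TFbar : restr_in_TFbar c W.
Proof.
move=> x cx; split=> [a|j].
  rewrite /= restr_glin -[RHS](@glin0 R k); apply: eq_glin => h; exact: (adapted_anchor_coef0 ac).
rewrite /= restr_gbil -[RHS](@gbil0 R k); apply: eq_gbil => h h'.
by rewrite /diff_a2 (adapted_structure_coef0 ac) ?oppr0 ?mulr0.
Qed.

Lemma restr_field_tangent : restr_tangent c W.
Proof.
move=> x cx j; have VF := diff_form L c.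
have Eeta : geta R (rshift k j) = glin (fun b : 'I_(k + s) => (rshift k j == b)%:R).
  by rewrite /glin sum_delta_l.
rewrite (sfapply_glin (schart_atlas c) (sdom_sub cx) (fun i => form_sfx VF i cx)
   (fun l => form_sfeta VF l cx) (t := fun b _ => (rshift k j == b)%:R)); first last.
- by move=> b; exact: snear_cst.
- by rewrite Eeta; exact: nearW.
rewrite restr_gbil -[RHS](@gbil0 R k); apply: eq_gbil => h h'.
rewrite big1 => [|i _]; last first.
  by rewrite -[pderiv _ _ _ _]/(dv _ _ _ _) dv_cst mulr0.
rewrite add0r big1 // => l _; case: eqP => [<-|_]; last by rewrite mulr0.
by rewrite /diff_a2 (adapted_structure_coef0 ac) ?oppr0 ?mulr0 ?mul0r.
Qed.

End Restricted.

Lemma field_of_super_couple : super_couple EB W.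
Proof.
split; [exact: field_of_homological|exact: field_of_projectable|].
move=> c ac; split.
- exact: restr_field_in_TFbar.
- exact: restr_field_tangent.
- exact: restr_field_homological.
- eexists; eexists; split; [exact: restr_field_form|exact: restr_field_transitive].
Qed.

Lemma field_of_corresponds : corresponds L B EB W.
Proof. by split; [exact: conormalP|exact: field_of_differential]. Qed.

Section Uniqueness.
Variables (E : foliated_subbundle F (dual A) s) (V : sfield A).
Hypotheses (SC : super_couple E V) (EV : corresponds L B E V).

Lemma couple_fib x : EB x = E x.
Proof.
have [EC _] := EV; apply/vspaceP => xi; apply/idP/idP => H.
  by apply/EC/conormalP.
by apply/conormalP/EC.
Qed.

Lemma couple_local_basis z : local_basis (conormal B) z <-> local_basis E z.
Proof.
have EC : (conormal B : forall x, {vspace dual A x}) = E.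
  by apply: functional_extensionality_dep => x; exact: couple_fib.
by rewrite EC.
Qed.

(** In coordinates adapted to the foliated basis z, projectability of the field gives
    C_hg^j = 0, which is the parallelism of z. *)
Lemma couple_bases_parallel z : foliated_bases E z -> bott_parallel L B z.
Proof.
move=> fz b a bB x zx i.
have [e [ae ex _ _ ze]] := exists_adapted_frame fz zx (nearW _ (fun=> I) : \forall y \near x, True).
have [ch Fch chx] := fcharts_cover F x; have Le : local_frame e by case: ae.
pose c := SCoord (fcharts_atlas Fch) Le; have ac : adapted E c by [].
have cx : sdom c x by [].
have [EC dV] := EV.
have st0 h g : structure_coef L e (lshift s h) g (rshift k i) x = 0.
  apply: oppr_inj; rewrite oppr0 -[RHS](projectable_coef2 SC h g i ac cx) /coef2.
  by rewrite (differential_sfeta dV _ _ _ cx).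
have b0 y j : fdom e y -> fcoord e (rshift k j) (b y) = 0.
  move=> ey; move: (bB y); rewrite -(annihilator_eq (EC y)).
  by move/(adapted_annihilator _ ae ey).
rewrite (dual_to_coord (frame_basis Le ex) (ze x ex)).
rewrite (tderiv_ext _ (g := fun y => fcoord e (rshift k i) (a y))); last first.
  by apply: filterS (frame_near Le ex) => y ey; rewrite (dual_to_coord (frame_basis Le ey) (ze y ey)).
have nb : \forall y \near x, fcoord e (rshift k i) (b y) = 0.
  by apply: filterS (frame_near Le ex) => y ey; exact: b0.
rewrite (fcoord_bracketE _ _ _ _ Le ex) (tderiv_near_cst _ nb) subr0 big1 ?addr0 // => l _.
rewrite big1 // => g _; have [h ->|j ->] := split_ordP l; first by rewrite st0 mulr0.
by rewrite b0 // !mul0r.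
Qed.

Lemma couple_unique : E = EB /\ sfield_eq V W.
Proof.
have [_ dV] := EV; split; last exact: differential_sfield_eq (field_of_differential L) dV.
apply: foliated_subbundle_eq => [x|z]; first exact: couple_fib.
split=> [[lz pz]|fz]; last first.
  split; last exact: couple_bases_parallel.
  by apply/couple_local_basis; exact: foliated_bases_local.
apply: foliated_bases_max => [|z' fz']; first exact/couple_local_basis.
apply: (bott_parallel_transition FL) => //; last exact: couple_bases_parallel.
by apply/couple_local_basis; exact: foliated_bases_local.
Qed.

End Uniqueness.

Lemma algebroid_to_couple : exists (E : foliated_subbundle F (dual A) s) (W : sfield A),
  [/\ super_couple E W, corresponds L B E W &
    forall (E' : foliated_subbundle F (dual A) s) (W' : sfield A),
      super_couple E' W' -> corresponds L B E' W' -> E' = E /\ sfield_eq W' W].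
Proof.
exists EB, W; split; [exact: field_of_super_couple|exact: field_of_corresponds|].
by move=> E' W'; exact: couple_unique.
Qed.

End FieldOfFoliatedAlgebroid.

Theorem proposition3p3 (R : realType) (p q k s : nat)
    (M : manifold R (p + q)) (F : foliation M) (A : vbundle M (k + s)) :
  (forall (L : lie_algebroid A) (B : subbundle A k),
     foliated_lie_algebroid F L B ->
     exists (E : foliated_subbundle F (dual A) s) (W : sfield A),
       [/\ super_couple E W,
           corresponds L B E W &
           forall (E' : foliated_subbundle F (dual A) s) (W' : sfield A),
             super_couple E' W' -> corresponds L B E' W' ->
             E' = E /\ sfield_eq W' W]) /\
  (forall (E : foliated_subbundle F (dual A) s) (W : sfield A),
     super_couple E W ->
     exists (L : lie_algebroid A) (B : subbundle A k),
       [/\ foliated_lie_algebroid F L B,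
           corresponds L B E W &
           forall (L' : lie_algebroid A) (B' : subbundle A k),
             foliated_lie_algebroid F L' B' -> corresponds L' B' E W ->
             L' = L /\ B' = B]).
Proof.
by split; [exact: algebroid_to_couple|exact: couple_to_algebroid].
Qed.
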